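(* For every fixed integer $J\ge 1$ there are $x_0(J)$ and a function $\varepsilon_J(x)$ with $\varepsilon_J(x)\to 0$ as $x\to\infty$ such that, for $x\ge x_0(J)$, with $$T_J=\frac{G}{\sqrt J},\qquad y_J=e^{T_J},\qquad Y_J=e^{\sqrt J\,G},$$ one has, uniformly for positive integers $1\le h\le y_J$, $$S_h^\varphi(x)=D_{h,>Y_J}^\varphi(x)+O_J\!\left(x\exp\{-\sqrt J\,G+\varepsilon_J(x)V\}\right).$$ If $h$ is odd, then $D_{h,>Y_J}^\varphi(x)=0$.
   Context: $\varphi$ is Euler's totient function; $P^+(m)$ is the largest prime factor of $m$, with $P^+(1)=1$; $\operatorname{rad}(m)$ is the product of the distinct primes dividing $m$; $\log_j x$ is the $j$-fold iterated logarithm. $O_J$ means the implied constant depends only on $J$. Scales: $L=\log x$, $\mathcal A=\log_3 x+\log_4 x-\log 2$, $G=(L\mathcal A)^{1/2}$, $V=L/G$ ($x$ is always large enough that these are defined and $\mathcal A>0$). Count: $S_h^\varphi(x)=\#\{n\le x:\varphi(n)=\varphi(n+h)\}$ ($n$ a positive integer). Diagonal: for $h\ge1$ let $\mathcal J_h=\{j\ge1:\operatorname{rad}(j)=\operatorname{rad}(j+h)\}$. For $j\in\mathcal J_h$ put $d_j=\gcd(j,j+h)$, $A_j=(j+h)/d_j$, $B_j=j/d_j$, $\Gamma_j=\varphi(j)A_j$. For $Y\ge2$, $D_{h,>Y}^\varphi(x)$ is the number of integers $n\le x$ for which there is at least one pair $(j,r)$ with $j\in\mathcal J_h$, $r\ge1$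 an integer, $n=j(A_jr+1)$, $n+h=(j+h)(B_jr+1)$, $A_jr+1$ and $B_jr+1$ both prime, $\gcd(A_jr+1,j)=1$, $\gcd(B_jr+1,j+h)=1$, and $P^+(\Gamma_jr)>Y$ (multiple representations of the same $n$ are counted once). *)

(* Defs.v *)
From mathcomp Require Import all_boot all_order all_algebra.
From mathcomp Require Import all_classical all_reals all_analysis.

Set Implicit Arguments.
Unset Strict Implicit.
Unset Printing Implicit Defensive.

Import Order.TTheory GRing.Theory Num.Theory.
Import numFieldNormedType.Exports.

Local Open Scope ring_scope.

Section Scales.
Context {R : realType}.
Implicit Types (x : R) (J : nat).

Definition scaleL x : R := ln x.

Definition scaleA x : R := iter 3 (@ln R) x + iter 4 (@ln R) x - ln 2.

Definition scaleG x : R := Num.sqrt (scaleL x * scaleA x).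

Definition scaleV x : R := scaleL x / scaleG x.

Definition scaleT J x : R := scaleG x / Num.sqrt J%:R.

Definition scaley J x : R := expR (scaleT J x).

Definition scaleY J x : R := expR (Num.sqrt J%:R * scaleG x).

End Scales.

Local Open Scope nat_scope.

Definition rad (m : nat) : nat := \prod_(p <- primes m) p.

Definition diag_index (h j : nat) : Prop := 0 < j /\ rad j = rad (j + h).

Definition diag_gcd (h j : nat) : nat := gcdn j (j + h).

Definition diag_A (h j : nat) : nat := (j + h) %/ diag_gcd h j.

Definition diag_B (h j : nat) : nat := j %/ diag_gcd h j.

Definition diag_Gamma (h j : nat) : nat := totient j * diag_A h j.

(* [max_pdiv 1 = 1], so [max_pdiv] is P^+ with its convention at 1. *)
Definition diag_repr {R : realType} (h : nat) (Y : R) (n j r : nat) : Prop :=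
  [/\ diag_index h j, 0 < r,
      n = j * (diag_A h j * r + 1) /\
      n + h = (j + h) * (diag_B h j * r + 1),
      prime (diag_A h j * r + 1) /\ prime (diag_B h j * r + 1) &
      [/\ coprime (diag_A h j * r + 1) j,
          coprime (diag_B h j * r + 1) (j + h) &
          (Y < (max_pdiv (diag_Gamma h j * r))%:R)%R]].

(* The positive integers n <= x are those of [iota 1 (Num.truncn x)]. *)
Definition count_upto {R : realType} (x : R) (P : nat -> Prop) : nat :=
  count (fun n => `[< P n >]) (iota 1 (Num.truncn x)).

Definition S_phi {R : realType} (h : nat) (x : R) : nat :=
  count_upto x (fun n => totient n = totient (n + h)).

Definition D_phi {R : realType} (h : nat) (Y x : R) : nat :=
  count_upto x (fun n => exists j r : nat, diag_repr h Y n j r).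

(* Main.v *)
(** Let [y = e^T] with [T = G / sqrt J], and let the rough part of an integer be
    its divisor composed of primes above [y].  A solution [n] of
    [phi(n) = phi(n + h)] that is not counted on the diagonal falls into one of
    five classes, each of size at most [x exp(- J T + o(V))].
    - All primes [p] dividing [n], or all those dividing [n + h], are sparse: the
      rough part of [p - 1] is below [y^K].  Rankin's method with exponent
      [s = 1 - (A - e) / T] gains [J T - o(V)] because [J T^2 = L A], and the sum
      of [p^-s] over sparse primes is [o(V)]: writing [p - 1 = a l] with [l] the
      largest prime factor of its smooth part, Brun's sieve for the pair
      [(l, a l + 1)] saves one more logarithm.
    - [n] or [n + h] is divisible by [t^2] for some [t >= y^J].
    - [n = a q] and [n + h = b q'], where [q] and [q'] are the largest primes,
      with [phi(a) b <> phi(b) a] and [a b <= x e^(- J T)]: the pair [(a, b)]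
      determines [n].
    - [phi(a) b = phi(b) a].  Then [a] and [b] have the same radical and [n] is
      diagonal unless [q - 1] has no prime factor above [y^J], which is rare,
      again by Rankin's method.
    - Otherwise [p p' <= 2 x e^(J T)] for all primes [p | n] and [p' | n + h].  A
      non-sparse [p | n] exists, and the rough part of [p - 1] divides
      [phi(n + h)], hence is spread over the [p' - 1].  A few [p'] suffice to
      collect common divisors of [p - 1] and [p' - 1] with product at least
      [y^(2 J)], and the resulting congruences on [p] save this factor. *)
Require Import Defs.
From mathcomp Require Import all_boot all_order all_algebra.
From mathcomp Require Import all_classical all_reals all_analysis.
From mathcomp Require Import zify ring lra.

Set Implicit Arguments.
Unset Strict Implicit.
Unset Printing Implicit Defensive.

Import Order.TTheory GRing.Theory Num.Theory.
Import numFieldNormedType.Exports.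

(** * Counting, radicals and totients *)

Local Open Scope nat_scope.

(** The [- log 2] in [A] comes from an exact balance. With [L = log x] one has
    [e^A = log L * log log L / 2]. For [y = e^T] and [delta = eta / T], the sum of [p^(delta - 1)]
    over primes [p <= y] is about [log T + e^eta / eta], so [eta = A] makes the Euler product over
    these primes about [T L^(1/2)]. Since [V = (L / A)^(1/2)], the choice [eta = A - e] lowers the
    exponent [1/2] to some [k < 1/2], and [L^k] times any power of [log L] is [o(V)]. The factor
    [T], itself about [L^(1/2)], would ruin this; it is cancelled by the [1 / T] that the sieve
    gives for primes [l] with [a l + 1] prime. A sieve losing powers of [log L] is good enough here,
    so Brun's pure sieve suffices. The margin [e] costs [e L / T = e sqrt(J) V]. For each fixed
    [eps] this gives an error [eps V] with a multiplicative constant independent of [eps], and that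
    uniformity is what allows [eps] to become a function tending to 0. *)

Definition cnt (N : nat) (P : nat -> Prop) : nat :=
  count (fun n => `[< P n >]) (iota 1 N).

Lemma cnt_le N (P Q : nat -> Prop) :
  (forall n, 0 < n <= N -> P n -> Q n) -> cnt N P <= cnt N Q.
Proof.
move=> PQ; rewrite /cnt -!size_filter; apply: uniq_leq_size; first by rewrite filter_uniq ?iota_uniq.
move=> n; rewrite !mem_filter => /andP[/asboolP Pn nN]; rewrite nN andbT.
by apply/asboolP; apply: PQ => //; move: nN; rewrite mem_iota; lia.
Qed.

Lemma cnt_or N (P Q : nat -> Prop) :
  cnt N (fun n => P n \/ Q n) <= cnt N P + cnt N Q.
Proof.
rewrite /cnt -count_predUI (leq_trans _ (leq_addr _ _)) //.
apply: sub_count => n /asboolP [Hn|Hn]; apply/orP; [left|right]; exact/asboolP.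
Qed.

Lemma cnt_ex (T : eqType) N (s : seq T) (P : T -> nat -> Prop) :
  cnt N (fun n => exists2 i, i \in s & P i n) <= \sum_(i <- s) cnt N (P i).
Proof.
elim: s => [|i s IHs].
  rewrite big_nil leqn0 /cnt; apply/eqP/eqP; rewrite -leqn0 leqNgt -has_count.
  by apply/hasPn => n _; apply/asboolPn => -[].
rewrite big_cons; apply: leq_trans (leq_add (leqnn _) IHs).
apply: leq_trans (cnt_or _ _ _); apply: cnt_le => n _ [j].
rewrite inE => /orP[/eqP->|js] Pj; first by left.
by right; exists j.
Qed.

Lemma cnt_inj (T : eqType) N (P : nat -> Prop) (f : nat -> T) (t : seq T) :
  (forall n, 0 < n <= N -> P n -> f n \in t) ->
  (forall m n, 0 < m <= N -> 0 < n <= N -> P m -> P n -> f m = f n -> m = n) ->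
  cnt N P <= size t.
Proof.
move=> ft finj; rewrite /cnt -size_filter -(size_map f).
have mem_s n : n \in [seq x <- iota 1 N | `[< P x >]] -> 0 < n <= N /\ P n.
  by rewrite mem_filter mem_iota => /andP[/asboolP Pn] nN; split=> //; lia.
apply: uniq_leq_size.
  rewrite map_inj_in_uniq ?filter_uniq ?iota_uniq // => m n.
  by move=> /mem_s[mN Pm] /mem_s[nN Pn]; apply: finj.
by move=> y /mapP[n /mem_s[nN Pn] ->]; apply: ft.
Qed.

Lemma cnt_spaced N q (P : nat -> Prop) : 0 < q ->
  (forall m n, 0 < m <= N -> 0 < n <= N -> P m -> P n -> m = n %[mod q]) ->
  cnt N P <= N %/ q + 1.
Proof.
move=> q0 Pq; rewrite -[X in _ <= X](size_iota 0).
apply: (@cnt_inj _ _ _ (fun n => n %/ q)) => [n nN _|m n mN nN Pm Pn mn].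
  by rewrite mem_iota /= add0n addn1 ltnS leq_div2r //; lia.
by rewrite (divn_eq m q) (divn_eq n q) mn (Pq m n).
Qed.

Lemma cnt_shift N h (P : nat -> Prop) :
  cnt N (fun n => P (n + h)) <= cnt (N + h) P.
Proof.
rewrite [X in _ <= X]/cnt -size_filter.
apply: (@cnt_inj _ _ _ (fun n => n + h)) => [n nN Pn|m n _ _ _ _ /addIn //].
by rewrite mem_filter mem_iota; apply/andP; split; [exact/asboolP|lia].
Qed.

(** [prad m] is the totient of the radical and [excess m] is [m / rad m]. Both [m] and its totient
    carry the same factor [excess m], so ratios of totients see only the radicals. *)
Definition prad (m : nat) := \prod_(p <- primes m) p.-1.
Definition excess (m : nat) := \prod_(p <- primes m) p ^ (logn p m).-1.

Lemma prod_primes_logn m : 0 < m -> m = \prod_(p <- primes m) p ^ logn p m.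
Proof. by move=> m0; rewrite {1}(prod_prime_decomp m0) prime_decompE big_map. Qed.

Lemma primesP p m : p \in primes m -> [/\ prime p, 0 < m & p %| m].
Proof. by rewrite mem_primes => /and3P. Qed.

Lemma logn_primes_gt0 p m : p \in primes m -> 0 < logn p m.
Proof. by rewrite logn_gt0. Qed.

Lemma excess_rad m : 0 < m -> m = excess m * Defs.rad m.
Proof.
move=> m0; rewrite {1}(prod_primes_logn m0) -big_split /=.
apply: eq_big_seq => p /logn_primes_gt0; case: (logn p m) => // k _.
by rewrite expnSr.
Qed.

Lemma totient_excess m : 0 < m -> totient m = excess m * prad m.
Proof.
move=> m0; rewrite totientE // big_split /= mulnC; congr (_ * _).
Qed.

Lemma excess_gt0 m : 0 < excess m.
Proof.
rewrite /excess big_seq; apply: prodn_cond_gt0 => p /primesP[pp _ _].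
by rewrite expn_gt0 prime_gt0.
Qed.

Lemma dvdn_prod_seq (T : eqType) (s : seq T) (F G : T -> nat) :
  (forall i, i \in s -> F i %| G i) -> \prod_(i <- s) F i %| \prod_(i <- s) G i.
Proof.
move=> FG; rewrite !big_seq; apply: (big_ind2 (fun a b => a %| b)) => //.
by move=> *; apply: dvdn_mul.
Qed.

Lemma leq_prod_seq (T : eqType) (s : seq T) (F G : T -> nat) :
  (forall i, i \in s -> F i <= G i) -> \prod_(i <- s) F i <= \prod_(i <- s) G i.
Proof.
move=> FG; rewrite !big_seq; apply: (big_ind2 (fun a b => a <= b)) => //.
by move=> *; apply: leq_mul.
Qed.

(** Halve every exponent [k] of [m]: [2 (k / 2) <= k], while [k - 1 <= 2 (k / 2)]. Hence an integer
    without large square divisors has a small [excess]. *)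
Lemma excess_square m : 0 < m -> exists t, t ^ 2 %| m /\ excess m <= t ^ 2.
Proof.
move=> m0; exists (\prod_(p <- primes m) p ^ (logn p m)./2).
have -> : (\prod_(p <- primes m) p ^ (logn p m)./2) ^ 2 =
    \prod_(p <- primes m) p ^ ((logn p m)./2 * 2).
  by rewrite expnS expn1 -big_split /=; apply: eq_bigr => p _;
    rewrite -expnD; congr (_ ^ _); lia.
split.
  rewrite [X in _ %| X](prod_primes_logn m0); apply: dvdn_prod_seq => p _.
  by apply: dvdn_exp2l; lia.
apply: leq_prod_seq => p /primesP[pp _ _].
by rewrite leq_exp2l ?prime_gt1 //; lia.
Qed.

(** Greedy: the factor assigned to [c] is [g = gcdn D (F c)]; as [D / g] is coprime to [F c / g], it
    divides the remaining product. This later spreads the rough part of [p - 1] over the numbers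
    [q - 1]. *)
Lemma dvdn_prod_split (T : eqType) (s : seq T) (F : T -> nat) D :
  uniq s -> 0 < D -> D %| \prod_(c <- s) F c ->
  exists d : T -> nat, D = \prod_(c <- s) d c /\ forall c, c \in s -> d c %| F c.
Proof.
elim: s D => [|c s IHs] D /=.
  by move=> _ _; rewrite big_nil dvdn1 => /eqP->; exists (fun=> 1); rewrite big_nil.
case/andP=> cs us D0; rewrite big_cons => Ddv.
set g := gcdn D (F c).
have g0 : 0 < g by rewrite gcdn_gt0 D0.
have gD : g %| D by rewrite dvdn_gcdl.
have Dg0 : 0 < D %/ g by rewrite divn_gt0 // dvdn_leq.
have Dg : D %/ g %| \prod_(c <- s) F c.
  have cop : coprime (D %/ g) (F c %/ g).
    by rewrite /coprime -(eqn_pmul2r g0) muln_gcdl !divnK ?dvdn_gcdl ?dvdn_gcdr // mul1n.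
  rewrite -(Gauss_dvdr _ cop) -(dvdn_pmul2r g0) divnK // mulnAC divnK //.
  exact: dvdn_gcdr.
have [d [dE dF]] := IHs _ us Dg0 Dg.
exists (fun x => if x == c then g else d x); rewrite big_cons eqxx; split.
  rewrite -[LHS](divnK gD) mulnC dE; congr (_ * _).
  by apply: eq_big_seq => x xs; case: eqP => // xc; rewrite -xc xs in cs.
move=> x; rewrite inE; case: eqP => [-> _|_] /=; first exact: dvdn_gcdr.
exact: dF.
Qed.

Lemma prime_dvd_prod (T : eqType) p (s : seq T) (F : T -> nat) : prime p ->
  p %| \prod_(i <- s) F i -> exists2 i, i \in s & p %| F i.
Proof.
move=> pp; elim: s => [|i s IHs]; first by rewrite big_nil Euclid_dvd1.
rewrite big_cons Euclid_dvdM // => /orP[pF|/IHs[j js pF]].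
  by exists i => //; rewrite inE eqxx.
by exists j => //; rewrite inE js orbT.
Qed.

Lemma dvdn_prod_mem (T : eqType) (s : seq T) (F : T -> nat) i :
  i \in s -> F i %| \prod_(j <- s) F j.
Proof. by move=> si; rewrite (big_rem i) //= dvdn_mulr. Qed.

(** The largest prime [M] divides the right side. It cannot divide the left one: each [p - 1] there
    is below [M], and [M] is not among the primes of [B]. *)
Lemma disjoint_prime_prods (A B : seq nat) M : all prime (A ++ B) ->
  M \in A -> (forall p, p \in A ++ B -> p <= M) ->
  (forall p, p \in A -> p \notin B) ->
  (\prod_(p <- A) p.-1) * (\prod_(p <- B) p) <>
  (\prod_(p <- B) p.-1) * (\prod_(p <- A) p).
Proof.
move=> /allP AB MA Mmax dis eqn.
have pM : prime M by apply: AB; rewrite mem_cat MA.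
have : M %| (\prod_(p <- A) p.-1) * (\prod_(p <- B) p).
  by rewrite eqn dvdn_mull //; apply: (dvdn_prod_mem (fun p => p)).
rewrite Euclid_dvdM // => /orP[] /(prime_dvd_prod pM)[p ps Mp].
  have pp : prime p by apply: AB; rewrite mem_cat ps.
  have pleM : p <= M by apply: Mmax; rewrite mem_cat ps.
  have p1 := prime_gt1 pp.
  by have := dvdn_leq _ Mp; lia.
have pp : prime p by apply: AB; rewrite mem_cat ps orbT.
move: Mp; rewrite dvdn_prime2 // => /eqP Mp.
by have := dis _ MA; rewrite Mp ps.
Qed.

Lemma exists_max_mem (s : seq nat) : s != [::] ->
  exists2 M, M \in s & forall p, p \in s -> p <= M.
Proof.
case: s => // x s _; elim: s x => [|y s IHs] x.
  by exists x; rewrite ?inE // => p; rewrite inE => /eqP->.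
have [M Ms Mm] := IHs x.
have [yM|My] := leqP y M.
  exists M; first by move: Ms; rewrite !inE => /orP[->|->]; rewrite ?orbT.
  move=> p; rewrite !inE => /or3P[/eqP->|/eqP->|ps] //; apply: Mm.
    by rewrite inE eqxx.
  by rewrite inE ps orbT.
exists y; first by rewrite !inE eqxx orbT.
move=> p; rewrite !inE => /or3P[/eqP->|/eqP->|ps] //.
  by rewrite (leq_trans _ (ltnW My)) // Mm // inE eqxx.
by rewrite (leq_trans _ (ltnW My)) // Mm // inE ps orbT.
Qed.

(** After cancelling [excess] and the common primes, the equation relates two disjoint sets of
    primes. If their union is nonempty, its largest element gives a contradiction. *)
Lemma totient_ratio_primes a b : 0 < a -> 0 < b ->
  totient a * b = totient b * a -> primes a = primes b.
Proof.
move=> a0 b0 eqab.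
have {eqab} eqab : prad a * Defs.rad b = prad b * Defs.rad a.
  move: eqab; rewrite !totient_excess //.
  have ea := excess_gt0 a; have eb := excess_gt0 b.
  have aE := excess_rad a0; have bE := excess_rad b0 => H.
  apply/eqP; rewrite -(eqn_pmul2l ea) -(eqn_pmul2l eb); apply/eqP.
  nia.
pose A := [seq p <- primes a | p \notin primes b].
pose B := [seq p <- primes b | p \notin primes a].
have sp F m n : \prod_(p <- primes m) F p =
    (\prod_(p <- primes m | p \in primes n) F p) *
    \prod_(p <- [seq p <- primes m | p \notin primes n]) F p :> nat.
  by rewrite (bigID (mem (primes n))) /= big_filter.
have com F : \prod_(p <- primes a | p \in primes b) F p =
    \prod_(p <- primes b | p \in primes a) F p :> nat.
  rewrite -!(big_filter (primes _)); apply: perm_big.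
  apply: uniq_perm; rewrite ?filter_uniq ?primes_uniq // => p.
  by rewrite !mem_filter andbC.
have allAB : all prime (A ++ B).
  apply/allP => p; rewrite mem_cat !mem_filter.
  by case/orP => /andP[_ ps]; have [] := primesP ps.
have disAB p : p \in A -> p \notin B.
  by rewrite mem_filter => /andP[_ ps]; rewrite mem_filter ps.
have disBA p : p \in B -> p \notin A.
  by rewrite mem_filter => /andP[_ ps]; rewrite mem_filter ps.
have eqAB : (\prod_(p <- A) p.-1) * (\prod_(p <- B) p) =
  (\prod_(p <- B) p.-1) * (\prod_(p <- A) p).
  move: eqab; rewrite /prad /Defs.rad (sp (fun p => p.-1) a b) (sp (fun p => p) b a).
  rewrite (sp (fun p => p.-1) b a) (sp (fun p => p) a b) -!com.
  set c1 := \prod_(p <- primes a | p \in primes b) p.-1.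
  set c2 := \prod_(p <- primes a | p \in primes b) p.
  have c10 : 0 < c1.
    rewrite /c1 big_seq_cond; apply: prodn_cond_gt0 => p /andP[pa _].
    have [pp _ _] := primesP pa.
    by have := prime_gt1 pp; lia.
  have c20 : 0 < c2.
    rewrite /c2 big_seq_cond; apply: prodn_cond_gt0 => p /andP[pa _].
    have [pp _ _] := primesP pa.
    exact: prime_gt0.
  rewrite -/A -/B => H; apply/eqP.
  rewrite -(eqn_pmul2l c10) -(eqn_pmul2l c20); by apply/eqP; nia.
have AB0 : A ++ B = [::].
  apply/eqP/negPn/negP => /exists_max_mem[M MAB Mmax].
  move: (MAB); rewrite mem_cat => /orP[MA|MB].
    exact: (disjoint_prime_prods allAB MA Mmax disAB).
  apply: (@disjoint_prime_prods B A M) => //.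
  - by rewrite all_cat andbC -all_cat.
  - by move=> p; rewrite mem_cat orbC -mem_cat; apply: Mmax.
have inj p : (p \in primes a) = (p \in primes b).
  have : p \notin A ++ B by rewrite AB0.
  rewrite mem_cat !mem_filter.
  by case: (p \in primes a); case: (p \in primes b).
by apply: (irr_sorted_eq ltn_trans ltnn); rewrite ?sorted_primes.
Qed.

Lemma primes_rad m : primes (Defs.rad m) = primes m.
Proof.
have [->//|m0] := posnP m; first by rewrite /Defs.rad big_nil.
have r0 : 0 < Defs.rad m.
  rewrite /Defs.rad big_seq; apply: prodn_cond_gt0 => p /primesP[pp _ _].
  exact: prime_gt0.
apply: (irr_sorted_eq ltn_trans ltnn); rewrite ?sorted_primes // => p.
apply/idP/idP => [/primesP[pp _ /(prime_dvd_prod pp)[q qm]]|pm].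
  by have /primesP[pq _ _] := qm; rewrite dvdn_prime2 // => /eqP->.
rewrite mem_primes r0 (dvdn_prod_mem (fun p => p)) //.
by have /primesP[-> _ _] := pm.
Qed.

Lemma totient_ratio_rad a b : 0 < a -> 0 < b ->
  Defs.rad a = Defs.rad b -> totient a * b = totient b * a.
Proof.
move=> a0 b0 rab; have pab : primes a = primes b by rewrite -primes_rad rab primes_rad.
have := excess_rad a0; have := excess_rad b0; rewrite -rab !totient_excess //.
have -> : prad a = prad b by rewrite /prad pab.
by nia.
Qed.

(** * Primorials and Mertens' theorems *)

Local Open Scope nat_scope.

Lemma prod_primes_dvd (s : seq nat) M : uniq s -> all prime s ->
  (forall p, p \in s -> p %| M) -> \prod_(p <- s) p %| M.
Proof.
elim: s => [|p s IHs] /=; first by rewrite big_nil dvd1n.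
move=> /andP[ps us] /andP[pp prs] dv; rewrite big_cons Gauss_dvd.
  rewrite dv ?inE ?eqxx //= IHs // => q qs; apply: dv.
  by rewrite inE qs orbT.
rewrite prime_coprime //; apply/negP => /(prime_dvd_prod pp)[q qs].
rewrite dvdn_prime2 //; last exact: (allP prs).
by move/eqP => pq; rewrite pq qs in ps.
Qed.

Definition primorial N := \prod_(1 <= p < N.+1 | prime p) p.

Lemma primorial_gt0 N : 0 < primorial N.
Proof. by apply: prodn_cond_gt0 => p /prime_gt0. Qed.

Lemma primorialS N : primorial N.+1 = primorial N * (if prime N.+1 then N.+1 else 1).
Proof. by rewrite /primorial big_mkcond big_nat_recr //= -big_mkcond. Qed.

Lemma primorial_split m N : m <= N ->
  primorial N = primorial m * \prod_(m.+1 <= p < N.+1 | prime p) p.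
Proof. by move=> mN; rewrite /primorial (@big_cat_nat _ _ _ m.+1). Qed.

(** These primes divide ['C(2m+1, m)], which is at most [4^m] because it occurs twice in the
    binomial expansion of [2^(2m+1)]. *)
Lemma prod_mid_primes m :
  \prod_(m.+2 <= p < m.*2.+2 | prime p) p <= 4 ^ m.
Proof.
have b : 'C(m.*2.+1, m) <= 4 ^ m.
  have : 'C(m.*2.+1, m) + 'C(m.*2.+1, m.+1) <= 2 ^ m.*2.+1.
    have : \sum_(i < m.*2.+2) 'C(m.*2.+1, i) = 2 ^ m.*2.+1.
      rewrite -[2]/(1 + 1) expnDn; apply: eq_bigr => i _.
      by rewrite !exp1n !muln1.
    move=> <-.
    have h1 : m < m.*2.+2 by lia.
    have h2 : m.+1 < m.*2.+2 by lia.
    rewrite (bigD1 (Ordinal h1)) //= (bigD1 (Ordinal h2)) /=; last first.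
      by rewrite -val_eqE /=; lia.
    by rewrite addnA leq_addr.
  have <- : 'C(m.*2.+1, m) = 'C(m.*2.+1, m.+1).
    by rewrite -(@bin_sub _ m.+1); [congr 'C(_, _)|]; lia.
  by rewrite expnS -mul2n expnM (_ : 2 ^ 2 = 4) //; lia.
apply: leq_trans b; apply: dvdn_leq; first by rewrite bin_gt0; lia.
rewrite -big_filter; apply: prod_primes_dvd.
- by rewrite filter_uniq // iota_uniq.
- by apply/allP => p; rewrite mem_filter => /andP[].
move=> p; rewrite mem_filter mem_index_iota => /and3P[pp lo hi].
have fE : 'C(m.*2.+1, m) * (m`! * (m.+1)`!) = (m.*2.+1)`!.
  have le : m <= m.*2.+1 by rewrite -addnn -addnS leq_addr.
  have := bin_fact le; rewrite (_ : m.*2.+1 - m = m.+1) //.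
  by rewrite -addnn -addnS addKn.
have ndv k : k < p -> ~~ (p %| k`!).
  by move=> kp; rewrite fact_prod; apply/negP => /(prime_dvd_prod pp)[i];
     rewrite mem_index_iota => /andP[i0 ik] /dvdn_leq; lia.
have : p %| (m.*2.+1)`!.
  by rewrite dvdn_fact // prime_gt0 //=; lia.
have h1 : m < p by apply: leq_trans lo; rewrite ltnS ltnW.
by rewrite -fE !Euclid_dvdM // (negbTE (ndv m h1)) (gtnNdvd _ lo) // !orbF.
Qed.

(** Induction after Erdős: an odd [N = 2m + 1] is split at [m + 1], and an even [N > 2] is not
    prime. *)
Lemma primorial_le N : primorial N <= 4 ^ N.
Proof.
elim/ltn_ind: N => N IH.
have [N2|N2] := leqP N 2.
  by case: N N2 {IH} => [|[|[|]]] // _; rewrite /primorial unlock.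
have [oN|eN] := boolP (odd N).
  have -> : N = (N./2).*2.+1 by lia.
  rewrite (@primorial_split (N./2).+1) ?ltnS; last by lia.
  apply: leq_trans (leq_mul (IH _ _) (prod_mid_primes _)) _; first by lia.
  by rewrite -expnD leq_exp2l //; lia.
case: N N2 eN IH => // N N2 eN IH; rewrite primorialS ifF ?muln1.
  by apply: leq_trans (IH _ _) _ => //; rewrite leq_exp2l.
apply/negP => /even_prime[] ; lia.
Qed.

Local Open Scope ring_scope.

Section Chebyshev.
Context {R : realType}.
Implicit Types (s delta : R) (N : nat).

Definition lnn (n : nat) : R := ln n%:R.

Lemma lnnM m n : (0 < m)%N -> (0 < n)%N -> lnn (m * n) = lnn m + lnn n.
Proof. by move=> m0 n0; rewrite /lnn natrM lnM ?posrE ?ltr0n. Qed.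

Lemma lnn_ge0 n : 0 <= lnn n.
Proof.
case: n => [|n]; first by rewrite /lnn ln0.
by rewrite ln_ge0 // ler1n.
Qed.

Lemma lnn_le m n : (0 < m)%N -> (m <= n)%N -> lnn m <= lnn n.
Proof.
move=> m0 mn; rewrite ler_ln ?posrE ?ltr0n ?ler_nat //; exact: leq_trans mn.
Qed.

Lemma lnn1 : lnn 1 = 0. Proof. exact: ln1. Qed.

Lemma lnnX m k : (0 < m)%N -> lnn (m ^ k) = lnn m *+ k.
Proof. by move=> m0; rewrite /lnn natrX lnXn // ltr0n. Qed.

Lemma lnnS_le n : (0 < n)%N -> lnn n.+1 - lnn n <= n%:R^-1.
Proof.
move=> n0; have n0' : (0 : R) < n%:R by rewrite ltr0n.
rewrite /lnn -ln_div ?posrE ?ltr0n //.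
have -> : n.+1%:R / n%:R = 1 + n%:R^-1 :> R.
  by rewrite -natr1 mulrDl divff ?gt_eqF // mul1r.
by apply: le_ln1Dx; rewrite (lt_trans _ (_ : 0 < _)) ?invr_gt0 // ltrN10.
Qed.

Lemma lnnS_ge n : (0 < n)%N -> n.+1%:R^-1 <= lnn n.+1 - lnn n.
Proof.
move=> n0; have n0' : (0 : R) < n%:R by rewrite ltr0n.
have n1' : (0 : R) < n.+1%:R by rewrite ltr0n.
rewrite -lerN2 opprB /lnn -ln_div ?posrE //.
have -> : n%:R / n.+1%:R = 1 + (- n.+1%:R^-1) :> R.
  by rewrite -[in LHS](addrK 1 n%:R) natr1 mulrBl divff ?gt_eqF // mul1r.
apply: le_ln1Dx; rewrite ltrN2 invf_lt1 //.
by rewrite ltr1n ltnS.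
Qed.

Lemma big_nat_recr_cond (F : nat -> R) (P : pred nat) N :
  \sum_(1 <= k < N.+2 | P k) F k =
  \sum_(1 <= k < N.+1 | P k) F k + (if P N.+1 then F N.+1 else 0).
Proof. by rewrite big_mkcond big_nat_recr //= -big_mkcond. Qed.

Definition theta N : R := \sum_(1 <= p < N.+1 | prime p) lnn p.

Lemma theta_le N : theta N <= N%:R * ln 4.
Proof.
have -> : theta N = lnn (primorial N).
  rewrite /theta; elim: N => [|N IHN].
    by rewrite /primorial !big_geq // lnn1.
  rewrite big_nat_recr_cond IHN primorialS lnnM ?primorial_gt0 //; last by case: ifP.
  by case: ifP => // _; rewrite lnn1.
apply: le_trans (lnn_le (primorial_gt0 _) (primorial_le N)) _.
by rewrite lnnX // mulr_natl.
Qed.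

Lemma lnn_fact N : lnn N`! = \sum_(1 <= p < N.+1 | prime p) (logn p N`!)%:R * lnn p.
Proof.
have f0 := fact_gt0 N.
transitivity (\sum_(p <- primes N`!) (logn p N`!)%:R * lnn p).
  rewrite {1}(prod_primes_logn f0).
  have : {in primes N`!, forall p, 0 < p}%N by move=> p /primesP[/prime_gt0].
  elim: (primes _) => [|p s IHs] s0; first by rewrite !big_nil lnn1.
  have p0 : (0 < p)%N by rewrite s0 // inE eqxx.
  have s1 : {in s, forall p, 0 < p}%N by move=> q qs; rewrite s0 // inE qs orbT.
  rewrite !big_cons lnnM ?expn_gt0 ?p0 // ?IHs // ?lnnX ?mulr_natl //.
  rewrite big_seq; apply: prodn_cond_gt0 => q /s1 q0; by rewrite expn_gt0 q0.
rewrite -[RHS]big_filter; apply: perm_big; apply: uniq_perm.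
- exact: primes_uniq.
- by rewrite filter_uniq // iota_uniq.
move=> p; rewrite mem_primes mem_filter mem_index_iota f0 /=.
case pp : (prime p) => //=; rewrite ltnS prime_gt0 //=.
apply/idP/idP => [|pN]; last by rewrite dvdn_fact // prime_gt0.
rewrite fact_prod => /(prime_dvd_prod pp)[i]; rewrite mem_index_iota => /andP[i0 iN].
by move/dvdn_leq; lia.
Qed.

Lemma lnn_fact_le N : lnn N`! <= N%:R * lnn N.
Proof.
elim: N => [|N IHN]; first by rewrite mul0r fact0 lnn1.
rewrite factS lnnM ?fact_gt0 //; case: N IHN => [|N] IHN.
  by rewrite fact0 lnn1 addr0 mulr_ge0 // lnn_ge0.
have h : lnn N.+1 <= lnn N.+2 by apply: lnn_le.
apply: le_trans (lerD (lexx _) IHN) _.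
rewrite -[N.+2%:R]natr1 mulrDl mul1r addrC lerD2r ler_wpM2l //.
Qed.

Lemma lnn_fact_ge N : N%:R * lnn N - N%:R <= lnn N`!.
Proof.
elim: N => [|N IHN]; first by rewrite mul0r subr0 fact0 lnn1.
rewrite factS lnnM ?fact_gt0 //; case: N IHN => [|N] IHN.
  by rewrite fact0 !lnn1; lra.
have h := @lnnS_le N.+1 isT.
apply: le_trans (lerD (lexx _) IHN).
have n0 : (0 : R) < N.+1%:R by rewrite ltr0n.
have {}h : N.+1%:R * (lnn N.+2 - lnn N.+1) <= 1.
  by rewrite -ler_pdivlMl // mulr1.
rewrite -[N.+2%:R]natr1; move: h; set a := lnn _; set b := lnn _; set n := N.+1%:R.
lra.
Qed.

Definition mertens N : R := \sum_(1 <= p < N.+1 | prime p) lnn p / p%:R.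

Lemma ln4_le3 : ln (4 : R) <= 3.
Proof.
have -> : (4 : R) = 1 + 3 by ring.
by apply: le_ln1Dx; lra.
Qed.

End Chebyshev.

Local Open Scope ring_scope.

Section MertensFirst.
Context {R : realType}.
Implicit Types (s delta : R) (N : nat).
Local Notation lnn := (@lnn R).
Local Notation mertens := (@mertens R).

Lemma ler_sum_natP (P : pred nat) (F G : nat -> R) m n :
  (forall k, (m <= k < n)%N -> P k -> F k <= G k) ->
  \sum_(m <= k < n | P k) F k <= \sum_(m <= k < n | P k) G k.
Proof.
move=> FG; rewrite big_nat_cond [leRHS]big_nat_cond.
by apply: ler_sum => k /andP[kn Pk]; apply: FG.
Qed.

Lemma sumr_ge0_natP (P : pred nat) (F : nat -> R) m n :
  (forall k, (m <= k < n)%N -> P k -> 0 <= F k) ->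
  0 <= \sum_(m <= k < n | P k) F k.
Proof.
move=> F0; rewrite big_nat_cond.
by apply: sumr_ge0 => k /andP[kn Pk]; apply: F0.
Qed.

Lemma ler_sum_sub (P Q : pred nat) (F : nat -> R) m n :
  (forall k, (m <= k < n)%N -> P k -> Q k) ->
  (forall k, (m <= k < n)%N -> Q k -> 0 <= F k) ->
  \sum_(m <= k < n | P k) F k <= \sum_(m <= k < n | Q k) F k.
Proof.
move=> PQ F0; rewrite big_mkcond [leRHS]big_mkcond /=.
apply: ler_sum_natP => k kn _; case: ifP => [/(PQ _ kn)->//|_].
by case: ifP => // /(F0 _ kn).
Qed.

Lemma natdiv_gt (p N : nat) : (0 < p)%N -> N%:R / p%:R - 1 <= (N %/ p)%:R :> R.
Proof.
move=> p0; have p0' : (0 : R) < p%:R by rewrite ltr0n.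
rewrite lerBlDr natr1 ler_pdivrMr // -natrM ler_nat.
by have := divn_eq N p; have := ltn_pmod N p0; rewrite mulSn; lia.
Qed.

Lemma natdiv_le (p N : nat) : (N %/ p)%:R <= N%:R / p%:R :> R.
Proof.
have [->|p0] := posnP p; first by rewrite divn0 invr0 mulr0.
rewrite ler_pdivlMr ?ltr0n // -natrM ler_nat; exact: leq_trunc_div.
Qed.

(** Keeping only the first term of Legendre's formula, [N * mertens N - theta N <= ln N! <= N ln N];
    Chebyshev's bound, with [ln 4 <= 3], then controls [theta N]. *)
Lemma mertens_le N : (0 < N)%N -> mertens N <= lnn N + 3.
Proof.
move=> N0; have N0' : (0 : R) < N%:R by rewrite ltr0n.
rewrite -(ler_pM2l N0').
have h : N%:R * mertens N - theta N <= lnn N`!.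
  rewrite lnn_fact /mertens /theta mulr_sumr -sumrB.
  apply: ler_sum_natP => p /andP[p1 pN] pp.
  have -> : N%:R * (lnn p / p%:R) - lnn p = (N%:R / p%:R - 1) * lnn p by ring.
  apply: ler_wpM2r; first exact: lnn_ge0.
  apply: le_trans (natdiv_gt _ p1) _.
  rewrite ler_nat logn_fact // big_ltn ?ltnS; last exact: N0.
  by rewrite expn1 leq_addr.
have := theta_le (R := R) N; have := lnn_fact_le (R := R) N.
have l4 : N%:R * ln 4 <= N%:R * 3 :> R by rewrite ler_pM2l // ln4_le3.
rewrite mulrDr => h1 h2; lra.
Qed.

Lemma sum_pow_le p n (N : nat) : (1 < p)%N ->
  \sum_(1 <= k < n.+1) N%:R / (p ^ k)%:R <= N%:R / (p%:R - 1) :> R.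
Proof.
move=> p1; have p1' : (1 : R) < p%:R by rewrite ltr1n.
have p0' : (0 : R) < p%:R by rewrite ltr0n ltnW.
rewrite -mulr_sumr; apply: ler_wpM2l => //.
suff -> : \sum_(1 <= k < n.+1) (p ^ k)%:R^-1 =
    (p%:R - 1)^-1 * (1 - (p ^ n)%:R^-1) :> R.
  by rewrite -[leRHS]mulr1 ler_pM2l ?invr_gt0 ?subr_gt0 // lerBlDr lerDl invr_ge0.
elim: n => [|n IHn]; first by rewrite big_geq // expn0 invr1 subrr mulr0.
rewrite big_nat_recr //= IHn !natrX exprS.
have pn0 : (p%:R ^+ n : R) != 0 by rewrite expf_neq0 // gt_eqF.
by field; rewrite pn0 subr_eq0 !gt_eqF.
Qed.

Lemma sum_logk_le N :
  \sum_(2 <= k < N.+1) lnn k / (k%:R * (k%:R - 1)) <= 2.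
Proof.
(* The majorant imitates the primitive [- (ln t + 1) / t] of [ln t / t^2]; with [+ 2] in place of
   [+ 1] it vanishes at [n = 0] and absorbs the discretisation error. *)
suff : forall n, \sum_(2 <= k < n.+2) lnn k / (k%:R * (k%:R - 1)) <=
    2 - (lnn n.+1 + 2) / n.+1%:R.
  move=> H; case: N => [|n]; first by rewrite big_geq.
  apply: le_trans (H n) _; rewrite lerBlDr lerDl divr_ge0 //.
  by rewrite addr_ge0 ?lnn_ge0.
elim=> [|n IHn]; first by rewrite big_geq // lnn1 add0r divr1 subrr.
rewrite big_nat_recr //=; apply: le_trans (lerD IHn (lexx _)) _.
have h := lnnS_le (R := R) (ltn0Sn n).
have n0 : (0 : R) < n.+1%:R by rewrite ltr0n.
have n1 : (1 : R) <= n.+1%:R by rewrite ler1n.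
move: h; rewrite -[n.+2%:R]natr1; set a := lnn _; set b := lnn _.
set m := n.+1%:R in n0 n1 *; rewrite addrK => h.
have {}h : (a - b) * m <= 1 by rewrite -ler_pdivlMr // mul1r.
rewrite -subr_ge0.
have -> : 2 - (a + 2) / (m + 1) - (2 - (b + 2) / m + a / ((m + 1) * m)) =
  (b * (m + 1) + 2 - a * (m + 1)) / ((m + 1) * m).
  by field; rewrite !gt_eqF //; lra.
by apply: divr_ge0; nra.
Qed.

(** Legendre's formula with full geometric series replaces [1 / p] by
    [1 / (p - 1) = 1 / p + 1 / (p (p - 1))], and the correction sums to at most 2. *)
Lemma mertens_ge N : (0 < N)%N -> lnn N - 3 <= mertens N.
Proof.
move=> N0; have N0' : (0 : R) < N%:R by rewrite ltr0n.
rewrite -(ler_pM2l N0').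
have h : lnn N`! <= N%:R * (mertens N + 2).
  apply: le_trans (_ : _ <= N%:R * \sum_(1 <= p < N.+1 | prime p) lnn p / (p%:R - 1)) _.
    rewrite lnn_fact mulr_sumr; apply: ler_sum_natP => p /andP[p0 pN] pp.
    rewrite mulrCA mulrC; apply: ler_wpM2l; first exact: lnn_ge0.
    apply: le_trans (sum_pow_le N N (prime_gt1 pp)).
    rewrite logn_fact // natr_sum; apply: ler_sum => k _; exact: natdiv_le.
  apply: ler_wpM2l => //.
  apply: le_trans (_ : _ <= mertens N + 
     \sum_(1 <= p < N.+1 | prime p) lnn p / (p%:R * (p%:R - 1))) _.
    rewrite /mertens -big_split /=; apply: ler_sum_natP => p /andP[p0 pN] pp.
    have p1 : (1 : R) < p%:R by rewrite ltr1n prime_gt1.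
    rewrite le_eqVlt; apply/orP; left; apply/eqP.
    by field; rewrite !gt_eqF //; lra.
  rewrite lerD2l; apply: le_trans (sum_logk_le N).
  have [N1|N1] := leqP N 1.
    have -> : N = 1%N by lia.
    by rewrite [leRHS]big_geq // big_mkcond big_nat1.
  rewrite big_ltn_cond ?ltnS //=.
  apply: (@ler_sum_sub _ xpredT) => // p /andP[p0 pN] _.
  have p1 : (1 : R) < p%:R by rewrite ltr1n.
  by apply: divr_ge0; [exact: lnn_ge0|nra].
have := lnn_fact_ge (R := R) N; nra.
Qed.

End MertensFirst.

Local Open Scope ring_scope.

Section MertensSecond.
Context {R : realType}.
Implicit Types (s delta : R) (N : nat).
Local Notation lnn := (@lnn R).
Local Notation mertens := (@mertens R).

Definition wsum (f : nat -> R) N : R :=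
  \sum_(1 <= p < N.+1 | prime p) lnn p / p%:R * f p.

(* Abel summation of [wsum f] against [mertens N = ln N + O(1)]: the boundary term
   has been removed, so that the increments [wdef_step] can be summed. *)
Definition wdef (f : nat -> R) N : R := wsum f N - (mertens N - lnn N) * f N.

(** When [N + 1] is prime, [wsum f] and [mertens * f] jump by the same amount, so the primes
    disappear from the increment. *)
Lemma wdef_step f N : wdef f N.+1 - wdef f N =
  (mertens N - lnn N) * (f N - f N.+1) + (lnn N.+1 - lnn N) * f N.+1.
Proof.
rewrite /wdef /wsum /mertens !big_nat_recr_cond; case: ifP => _; ring.
Qed.

Lemma mertens_bound N : (0 < N)%N -> `|mertens N - lnn N| <= 3.
Proof.
move=> N0; have := mertens_le (R := R) N0; have := mertens_ge (R := R) N0.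
by rewrite ler_norml => h1 h2; apply/andP; split; lra.
Qed.

Lemma lnn_gt0 N : (1 < N)%N -> 0 < lnn N.
Proof. by move=> N1; rewrite ln_gt0 // ltr1n. Qed.

Lemma lnn_lt N : (0 < N)%N -> lnn N < lnn N.+1.
Proof. by move=> N0; rewrite ltr_ln ?posrE ?ltr0n // ltr_nat. Qed.

Lemma ln_diff_le (a b : R) : 0 < a -> 0 < b -> ln a - ln b <= (a - b) / b.
Proof.
move=> a0 b0; rewrite -ln_div ?posrE //.
have -> : a / b = 1 + (a - b) / b by field; rewrite gt_eqF.
apply: le_ln1Dx; rewrite ltr_pdivlMr //; lra.
Qed.

Definition recip_sum N : R := \sum_(1 <= p < N.+1 | prime p) p%:R^-1.

Lemma recip_sumE N : recip_sum N = wsum (fun k => (lnn k)^-1) N.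
Proof.
apply: eq_bigr => p pp; have l0 := lnn_gt0 (prime_gt1 pp).
by rewrite mulrAC divff ?gt_eqF // mul1r.
Qed.

Theorem mertens2 : exists2 C : R, 0 < C & forall N, (2 <= N)%N ->
  ln (lnn N) - C <= recip_sum N /\ recip_sum N <= ln (lnn N) + C.
Proof.
pose f k := (lnn k)^-1.
(* [U] decreases and [W] increases. The term [3 * f] absorbs the Mertens error [|E| <= 3]; the
   fourth unit in [W] pays for replacing [1 / ln N] by [1 / ln (N + 1)], as
   [ln (N + 1) - ln N <= 1]. *)
pose U N := wdef f N + 3 * f N - ln (lnn N).
pose W N := wdef f N - 4 * f N - ln (lnn N).
have step N : (2 <= N)%N -> U N.+1 <= U N /\ W N <= W N.+1.
  move=> N2; have N0 : (0 < N)%N by lia.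
  have := mertens_bound N0; rewrite ler_norml => /andP[E1 E2].
  have := wdef_step f N; rewrite /U /W.
  set E := mertens N - lnn N in E1 E2 *.
  have l0 := lnn_gt0 N2.
  have ll' := lnn_lt N0; have l'0 := lt_trans l0 ll'.
  have d1 : lnn N.+1 - lnn N <= 1.
    by apply: le_trans (lnnS_le N0) _; rewrite invf_le1 ?ltr0n // ler1n.
  have := ln_diff_le l0 l'0; have := ln_diff_le l'0 l0.
  rewrite /f; move: l0 ll' l'0 d1; set l := lnn N; set l' := lnn N.+1.
  set k := ln l; set k' := ln l'; set a := wdef _ _; set b := wdef _ _.
  move=> l0 ll' l'0 d1 h1 h2 h3.
  have f1 : 0 <= l^-1 - l'^-1 by rewrite subr_ge0 lef_pV2 // ltW.
  have e1 : (l - l') / l' = - ((l' - l) * l'^-1) by ring.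
  have e2 : (l' - l) / l = (l' - l) * l'^-1 + (l' - l) * (l^-1 - l'^-1) by ring.
  rewrite e1 in h2; rewrite e2 in h1.
  move: f1 h1 h2 h3; set g := l^-1; set g' := l'^-1; move=> f1 h1 h2 h3.
  have h4 : E * (g - g') <= 3 * (g - g') by apply: ler_wpM2r.
  have h5 : -3 * (g - g') <= E * (g - g') by apply: ler_wpM2r.
  have h6 : (l' - l) * (g - g') <= 1 * (g - g') by apply: ler_wpM2r.
  by split; lra.
have UW N : (2 <= N)%N -> U N <= U 2%N /\ W 2%N <= W N.
  elim: N => // N IHN; rewrite leq_eqVlt => /predU1P[<-//|N2].
  have [h1 h2] := IHN N2; have [h3 h4] := step _ N2.
  by split; [exact: le_trans h1|exact: le_trans h4].
exists (`|U 2%N| + `|W 2%N| + 1); first by rewrite ltr_wpDl // addr_ge0.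
move=> N N2; have [h1 h2] := UW _ N2; have N0 : (0 < N)%N by lia.
have := mertens_bound N0; rewrite ler_norml => /andP[E1 E2].
have l0 := lnn_gt0 N2; rewrite recip_sumE.
have f0 : 0 <= f N by rewrite invr_ge0 ltW.
have -> : wsum f N = wdef f N + (mertens N - lnn N) * f N by rewrite /wdef subrK.
set E := mertens N - lnn N in E1 E2 *.
have h3 : E * f N <= 3 * f N by apply: ler_wpM2r.
have h4 : - 3 * f N <= E * f N by apply: ler_wpM2r.
have := ler_norm (U 2%N); have := ler_norm (- W 2%N); rewrite normrN.
have := normr_ge0 (U 2%N); have := normr_ge0 (W 2%N).
move: h1 h2; set u := U 2%N; set w := W 2%N; rewrite /U /W.
by move=> *; split; lra.
Qed.

(** The real power [n^s]. Since [ln] vanishes at 0, its value at [n = 0] is 1. *)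
Definition pw s (n : nat) : R := expR (s * lnn n).

Lemma pw_gt0 s n : 0 < pw s n. Proof. exact: expR_gt0. Qed.
Lemma pw_ge0 s n : 0 <= pw s n. Proof. exact: expR_ge0. Qed.

Lemma pwM s m n : (0 < m)%N -> (0 < n)%N -> pw s (m * n) = pw s m * pw s n.
Proof. by move=> m0 n0; rewrite /pw lnnM // mulrDr expRD. Qed.

Lemma pwD s t n : pw (s + t) n = pw s n * pw t n.
Proof. by rewrite /pw mulrDl expRD. Qed.

Lemma pw1 s : pw s 1 = 1. Proof. by rewrite /pw lnn1 mulr0 expR0. Qed.

Lemma pwN1 n : (0 < n)%N -> pw (-1) n = n%:R^-1.
Proof. by move=> n0; rewrite /pw mulN1r expRN lnK // posrE ltr0n. Qed.

Lemma pw_le s m n : 0 <= s -> (0 < m)%N -> (m <= n)%N -> pw s m <= pw s n.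
Proof. by move=> s0 m0 mn; rewrite ler_expR ler_wpM2l // lnn_le. Qed.

Lemma pwN_le s m n : 0 <= s -> (0 < m)%N -> (m <= n)%N -> pw (- s) n <= pw (- s) m.
Proof.
by move=> s0 m0 mn; rewrite ler_expR !mulNr lerN2 ler_wpM2l // lnn_le.
Qed.

Lemma pw_le_exp s t n : (0 < n)%N -> s <= t -> pw s n <= pw t n.
Proof. by move=> n0 st; rewrite ler_expR ler_wpM2r // lnn_ge0. Qed.

(** The main term compares with the integral of [t^(delta - 1)]; the factor [2^delta] bounds the
    change of [t^delta] over one step. The Mertens error 3 is paid twice, in the increments and at
    the boundary, whence 6. *)
Lemma wsum_pw delta N : 0 < delta -> (0 < N)%N ->
  wsum (pw delta) N <= (6 + expR (delta * ln 2) / delta) * pw delta N.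
Proof.
move=> d0 N0; pose c := 3 + expR (delta * ln 2) / delta.
have H : wdef (pw delta) N <= c * (pw delta N - 1).
  case: N N0 => // N _; elim: N => [|N IHN].
    rewrite /wdef /wsum /mertens lnn1 pw1.
    by rewrite !(big_mkcond prime) !big_nat1 /= !subrr mul0r mulr0 subrr.
  have := wdef_step (pw delta) N.+1.
  have := mertens_bound (ltn0Sn N); rewrite ler_norml => /andP[E1 E2].
  set E := mertens N.+1 - lnn N.+1 in E1 E2 *.
  have fS : pw delta N.+2 = pw delta N.+1 * expR (delta * (lnn N.+2 - lnn N.+1)).
    by rewrite /pw -expRD; congr expR; ring.
  have u0 : 0 <= lnn N.+2 - lnn N.+1 by rewrite subr_ge0 ltW // lnn_lt.
  have u2 : lnn N.+2 - lnn N.+1 <= ln 2.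
    rewrite /lnn -ln_div ?posrE ?ltr0n // ler_ln ?posrE ?ltr0n ?divr_gt0 ?ltr0n //.
    by rewrite ler_pdivrMr ?ltr0n // -natrM ler_nat; lia.
  set u := lnn N.+2 - lnn N.+1 in fS u0 u2 *.
  have e1 : delta * u * pw delta N.+1 <= pw delta N.+2 - pw delta N.+1.
    rewrite fS; have := expR_ge1Dx (delta * u); have := pw_gt0 delta N.+1; nra.
  have e2 : u * pw delta N.+2 <= expR (delta * ln 2) / delta *
      (pw delta N.+2 - pw delta N.+1).
    have g0 := expR_gt0 (delta * ln 2).
    have : expR (delta * ln 2) / delta * (delta * u * pw delta N.+1) <=
      expR (delta * ln 2) / delta * (pw delta N.+2 - pw delta N.+1).
      by rewrite ler_wpM2l // divr_ge0 // ltW.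
    apply: le_trans.
    have -> : expR (delta * ln 2) / delta * (delta * u * pw delta N.+1) =
      u * (pw delta N.+1 * expR (delta * ln 2)) by field; rewrite gt_eqF.
    rewrite fS ler_wpM2l // ler_wpM2l ?pw_ge0 // ler_expR ler_wpM2l //; exact: ltW.
  have e3 : pw delta N.+1 <= pw delta N.+2 by apply: pw_le => //; exact: ltW.
  have e4 : E * (pw delta N.+1 - pw delta N.+2) <= -3 * (pw delta N.+1 - pw delta N.+2).
    by apply: ler_wnM2r => //; rewrite subr_le0.
  rewrite /c in IHN *; move: IHN e2 e4; set v := _ / _; lra.
have E := mertens_bound N0; move: E; rewrite ler_norml => /andP[E1 E2].
have f0 := pw_gt0 delta N.
have h : (mertens N - lnn N) * pw delta N <= 3 * pw delta N by rewrite ler_pM2r.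
have v0 : 0 <= expR (delta * ln 2) / delta by rewrite divr_ge0 ?expR_ge0 // ltW.
move: H; rewrite /wdef /c; move: v0; set v := _ / _; lra.
Qed.

End MertensSecond.

(** * Euler products *)

Local Open Scope ring_scope.

Section Euler.
Context {R : realType}.
Implicit Types (s delta : R) (N : nat).
Local Notation lnn := (@lnn R).
Local Notation pw := (@pw R).

(** Double counting: every [i] has a witness [j] that dominates it, and no [j] serves two
    indices. *)
Lemma sum_witness_le (I J : eqType) (s : seq I) (t : seq J) (r : I -> J -> bool)
    (F : I -> R) (G : J -> R) : uniq s ->
  (forall j, j \in t -> 0 <= G j) ->
  (forall i, i \in s -> exists j, [/\ j \in t, r i j & F i <= G j]) ->
  (forall j i i', j \in t -> i \in s -> i' \in s -> r i j -> r i' j -> i = i') ->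
  \sum_(i <- s) F i <= \sum_(j <- t) G j.
Proof.
move=> us G0 ex inj.
apply: le_trans (_ : _ <= \sum_(i <- s) \sum_(j <- t) if r i j then G j else 0) _.
  rewrite !big_seq; apply: ler_sum => i si.
  have [j [jt rij FG]] := ex _ si; apply: le_trans FG _.
  rewrite (big_rem j) //= rij lerDl big_seq; apply: sumr_ge0 => k kt.
  by case: ifP => // _; apply: G0; exact: mem_rem kt.
rewrite exchange_big /= !big_seq; apply: ler_sum => j jt.
have [/hasP[i si rij]|/hasPn no] := boolP (has (r^~ j) s); last first.
  by rewrite big_seq big1 ?G0 // => i si; rewrite (negbTE (no _ si)).
rewrite (big_rem i) //= rij big_seq big1 ?addr0 // => k.
rewrite rem_filter // mem_filter /= => /andP[ki ks].
by case: ifP => // rkj; rewrite (inj _ _ _ jt ks si rkj rij) eqxx in ki.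
Qed.

Lemma sum_inj_le (I J : eqType) (s : seq I) (t : seq J) (f : I -> J)
    (F : I -> R) (G : J -> R) : uniq s ->
  (forall j, j \in t -> 0 <= G j) ->
  (forall i, i \in s -> f i \in t /\ F i <= G (f i)) ->
  (forall i i', i \in s -> i' \in s -> f i = f i' -> i = i') ->
  \sum_(i <- s) F i <= \sum_(j <- t) G j.
Proof.
move=> us G0 ft inj; apply: (@sum_witness_le _ _ _ _ (fun i j => f i == j)) => //.
  by move=> i si; have [h1 h2] := ft _ si; exists (f i).
by move=> j i i' _ si si' /eqP<- /eqP /esym; apply: inj.
Qed.

(** The completely multiplicative function with value [g p] at each prime [p]; other indices
    contribute 1, because [logn] vanishes there. *)
Definition cmul (g : nat -> R) (a : nat) : R :=
  \prod_(0 <= p < a.+1) g p ^+ logn p a.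

Lemma cmul_widen g a N : (a <= N)%N ->
  cmul g a = \prod_(0 <= p < N.+1) g p ^+ logn p a.
Proof.
move=> aN; rewrite [RHS](@big_cat_nat _ _ _ a.+1) //= [X in _ = _ * X]big_nat_cond [X in _ = _ * X]big1 ?mulr1 //.
move=> p /andP[/andP[ap _] _]; rewrite lognE; case: ifP => // /and3P[_ a0].
by move=> /dvdn_leq => /(_ a0); lia.
Qed.

Lemma cmulM g p a : prime p -> (0 < a)%N -> cmul g (p * a) = g p * cmul g a.
Proof.
move=> pp a0; have p0 := prime_gt0 pp.
rewrite (@cmul_widen g a (p * a)%N) ?leq_pmull // /cmul.
have pin : p \in index_iota 0 (p * a).+1.
  by rewrite mem_index_iota /= ltnS leq_pmulr.
rewrite !(bigD1_seq p) ?iota_uniq //= lognM // logn_prime // eqxx add1n exprS mulrA.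
congr (_ * _); apply: eq_bigr => q qp.
by rewrite lognM // logn_prime // (negbTE qp).
Qed.

Lemma cmul1 g : cmul g 1 = 1.
Proof. by rewrite /cmul big1 // => p _; rewrite logn1. Qed.

Lemma cmul_ge0 g a : (forall p, 0 <= g p) -> 0 <= cmul g a.
Proof. by move=> g0; apply: prodr_ge0 => p _; apply: exprn_ge0. Qed.

Lemma eq_cmul_prime g g' a : (forall p, prime p -> (p %| a)%N -> g p = g' p) ->
  cmul g a = cmul g' a.
Proof.
move=> gg; apply: eq_bigr => p _; rewrite lognE; case: ifP => // /and3P[pp _ pa].
by rewrite gg.
Qed.

Lemma prime_divisor_ind (P : nat -> Prop) : P 1%N ->
  (forall p a, prime p -> (0 < a)%N -> P a -> P (p * a)%N) ->
  forall a, (0 < a)%N -> P a.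
Proof.
move=> P1 PM; elim/ltn_ind=> a IH a0.
have [a1|a1] := leqP a 1; first by have -> : a = 1%N by lia.
have pp := pdiv_prime a1; have pa := pdiv_dvd a.
rewrite -(divnK pa) mulnC; have d0 : (0 < a %/ pdiv a)%N.
  by rewrite divn_gt0 ?pdiv_gt0 // dvdn_leq.
apply: PM => //; apply: IH => //; apply: ltn_Pdiv => //; exact: prime_gt1.
Qed.

Lemma cmul_pw s a : (0 < a)%N -> cmul (pw s) a = pw s a.
Proof.
move: a; apply: prime_divisor_ind => [|p a pp a0 IH]; first by rewrite cmul1 pw1.
by rewrite cmulM // IH pwM // prime_gt0.
Qed.

Definition smooth (Q a : nat) := all (fun p => p <= Q)%N (primes a).

Lemma smoothP Q a : (0 < a)%N ->
  reflect (forall p, prime p -> (p %| a)%N -> (p <= Q)%N) (smooth Q a).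
Proof.
move=> a0; apply: (iffP allP) => H p; last first.
  by move=> /primesP[pp _ pa]; apply: H.
by move=> pp pa; apply: H; rewrite mem_primes pp a0.
Qed.

Definition euler_prod (g : nat -> R) Q : R :=
  \prod_(1 <= p < Q.+1 | prime p) (1 - g p)^-1.

Lemma euler_prodS g Q : euler_prod g Q.+1 =
  euler_prod g Q * (if prime Q.+1 then (1 - g Q.+1)^-1 else 1).
Proof. by rewrite /euler_prod big_mkcond big_nat_recr //= -big_mkcond. Qed.

(** Induction on [Q]. Taking out one factor [p = Q + 1] gives [S <= S' + g p * S], with [S'] the sum
    over [Q]-smooth integers. As [S] is a finite sum, this can be solved for [S], and no infinite
    series appears. *)
Lemma euler_sum_le g Q N : (forall p, 0 <= g p < 1) ->
  \sum_(1 <= a < N.+1 | smooth Q a) cmul g a <= euler_prod g Q.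
Proof.
move=> g01; have g0 p : 0 <= g p by have /andP[] := g01 p.
elim: Q N => [|Q IHQ] N.
  rewrite /euler_prod big_geq // -big_filter.
  have -> : [seq a <- index_iota 1 N.+1 | smooth 0 a] = [seq a <- index_iota 1 N.+1 | a == 1%N].
    apply: eq_in_filter => a; rewrite mem_index_iota => /andP[a0 _].
    apply/(smoothP _ a0)/eqP => [H|->].
      apply/eqP; rewrite eqn_leq a0 andbT leqNgt; apply/negP => a1.
      by have := H _ (pdiv_prime a1) (pdiv_dvd a); have := pdiv_gt0 a; lia.
    by move=> p pp; rewrite dvdn1 => /eqP p1; rewrite p1 in pp.
  rewrite big_filter; case: N => [|N]; first by rewrite big_geq.
  rewrite big_ltn_cond //= cmul1 big_nat_cond big1 ?addr0 // => a.
  by case/andP => /andP[a2 _] /eqP a1; rewrite a1 in a2.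
have [pQ|nQ] := boolP (prime Q.+1); last first.
  rewrite euler_prodS (negbTE nQ) mulr1.
  apply: le_trans (IHQ N); apply: ler_sum_sub => a /andP[a0 _].
    move=> /(smoothP _ a0) H; apply/(smoothP _ a0) => p pp pa.
    have := H _ pp pa; rewrite leq_eqVlt => /predU1P[pE|]; last by rewrite ltnS.
    by rewrite -pE pp in nQ.
  by move=> _; apply: cmul_ge0.
rewrite euler_prodS pQ.
have /andP[_ g1] := g01 Q.+1; rewrite ler_pdivlMr ?subr_gt0 // mulrBr mulr1 lerBlDr.
set S := \sum_(1 <= a < N.+1 | _) _.
apply: le_trans (_ : _ <= \sum_(1 <= a < N.+1 | smooth Q a) cmul g a + S * g Q.+1) _; last first.
  by rewrite lerD2r.
rewrite {1}/S (bigID (fun a => Q.+1 %| a)%N) /= addrC; apply: lerD.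
  apply: ler_sum_sub => a /andP[a0 aN]; last by move=> _; apply: cmul_ge0.
  move=> /andP[/(smoothP _ a0) H Qa]; apply/(smoothP _ a0) => p pp pa.
  have := H _ pp pa; rewrite leq_eqVlt => /predU1P[pE|]; last by rewrite ltnS.
  by rewrite -pE pa in Qa.
rewrite /S mulr_suml -[leLHS]big_filter -[leRHS]big_filter.
apply: (@sum_inj_le _ _ _ _ (fun a => a %/ Q.+1)%N).
- by rewrite filter_uniq // iota_uniq.
- by move=> a _; rewrite mulr_ge0 // cmul_ge0.
- move=> a; rewrite mem_filter mem_index_iota => /andP[/andP[sa Qa] /andP[a0 aN]].
  have d0 : (0 < a %/ Q.+1)%N by rewrite divn_gt0 // dvdn_leq.
  have aE : cmul g a = g Q.+1 * cmul g (a %/ Q.+1) by rewrite -cmulM // mulnC divnK.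
  rewrite aE mulrC lexx; split => //.
  rewrite mem_filter mem_index_iota d0 /= ltnS; apply/andP; split.
    apply/(smoothP _ d0) => p pp pd; apply: (smoothP _ a0 sa) => //.
    exact: dvdn_trans pd (dvdn_div Qa).
  by apply: leq_trans (leq_div _ _) _; rewrite -ltnS.
- move=> a b; rewrite !mem_filter => /andP[/andP[_ Qa] _] /andP[/andP[_ Qb] _] ab.
  by rewrite -(divnK Qa) ab divnK.
Qed.

Lemma pw32_sum N : \sum_(2 <= k < N.+1) pw (- (3 / 2)) k <= 2.
Proof.
suff H n : \sum_(2 <= k < n.+2) pw (- (3 / 2)) k <= 2 - 2 * pw (- (1 / 2)) n.+1.
  case: N => [|n]; first by rewrite big_geq.
  by apply: le_trans (H n) _; rewrite lerBlDr lerDl mulr_ge0 // pw_ge0.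
elim: n => [|n IHn]; first by rewrite big_geq // pw1 mulr1 subrr.
rewrite big_nat_recr //=; apply: le_trans (lerD IHn (lexx _)) _.
have h := lnnS_ge (R := R) (ltn0Sn n).
have -> : - (3 / 2) = - (1 / 2) + (- 1) :> R by lra.
rewrite pwD pwN1 //.
have -> : pw (- (1 / 2)) n.+1 = pw (- (1 / 2)) n.+2 * expR (1 / 2 * (lnn n.+2 - lnn n.+1)).
  by rewrite /pw -expRD; congr expR; ring.
have := expR_ge1Dx (1 / 2 * (lnn n.+2 - lnn n.+1)); have := pw_gt0 (R:=R) (- (1 / 2)) n.+2.
move: h; set u := _ - _; set w := pw _ _; set v := _^-1; set e := expR _.
move=> h1 h2 h3; have : w * v <= w * (2 * (e - 1)) by rewrite ler_pM2l //; lra.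
lra.
Qed.

(** [1 / (1 - t) = 1 + t + t^2 / (1 - t)], and [1 / (1 - t) <= 5/2] on this range. The bound [3/5]
    lies just above [2^(-3/4)], the largest value of [p^(-s)] for [s >= 3/4]. *)
Lemma inv_1B_le (t : R) : 0 <= t <= 3 / 5 -> (1 - t)^-1 <= expR (t + 5 / 2 * t ^+ 2).
Proof.
move=> /andP[t0 t1]; have h := expR_ge1Dx (t + 5 / 2 * t ^+ 2).
apply: le_trans h; rewrite -[leLHS]mul1r ler_pdivrMr; last by lra.
rewrite expr2; nra.
Qed.

Lemma euler_prod_le g Q :
  (forall p, prime p -> 0 <= g p <= 3 / 5 /\ g p ^+ 2 <= pw (- (3 / 2)) p) ->
  euler_prod g Q <= expR (\sum_(1 <= p < Q.+1 | prime p) g p + 5).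
Proof.
move=> gP.
apply: le_trans (_ : _ <= expR (\sum_(1 <= p < Q.+1 | prime p) (g p + 5 / 2 * pw (- (3/2)) p))) _.
  rewrite expR_sum; apply: ler_prod => p pp; have [/andP[h1 h2] h3] := gP _ pp.
  apply/andP; split; first by rewrite invr_ge0 subr_ge0; lra.
  apply: le_trans (inv_1B_le _) _; first by rewrite h1 h2.
  by rewrite ler_expR lerD2l ler_wpM2l //; lra.
rewrite ler_expR big_split /= lerD2l -mulr_sumr.
have : \sum_(1 <= p < Q.+1 | prime p) pw (- (3 / 2)) p <= 2.
  apply: le_trans (pw32_sum Q).
  have [Q0|Q0] := posnP Q; first by rewrite Q0 !big_geq.
  rewrite big_ltn_cond ?ltnS //=.
  by apply: (@ler_sum_sub _ _ xpredT) => // k _ _; rewrite pw_ge0.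
lra.
Qed.

End Euler.

(** * Brun's sieve and twin-type prime counts *)

Local Open Scope nat_scope.

Lemma count_mod_iota d c n : 0 < d ->
  count (fun k => k == c %[mod d]) (iota 0 n) = (n + (d.-1 - c %% d)) %/ d.
Proof.
move=> d0; have cd := ltn_pmod c d0; elim: n => [|n IHn].
  by rewrite /= add0n divn_small //; lia.
rewrite -addn1 iotaD count_cat IHn /= addn0 add0n addn1 addSn divnS // addnC.
congr (_ + _); congr nat_of_bool.
have -> : (n + (d.-1 - c %% d)).+1 = n + d - c %% d by lia.
rewrite /dvdn -[X in _ = (X == 0)]/((n + d - c %% d) %% d).
have -> : ((n + d - c %% d) %% d == 0) = (n + d == c %% d %[mod d]).
  by rewrite eqn_mod_dvd //; lia.
by rewrite modnDr modn_mod.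
Qed.

Local Open Scope ring_scope.

Section Brun.
Context {R : realType}.
Context (a Z M : nat).

Definition inclass (d c k : nat) : bool := (k == c %[mod d])%N.

Definition sifted (ps : seq nat) d c :=
  count (fun k => inclass d c k && all (fun p => ~~ (p %| k * (a * k + 1)))%N ps)
    (index_iota Z (Z + M)).

Lemma count_class d c : (0 < d)%N ->
  `| (count (inclass d c) (index_iota Z (Z + M)))%:R - M%:R / d%:R | <= 1 :> R.
Proof.
move=> d0; have d0' : (0 : R) < d%:R by rewrite ltr0n.
set e := (d.-1 - c %% d)%N.
have cE : (count (inclass d c) (index_iota Z (Z + M)) + (Z + e) %/ d = (Z + M + e) %/ d)%N.
  rewrite -!(count_mod_iota c) // /index_iota addKn iotaD count_cat addnC.
  by rewrite add0n.
have h1 := divn_eq (Z + e) d; have h2 := divn_eq (Z + M + e) d.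
have m1 := ltn_pmod (Z + e) d0; have m2 := ltn_pmod (Z + M + e) d0.
rewrite -cE in h2; set k := count _ _ in cE h2 *.
have h3 : (k * d <= M + d)%N by nia.
have h4 : (M <= k * d + d)%N by nia.
have r1 : M%:R / d%:R <= k%:R + 1 :> R.
  by rewrite ler_pdivrMr // mulrDl mul1r -natrM -natrD ler_nat.
have r2 : k%:R - 1 <= M%:R / d%:R :> R.
  by rewrite ler_pdivlMr // mulrBl mul1r lerBlDr -natrM -natrD ler_nat.
by rewrite ler_norml; apply/andP; split; lra.
Qed.

Definition sprod (ps : seq nat) : R := \prod_(p <- ps) (1 - 2 / p%:R).
Definition ssum (ps : seq nat) : R := \sum_(p <- ps) (2 / p%:R).

(** The first two terms of the binomial expansion. This is what makes the bounds [s^r / r!] and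
    [(1 + 2n)^r] of the sieve stable when one more prime is added. *)
Lemma pow_add_ge (s w : R) n : 0 <= s -> 0 <= w ->
  s ^+ n.+1 + n.+1%:R * w * s ^+ n <= (s + w) ^+ n.+1.
Proof.
move=> s0 w0; elim: n => [|n IHn]; first by rewrite !expr1 expr0; lra.
rewrite exprS [leRHS]exprS.
have sn : 0 <= s ^+ n by apply: exprn_ge0.
have sw : 0 <= s + w by apply: addr_ge0.
apply: le_trans (ler_wpM2l sw IHn).
rewrite [s ^+ n.+1]exprS -[n.+2%:R]natr1; set N := n.+1%:R.
have N0 : 0 <= N by [].
have h : 0 <= N * w * w * s ^+ n by rewrite !mulr_ge0.
lra.
Qed.

Lemma ssum_ge0 ps : 0 <= ssum ps.
Proof. by apply: sumr_ge0 => p _; rewrite divr_ge0. Qed.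

Lemma sprod_01 ps : all prime ps -> 0 <= sprod ps <= 1.
Proof.
elim: ps => [|p ps IHps]; first by rewrite /sprod big_nil ler01 lexx.
move=> /= /andP[pp /IHps]; rewrite /sprod big_cons; set w := \prod_(_ <- _) _.
have p2 : (2 : R) <= p%:R by rewrite ler_nat prime_gt1.
have h : 2 / p%:R <= 1 :> R by rewrite ler_pdivrMr ?mul1r // ltr0n prime_gt0.
have h0 : 0 <= 2 / p%:R :> R by rewrite divr_ge0.
by move=> /andP[w0 w1]; apply/andP; split; nra.
Qed.

Lemma bad_classes p : prime p -> ~~ (p %| a)%N ->
  exists e, ~~ (p %| e)%N /\
    forall k, (p %| k * (a * k + 1))%N = inclass p 0 k || inclass p e k.
Proof.
move=> pp pa; have cop : coprime p a by rewrite prime_coprime.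
have p0 := prime_gt0 pp; have p1 := prime_gt1 pp.
have [u [v uv]] : exists u v, (a * u = 1 + p * v)%N.
  case: (egcdnP p (_ : (0 < a)%N)) => [|u v uv _].
    by case: (a) pa => //; rewrite dvdn0.
  exists u, v; move: uv; rewrite gcdnC (eqP cop); lia.
(* [u] is the inverse of [a] modulo [p], and [u * p.-1] represents [- u] without subtraction. *)
exists (u * p.-1)%N; split.
  rewrite Euclid_dvdM // negb_or; apply/andP; split; last first.
    by apply/negP => /dvdn_leq; lia.
  apply/negP => /(dvdn_mull a); rewrite uv dvdn_addl ?dvdn_mulr // dvdn1 => /eqP p1'.
  by rewrite p1' in pp.
move=> k; rewrite Euclid_dvdM // /inclass mod0n; congr (_ || _).
have -> : (p %| a * k + 1)%N = (p %| u * (a * k + 1))%N.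
  rewrite Euclid_dvdM //; suff /negbTE-> : ~~ (p %| u)%N by [].
  apply/negP => /(dvdn_mull a); rewrite uv dvdn_addl ?dvdn_mulr // dvdn1 => /eqP p1'.
  by rewrite p1' in pp.
have -> : (u * (a * k + 1) = k + u + p * (v * k))%N by nia.
rewrite dvdn_addl ?dvdn_mulr // -(eqn_modDr u) -mulnSr prednK // modnMl.
by rewrite /dvdn.
Qed.

(** Buchstab's identity. The integers removed by [p] lie in two distinct classes modulo [p], each of
    which merges with the class modulo [d] by the Chinese remainder theorem. *)
Lemma sifted_cons p ps d c : prime p -> ~~ (p %| a)%N -> coprime d p ->
  exists c0 c1, sifted ps d c =
    (sifted (p :: ps) d c + sifted ps (d * p) c0 + sifted ps (d * p) c1)%N.
Proof.
move=> pp pa cop; have [e [pe bad]] := bad_classes pp pa.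
exists (chinese d p c 0), (chinese d p c e); rewrite /sifted.
set s := index_iota _ _.
have cls r k : inclass (d * p) (chinese d p c r) k = inclass d c k && inclass p r k.
  by rewrite /inclass chinese_remainder // chinese_modl // chinese_modr.
elim: s => //= k s ->; rewrite !cls bad.
have : ~~ (inclass p 0 k && inclass p e k).
  apply/negP; rewrite /inclass mod0n => /andP[/eqP-> /eqP]; rewrite /dvdn in pe.
  by move=> h; rewrite -h in pe.
by case: (inclass d c k); case: (inclass p 0 k); case: (inclass p e k); case: all; rewrite //=; lia.
Qed.

(* Brun's pure sieve by induction on [r] and on the list of primes: removing a prime [p]
   subtracts the two classes mod [d * p] where [p] divides [k (a k + 1)], and these are
   estimated at order [r - 1]. *)
Theorem brun_sieve r ps d c : (0 < d)%N -> uniq ps -> all prime ps ->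
  all (fun p => ~~ (p %| a))%N ps -> all (coprime d) ps ->
  `| (sifted ps d c)%:R - M%:R / d%:R * sprod ps | <=
    M%:R / d%:R * (ssum ps ^+ r / r`!%:R) + (1 + 2 * (size ps)%:R) ^+ r.
Proof.
elim: r ps d c => [|r IHr] ps d c d0.
  move=> _ /sprod_01 /andP[w0 w1] _ _; rewrite !expr0 divr1 mulr1.
  have := count_class c d0; rewrite ler_norml => /andP[h1 h2].
  have : (sifted ps d c)%:R <= (count (inclass d c) (index_iota Z (Z + M)))%:R :> R.
    by rewrite ler_nat; apply: sub_count => k /andP[].
  have m0 : 0 <= M%:R / d%:R :> R by rewrite divr_ge0.
  have : 0 <= (sifted ps d c)%:R :> R by [].
  move: h1 h2 m0; set m := _ / _; set A := (count _ _)%:R; set B := _%:R.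
  move=> h1 h2 m0 h3 h4; rewrite ler_norml; apply/andP; split; nra.
elim: ps d c d0 => [|p ps IHps] d c d0.
  move=> _ _ _ _; rewrite /sprod /ssum !big_nil expr0n /= mul0r mulr0 add0r mulr0 addr0 mulr1 expr1n.
  have -> : sifted [::] d c = count (inclass d c) (index_iota Z (Z + M)).
    by apply: eq_count => k; rewrite /= andbT.
  exact: count_class.
move=> /= /andP[pps us] /andP[pp prs] /andP[pa na] /andP[cop cops].
have [c0 [c1 sE]] := sifted_cons ps c pp pa cop.
have p0 : (0 < p)%N by apply: prime_gt0.
have dp0 : (0 < d * p)%N by rewrite muln_gt0 d0.
have cop' : all (coprime (d * p)) ps.
  apply/allP => q qs; rewrite coprimeMl (allP cops) //= prime_coprime //.
  rewrite dvdn_prime2 //; last exact: (allP prs).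
  by apply/eqP => pq; rewrite pq qs in pps.
have := IHps d c d0 us prs na cops.
have := IHr ps (d * p)%N c0 dp0 us prs na cop'.
have := IHr ps (d * p)%N c1 dp0 us prs na cop'.
have {}sE : (sifted ps d c)%:R = (sifted (p :: ps) d c)%:R +
  (sifted ps (d * p) c0)%:R + (sifted ps (d * p) c1)%:R :> R by rewrite sE !natrD.
have s0 := ssum_ge0 ps.
rewrite !ler_norml /sprod /ssum !big_cons -/(sprod ps) -/(ssum ps).
have dpE : M%:R / (d * p)%:R = M%:R / d%:R * (2 / p%:R) / 2 :> R.
  by rewrite natrM; field; rewrite !pnatr_eq0 -!lt0n d0 p0.
rewrite dpE.
have w0 : 0 <= 2 / p%:R :> R by rewrite divr_ge0.
have := pow_add_ge r s0 w0.
have j0 : 0 <= 1 + 2 * (size ps)%:R :> R by rewrite addr_ge0 // mulr_ge0.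
(* The growth of the remainder from [(1 + 2n)^(r+1)] to [(3 + 2n)^(r+1)] must cover [2 (1 + 2n)^r],
   one copy for each of the two removed classes. *)
have := @pow_add_ge (1 + 2 * (size ps)%:R) 2 r j0 (ltW (ltr0Sn _ 1)).
have -> : 1 + 2 * (size ps).+1%:R = 1 + 2 * (size ps)%:R + 2 :> R.
  by rewrite -natr1; ring.
have jr : 0 <= (1 + 2 * (size ps)%:R) ^+ r :> R by apply: exprn_ge0.
have j2 : 2 * (1 + 2 * (size ps)%:R) ^+ r <= r.+1%:R * 2 * (1 + 2 * (size ps)%:R) ^+ r :> R.
  by rewrite ler_wpM2r // ler_peMl // ler1n.
have m0 : 0 <= M%:R / d%:R :> R by rewrite divr_ge0.
move=> h1 h2.
have {}h2 : ssum ps ^+ r.+1 / r.+1`!%:R + (2 / p%:R) * (ssum ps ^+ r / r`!%:R) <=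
    (2 / p%:R + ssum ps) ^+ r.+1 / r.+1`!%:R.
  rewrite [in leRHS]addrC ler_pdivlMr ?ltr0n ?fact_gt0 //; apply: le_trans h2.
  rewrite le_eqVlt; apply/orP; left; apply/eqP.
  have f0 : (r`!%:R : R) != 0 by rewrite pnatr_eq0 -lt0n fact_gt0.
  have r0 : (r.+1%:R : R) != 0 by rewrite pnatr_eq0.
  have P0 : (p%:R : R) != 0 by rewrite pnatr_eq0 -lt0n.
  rewrite factS natrM exprS; move: (r`!%:R) (r.+1%:R) (p%:R) f0 r0 P0 => F N P f0 r0 P0.
  by field; rewrite f0 r0 P0.
have {}h2 := ler_wpM2l m0 h2.
move: sE h1 h2 jr j2.
move: (M%:R / d%:R) m0 (2 / p%:R) w0 => m m0 w w0.
set T1 := _ ^+ r.+1 / _; set T2 := _ ^+ r / _; set T3 := _ ^+ r.+1 / _.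
set X1 := _ ^+ r.+1; set X2 := _ ^+ r; set X3 := _ ^+ r.+1.
set S := (sifted ps d c)%:R; set S0 := (sifted _ _ c0)%:R; set S1 := (sifted _ _ c1)%:R.
set S' := (sifted _ d c)%:R; set W := sprod ps.
move=> sE h1 h2 jr j2 /andP[a1 a2] /andP[b1 b2] /andP[e1 e2].
by apply/andP; split; lra.
Qed.

End Brun.

Local Open Scope ring_scope.

Section TwinCount.
Context {R : realType}.
Local Notation lnn := (@lnn R).
Local Notation pw := (@pw R).
Local Notation recip_sum := (@recip_sum R).

Definition recip_div (a : nat) : R := \sum_(p <- primes a) p%:R^-1.

Lemma prod_primes_le a : (0 < a)%N -> (\prod_(p <- primes a) p <= a)%N.
Proof.
move=> a0; apply: dvdn_leq => //; apply: prod_primes_dvd.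
- exact: primes_uniq.
- by apply/allP => p /primesP[].
- by move=> p /primesP[].
Qed.

Lemma size_primes_le a : (0 < a)%N -> (size (primes a))%:R * ln 2 <= lnn a.
Proof.
move=> a0; rewrite mulr_natl -lnXn // -natrX.
apply: lnn_le; first by rewrite expn_gt0.
apply: leq_trans (prod_primes_le a0).
have : {in primes a, forall p, 2 <= p}%N by move=> p /primesP[/prime_gt1].
elim: (primes a) => [|p s IHs] s2; first by rewrite big_nil.
rewrite big_cons expnS; apply: leq_mul; first by rewrite s2 // inE eqxx.
by apply: IHs => q qs; rewrite s2 // inE qs orbT.
Qed.

(** Prime factors up to [T] are bounded by the full sum over primes; there are at most [ln a / ln 2]
    others, each contributing at most [1 / T]. This keeps the singular series of the sieve small
    even when [a] is as large as [x]. *)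
Lemma recip_div_le a T : (0 < a)%N -> (0 < T)%N ->
  recip_div a <= recip_sum T + lnn a / ln 2 / T%:R.
Proof.
move=> a0 T0; have T0' : (0 : R) < T%:R by rewrite ltr0n.
rewrite /recip_div (bigID (fun p => p <= T)%N) /=; apply: lerD.
  rewrite /recip_sum -big_filter -[leRHS]big_filter.
  apply: (@sum_inj_le _ _ _ _ _ id).
  - by rewrite filter_uniq // primes_uniq.
  - by move=> p _; rewrite invr_ge0.
  - move=> p; rewrite !mem_filter mem_index_iota => /andP[pT pa].
    by have [pp _ _] := primesP pa; rewrite pp ltnS pT (prime_gt0 pp).
  - by [].
apply: le_trans (_ : _ <= \sum_(p <- primes a) T%:R^-1) _.
  rewrite big_mkcond /= !big_seq; apply: ler_sum => p pa; case: ifP; rewrite ?invr_ge0 //.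
  rewrite -ltnNge => Tp; rewrite lef_pV2 ?posrE ?ltr0n // ?ler_nat; first exact: ltnW.
  exact: leq_trans Tp.
rewrite big_const_seq count_predT iter_addr_0 -[leLHS]mulr_natl ler_pM2r ?invr_gt0 //.
rewrite ler_pdivlMr ?size_primes_le //; by rewrite ln_gt0 // ltr1n.
Qed.

Lemma sprod_le_exp ps : all prime ps -> sprod ps <= expR (- ssum ps) :> R.
Proof.
elim: ps => [|p ps IHps] /=; first by rewrite /sprod /ssum !big_nil oppr0 expR0.
move=> /andP[pp prs]; have /andP[w0 _] := sprod_01 (R := R) prs; move: IHps w0.
rewrite /sprod /ssum !big_cons opprD expRD => IHps w0; apply: ler_pM => //.
- have p2 : (2 : R) <= p%:R by rewrite ler_nat prime_gt1.
  by rewrite subr_ge0 ler_pdivrMr ?mul1r // ltr0n prime_gt0.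
- exact: expR_ge1Dx.
exact: IHps.
Qed.

(** Since [r! >= (r / e)^r], the quotient is at most [(e s / r)^r], and [e s / r <= 1 / e]. *)
Lemma pow_fact_le (s : R) r : 0 < s -> expR 2 * s <= r%:R -> s ^+ r / r`!%:R <= expR (- r%:R).
Proof.
move=> s0 sr; have f0 : (0 : R) < r`!%:R by rewrite ltr0n fact_gt0.
have r0 : (0 : R) < r%:R by apply: lt_le_trans sr; rewrite mulr_gt0 // expR_gt0.
rewrite ler_pdivrMr // -[s ^+ r]lnK ?posrE ?exprn_gt0 //.
rewrite -[r`!%:R]lnK ?posrE // -expRD ler_expR lnXn // -mulr_natl.
have := lnn_fact_ge (R := R) r; rewrite /lnn => h.
have : ln s <= ln r%:R - 2.
  have e : ln s + 2 = ln (s * expR 2) by rewrite lnM ?posrE ?expR_gt0 // expRK.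
  by rewrite lerBrDr e ler_ln ?posrE // ?mulr_gt0 ?expR_gt0 // mulrC.
move=> h2; have := ler_wpM2l (ltW r0) h2; lra.
Qed.

Definition twin_count a Z :=
  count (fun k => prime k && prime (a * k + 1)) (index_iota Z (Z + Z)).

Definition sieve_primes a z := [seq p <- index_iota 1 z.+1 | prime p & ~~ (p %| a)%N].

(** Brun's sieve with all primes up to [z] not dividing [a], stopped at depth [r] about [e^2 B],
    where [B] bounds the sum of [2 / p]. The hypothesis on [Z] says that the remainder [(3 z)^r] is
    at most [Z / ln^2 z]. The factor 3 counts the main term and the two error terms, each of that
    size. *)
Theorem twin_count_le : exists2 C : R, 0 < C & forall a z Z, (0 < a)%N -> (3 <= z)%N ->
  (z < Z)%N ->
  (expR 2 * (2 * (ln (lnn z) + C)) + 1) * lnn (3 * z)%N + 2 * ln (lnn z) <= lnn Z ->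
  (twin_count a Z)%:R <= Z%:R * (3 * expR (2 * C + 2 * recip_div a) / lnn z ^+ 2).
Proof.
have [C0 C00 mert] := mertens2 (R := R).
pose C := C0 + `|ln (lnn 3)| + 1.
have C1 : C0 + 1 <= C by rewrite /C; have := normr_ge0 (ln (lnn 3)); lra.
exists C; first by lra.
move=> a z Z a0 z3 zZ; set ll := ln (lnn z).
have l3 : ln (lnn 3) <= ll.
  rewrite ler_ln ?posrE ?lnn_gt0 //; last by lia.
  by apply: lnn_le.
have llC : 0 < ll + C by rewrite /C; have := ler_norm (- ln (lnn 3)); rewrite normrN; lra.
pose B := 2 * (ll + C); have B0 : 0 < B by rewrite mulr_gt0.
pose r := (Num.truncn (expR 2 * B)).+1.
have eB0 : 0 <= expR 2 * B by rewrite mulr_ge0 ?expR_ge0 // ltW.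
have /andP[r1 r2] := truncn_itv eB0.
rewrite -/r in r2.
have {}r1 : r%:R <= expR 2 * B + 1 by rewrite /r -natr1 lerD2r.
move=> hyp; have l0 : 0 < lnn z by apply: lnn_gt0; exact: leq_trans z3.
pose ps := sieve_primes a z.
have ups : uniq ps by rewrite filter_uniq // iota_uniq.
have prs : all prime ps by apply/allP => p; rewrite mem_filter => /andP[/andP[]].
have nas : all (fun p => ~~ (p %| a)%N) ps.
  by apply/allP => p; rewrite mem_filter => /andP[/andP[]].
have c1 : all (coprime 1) ps by apply/allP => p _; rewrite coprime1n.
have := brun_sieve (R := R) Z Z r 0 (ltn0Sn 0) ups prs nas c1.
rewrite ler_norml => /andP[_]; rewrite divr1 => br.
have Z0 : (0 : R) < Z%:R by rewrite ltr0n (leq_ltn_trans _ zZ).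
have sz : ((size ps) <= z)%N.
  by rewrite size_filter (leq_trans (count_size _ _)) // size_iota subn1.
(* A sieving prime is at most [z < Z <= k], so it can equal neither the prime [k] nor the prime
   [a k + 1]. *)
have tw : (twin_count a Z)%:R <= (sifted a Z Z ps 1 0)%:R :> R.
  rewrite ler_nat; rewrite /twin_count /sifted -!size_filter; apply: uniq_leq_size.
    by rewrite filter_uniq // iota_uniq.
  move=> k; rewrite !mem_filter mem_index_iota => /andP[/andP[pk pak] /andP[Zk kZ]].
  rewrite Zk kZ /inclass !modn1 eqxx !andbT /=; apply/allP => p.
  rewrite mem_filter mem_index_iota => /andP[/andP[pp _] /andP[p0 pz]].
  rewrite Euclid_dvdM // !dvdn_prime2 //; apply/negP => /orP[] /eqP; move: Zk zZ pz a0; clear; nia.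
have ssumE : ssum ps = 2 * \sum_(p <- ps) p%:R^-1 :> R by rewrite /ssum mulr_sumr.
have recE : recip_sum z = \sum_(p <- ps) p%:R^-1 + \sum_(1 <= p < z.+1 | prime p && (p %| a)%N) p%:R^-1.
  by rewrite /ps big_filter /recip_sum (bigID (fun p => p %| a)%N) /= addrC.
have z2 : (2 <= z)%N by exact: leq_trans z3.
have [m1 m2] := mert z z2; rewrite -/ll in m1 m2.
have rd : \sum_(1 <= p < z.+1 | prime p && (p %| a)%N) p%:R^-1 <= recip_div a.
  rewrite -big_filter /recip_div; apply: (@sum_inj_le _ _ _ _ _ id).
  - by rewrite filter_uniq // iota_uniq.
  - by move=> p _; rewrite invr_ge0.
  - by move=> p; rewrite !mem_filter mem_primes a0 => /andP[/andP[-> ->]].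
  - by [].
have rd0 : 0 <= \sum_(1 <= p < z.+1 | prime p && (p %| a)%N) p%:R^-1 :> R.
  by apply: sumr_ge0 => p _; rewrite invr_ge0.
have sB : ssum ps <= B by rewrite ssumE /B; move: m2 rd0 recE C1; clear; lra.
have s1 : sprod ps <= expR (2 * C + 2 * recip_div a - 2 * ll).
  by apply: le_trans (sprod_le_exp prs) _; rewrite ler_expR ssumE; move: m1 rd recE C1; clear; lra.
have s0 := ssum_ge0 (R := R) ps.
have s2 : ssum ps ^+ r / r`!%:R <= expR (- 2 * ll).
  apply: le_trans (_ : _ <= B ^+ r / r`!%:R) _.
    by rewrite ler_pM2r ?invr_gt0 ?ltr0n ?fact_gt0 // lerXn2r // nnegrE // ltW.
  apply: le_trans (pow_fact_le B0 (ltW r2)) _; rewrite ler_expR.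
  have : 1 * B <= expR 2 * B by rewrite ler_pM2r // ltW // expR_gt1.
  by move: r2 llC C1 C00; rewrite /B; clear; lra.
have s3 : (1 + 2 * (size ps)%:R) ^+ r <= Z%:R * expR (- 2 * ll).
  have z0 : (0 < 3 * z)%N by rewrite muln_gt0 (leq_trans _ z2).
  apply: le_trans (_ : _ <= (3 * z)%:R ^+ r) _.
    rewrite lerXn2r // ?nnegrE // ?addr_ge0 ?mulr_ge0 //.
    by rewrite -natrM addrC natr1 ler_nat; move: z2 sz; clear; lia.
  rewrite -[(3 * z)%:R]lnK ?posrE ?ltr0n // -[Z%:R]lnK ?posrE // -expRM_natl -expRD ler_expR.
  have : r%:R * lnn (3 * z) <= (expR 2 * B + 1) * lnn (3 * z).
    by rewrite ler_wpM2r // lnn_ge0.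
  by move: hyp; rewrite -/B -/ll /lnn; clear; lra.
have ll2 : expR (- 2 * ll) = (lnn z ^+ 2)^-1.
  by rewrite mulNr expRN expRM_natl lnK.
have rd1 : 0 <= recip_div a by apply: sumr_ge0 => p _; rewrite invr_ge0.
have s1' : sprod ps <= expR (2 * C + 2 * recip_div a) * expR (- 2 * ll).
  by rewrite -expRD mulNr.
have e1 : 1 <= expR (2 * C + 2 * recip_div a).
  by rewrite -[leLHS]expR0 ler_expR; move: rd1 C1 C00; clear; lra.
move: tw br s1' s2 s3 e1 Z0; rewrite -ll2; have := expR_gt0 (- 2 * ll).
set e := expR (-2 * ll); set D := expR _; set SP := sprod ps; set T := _ ^+ r / _; set U := _ ^+ r.
move: (Z%:R : R) ((twin_count a Z)%:R) ((sifted _ _ _ _ _ _)%:R) => z' t s.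
clear=> e0 h1 h2 h3 h4 h5 h6 h7.
have k1 := ler_wpM2l (ltW h7) h3.
have k2 := ler_wpM2l (ltW h7) h4.
have k3 : z' * e <= z' * (D * e) by rewrite ler_wpM2l ?(ltW h7) // ler_peMl // ltW.
lra.
Qed.

Lemma sum_dyadic_le (P : pred nat) w I (H : R) : (0 < w)%N ->
  (forall Z, (w <= Z)%N -> (count P (index_iota Z (Z + Z)))%:R <= Z%:R * H) ->
  \sum_(w <= l < w * 2 ^ I | P l) l%:R^-1 <= I%:R * H.
Proof.
move=> w0 HP; elim: I => [|I IHI]; first by rewrite expn0 muln1 big_geq // mul0r.
have wI : (w <= w * 2 ^ I)%N by rewrite leq_pmulr // expn_gt0.
have wS : (w * 2 ^ I.+1 = w * 2 ^ I + w * 2 ^ I)%N by rewrite expnS; lia.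
rewrite (@big_cat_nat _ _ _ (w * 2 ^ I)) //=; last by rewrite wS leq_addr.
rewrite -natr1 mulrDl mul1r; apply: lerD => //.
rewrite wS; set Z := (w * 2 ^ I)%N in wI *.
have Z0 : (0 : R) < Z%:R by rewrite ltr0n (leq_trans w0).
apply: le_trans (_ : _ <= \sum_(Z <= l < Z + Z | P l) Z%:R^-1) _.
  apply: ler_sum_natP => k /andP[Zk _] _; rewrite lef_pV2 ?posrE ?ler_nat // ltr0n.
  by rewrite (leq_trans w0) // (leq_trans wI).
rewrite big_const_seq iter_addr_0 -[leLHS]mulr_natl ler_pdivrMr // mulrC.
exact: HP.
Qed.

End TwinCount.

(** * Primes with small rough part of p - 1 *)

Local Open Scope nat_scope.

Definition above (y : nat) : nat_pred := [pred p | y < p].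
Definition rough_part (y m : nat) := m`_(above y).
Definition smooth_part (y m : nat) := m`_(above y)^'.

Lemma rough_smooth_part y m : 0 < m -> m = rough_part y m * smooth_part y m.
Proof. by move=> m0; rewrite /rough_part /smooth_part partnC. Qed.

Lemma rough_part_gt0 y m : 0 < rough_part y m. Proof. exact: part_gt0. Qed.
Lemma smooth_part_gt0 y m : 0 < smooth_part y m. Proof. exact: part_gt0. Qed.

Lemma rough_part_prime_gt y m p : prime p -> p %| rough_part y m -> y < p.
Proof.
move=> pp pr; have /pnatP := part_pnat (above y) m.
by move=> /(_ (rough_part_gt0 y m) p pp pr).
Qed.

Lemma smooth_part_prime_le y m p : prime p -> p %| smooth_part y m -> p <= y.
Proof.
move=> pp pr; have /pnatP := part_pnat (above y)^' m.
by move=> /(_ (smooth_part_gt0 y m) p pp pr); rewrite inE /= inE /= -leqNgt.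
Qed.

Lemma rough_partM y m n : 0 < m -> 0 < n -> rough_part y (m * n) = rough_part y m * rough_part y n.
Proof. exact: partnM. Qed.

Lemma rough_part_small_prime y p : prime p -> p <= y -> rough_part y p = 1.
Proof.
move=> pp py; apply: part_p'nat; rewrite pnatE // inE /= inE /= -leqNgt //.
Qed.

Definition sparse_prime y B p := prime p && (rough_part y p.-1 < B).

Local Open Scope ring_scope.

Section Rankin.
Context {R : realType}.
Local Notation lnn := (@lnn R).
Local Notation pw := (@pw R).
Local Notation recip_sum := (@recip_sum R).
Local Notation mertens := (@mertens R).

Lemma cmulMn g a b : (0 < a)%N -> (0 < b)%N -> cmul g (a * b) = cmul g a * cmul g b :> R.
Proof.
move=> a0 b0; move: a a0; apply: prime_divisor_ind => [|p a pp a0 IH].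
  by rewrite mul1n cmul1 mul1r.
by rewrite -mulnA cmulM ?muln_gt0 ?a0 // [cmul g (p * a)]cmulM // IH mulrA.
Qed.

Lemma harmonic_le N : \sum_(1 <= k < N.+1) k%:R^-1 <= 1 + lnn N.
Proof.
elim: N => [|N IHN]; first by rewrite big_geq // /lnn ln0 // addr0.
case: N IHN => [|N] IHN; first by rewrite big_nat1 lnn1 invr1 addr0.
rewrite big_nat_recr //=; apply: le_trans (lerD IHN (lnnS_ge (ltn0Sn N))) _.
by rewrite addrC addrA; lra.
Qed.

Lemma pw_split (delta : R) p : (0 < p)%N -> pw (- (1 - delta)) p = pw delta p * p%:R^-1.
Proof. by move=> p0; rewrite opprB addrC pwD pwN1 // mulrC. Qed.

Lemma prime_pw34 s p : 3 / 4 <= s -> prime p -> 0 <= pw (- s) p <= 3 / 5.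
Proof.
move=> s34 pp; rewrite pw_ge0 /=.
apply: le_trans (_ : _ <= pw (- (3 / 4)) p) _.
  by apply: pw_le_exp; rewrite ?prime_gt0 // lerN2.
apply: le_trans (_ : _ <= pw (- (3 / 4)) 2) _.
  by apply: pwN_le; rewrite ?prime_gt1 //; lra.
have h : pw (- (3 / 4)) 2 ^+ 4 = 1 / 8.
  rewrite /pw -expRM_natl mulrA (_ : 4 * - (3 / 4) = - 3); last by lra.
  rewrite mulNr expRN mulr_natl /lnn -lnXn // lnK ?posrE ?exprn_gt0 //.
  by rewrite -natrX mul1r.
by rewrite -(@ler_pXn2r _ 4) ?nnegrE ?pw_ge0 ?h //; lra.
Qed.

Lemma pw_sq_le s p : 3 / 4 <= s -> (0 < p)%N -> pw (- s) p ^+ 2 <= pw (- (3 / 2)) p.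
Proof.
move=> s34 p0; rewrite expr2 -pwD; apply: pw_le_exp => //; lra.
Qed.

Lemma smooth_sum_le s Q N : 3 / 4 <= s ->
  \sum_(1 <= a < N.+1 | smooth Q a) pw (- s) a <=
  expR (\sum_(1 <= p < Q.+1 | prime p) pw (- s) p + 5).
Proof.
move=> s34; pose g p : R := if prime p then pw (- s) p else 0.
have gP p : 0 <= g p < 1.
  rewrite /g; case: ifP => [pp|_]; last by rewrite lexx ltr01.
  by have /andP[h1 h2] := prime_pw34 s34 pp; apply/andP; split=> //; lra.
have -> : \sum_(1 <= p < Q.+1 | prime p) pw (- s) p = \sum_(1 <= p < Q.+1 | prime p) g p.
  by apply: eq_bigr => p pp; rewrite /g pp.
have := euler_sum_le Q N gP.
have -> : \sum_(1 <= a < N.+1 | smooth Q a) cmul g a =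
    \sum_(1 <= a < N.+1 | smooth Q a) pw (- s) a.
  rewrite big_nat_cond [RHS]big_nat_cond; apply: eq_bigr => a /andP[/andP[a0 _] _].
  by rewrite -cmul_pw //; apply: eq_cmul_prime => p pp _; rewrite /g pp.
move/le_trans; apply; apply: euler_prod_le => p pp; rewrite /g pp.
by split; [exact: prime_pw34|apply: pw_sq_le => //; exact: prime_gt0].
Qed.

(** Write [p^delta = 1 + (p^delta - 1)]. Up to [th], use [p^delta - 1 <= delta ln p * th^delta];
    beyond it, insert the factor [ln p / ln th >= 1] so that [wsum] applies. With [th] a power of
    [N] of exponent close to 1, the last term has nearly the correct constant. *)
Lemma prime_sum_pw_le (delta : R) N th : 0 < delta -> (0 < N)%N -> (1 < th)%N ->
  \sum_(1 <= p < N.+1 | prime p) pw (- (1 - delta)) p <=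
  recip_sum N + delta * pw delta th * mertens th +
  wsum (pw delta) N / lnn th.
Proof.
move=> d0 N0 th1; have lt0 : 0 < lnn th by apply: lnn_gt0.
have e1 t : expR t - 1 <= t * expR t :> R.
  have := expR_ge1Dx (- t); rewrite expRN => h.
  have e0 := expR_gt0 t; have := ler_wpM2r (ltW e0) h.
  by rewrite mulVf ?gt_eqF //; lra.
pose F p := if (p <= th)%N then delta * pw delta th * (lnn p / p%:R) else 0.
apply: le_trans (_ : _ <= \sum_(1 <= p < N.+1 | prime p)
   (p%:R^-1 + F p + lnn p / p%:R * pw delta p / lnn th)) _.
  apply: ler_sum_natP => p /andP[p0 _] pp; rewrite pw_split // /F.
  have p0' : (0 : R) < p%:R by rewrite ltr0n.
  have ip : (0 : R) <= p%:R^-1 by rewrite invr_ge0.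
  have lp := lnn_ge0 (R := R) p; have wp := pw_gt0 delta p.
  case: ifP => pth.
    have h1 : pw delta p - 1 <= delta * lnn p * pw delta p by apply: e1.
    have h2 : pw delta p <= pw delta th by apply: pw_le => //; exact: ltW.
    have h3 : pw delta p - 1 <= delta * lnn p * pw delta th.
      apply: le_trans h1 _; rewrite ler_wpM2l // mulr_ge0 // ltW //.
    have h4 := ler_wpM2r ip h3.
    have h5 : 0 <= lnn p / p%:R * pw delta p / lnn th.
      by rewrite !mulr_ge0 // ?invr_ge0 ?pw_ge0 // ltW.
    by lra.
  rewrite addr0; apply: le_trans (_ : _ <= lnn p / p%:R * pw delta p / lnn th) _.
    rewrite ler_pdivlMr //.
    have h : lnn th <= lnn p by apply: lnn_le; [lia|rewrite ltnW // ltnNge pth].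
    have h2 : 0 <= pw delta p * p%:R^-1 by rewrite mulr_ge0 // ltW.
    by have := ler_wpM2l h2 h; lra.
  by rewrite lerDr.
rewrite !big_split /= /wsum mulr_suml; apply: lerD => //; apply: lerD => //.
rewrite /F -big_mkcondr /= -mulr_sumr; apply: ler_wpM2l.
  by rewrite mulr_ge0 ?pw_ge0 // ltW.
rewrite /mertens -big_filter -[leRHS]big_filter; apply: (@sum_inj_le _ _ _ _ _ id).
- by rewrite filter_uniq // iota_uniq.
- by move=> p _; rewrite divr_ge0 ?lnn_ge0.
- move=> p; rewrite !mem_filter !mem_index_iota => /andP[/andP[pp pth] /andP[p0 _]].
  by rewrite pp p0 ltnS pth.
- by [].
Qed.

Lemma mid_prime_sum_le y N : (0 < y)%N -> (0 < N)%N ->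
  \sum_(1 <= p < N.+1 | prime p && (y < p)%N) p%:R^-1 <= (lnn N + 3) / lnn y.+1.
Proof.
move=> y0 N0; have l0 : 0 < lnn y.+1 by apply: lnn_gt0.
rewrite ler_pdivlMr //; apply: le_trans (mertens_le N0); rewrite mulr_suml.
apply: le_trans (_ : _ <= \sum_(1 <= p < N.+1 | prime p && (y < p)%N) lnn p / p%:R) _.
  apply: ler_sum_natP => p /andP[p0 _] /andP[pp yp]; rewrite mulrC.
  by rewrite ler_wpM2r ?invr_ge0 // lnn_le.
apply: ler_sum_sub => p _; first by case/andP.
by move=> _; rewrite divr_ge0 ?lnn_ge0.
Qed.

(** Lowering the exponent of the rough part from [delta - 1] to [-1] costs only [B^delta]. The new
    weight is completely multiplicative, so an Euler product applies; primes between [y] and [B]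
    then contribute about [ln B / ln y], and no prime factor exceeds [B]. *)
Lemma sparse_sum_le (delta : R) y B N : 0 < delta <= 1 / 4 -> (0 < y)%N -> (y < B)%N ->
  \sum_(1 <= a < N.+1 | (rough_part y a < B)%N) pw (- (1 - delta)) a <=
  pw delta B * expR (\sum_(1 <= p < y.+1 | prime p) pw (- (1 - delta)) p +
     (lnn B + 3) / lnn y.+1 + 5).
Proof.
move=> /andP[d0 d1] y0 yB; have B0 : (0 < B)%N by exact: leq_ltn_trans yB.
pose g p : R := if prime p then (if (p <= y)%N then pw (- (1 - delta)) p else pw (- 1) p) else 0.
have g1 p : prime p -> 0 <= g p <= 3 / 5 /\ g p ^+ 2 <= pw (- (3 / 2)) p.
  move=> pp; have p0 := prime_gt0 pp; rewrite /g pp; case: ifP => _.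
    by split; [apply: prime_pw34|apply: pw_sq_le] => //; lra.
  by split; [apply: prime_pw34|apply: pw_sq_le] => //; lra.
have gP p : 0 <= g p < 1.
  case pp : (prime p); last by rewrite /g pp lexx ltr01.
  by have [/andP[h1 h2] _] := g1 _ pp; apply/andP; split=> //; lra.
have g0 p : 0 <= g p by have /andP[] := gP p.
have sumg : \sum_(1 <= p < B.+1 | prime p) g p <=
    \sum_(1 <= p < y.+1 | prime p) pw (- (1 - delta)) p + (lnn B + 3) / lnn y.+1.
  rewrite (bigID (fun p => p <= y)%N) /=; apply: lerD.
    rewrite -big_filter -[leRHS]big_filter; apply: (@sum_inj_le _ _ _ _ _ id).
    - by rewrite filter_uniq // iota_uniq.
    - by move=> p _; rewrite pw_ge0.
    - move=> p; rewrite !mem_filter !mem_index_iota => /andP[/andP[pp py] /andP[p0 _]].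
      by rewrite pp p0 ltnS py /g pp py.
    - by [].
  apply: le_trans (mid_prime_sum_le y0 B0).
  rewrite le_eqVlt; apply/orP; left; apply/eqP; apply: eq_big => p; first by rewrite ltnNge.
  by move=> /andP[pp /negbTE py]; rewrite /g pp py pwN1 // prime_gt0.
have := le_trans (euler_sum_le B N gP) (euler_prod_le B g1).
move=> h; have {}h := le_trans h (_ : _ <= expR (\sum_(1 <= p < y.+1 | prime p) pw (- (1 - delta)) p +
     (lnn B + 3) / lnn y.+1 + 5)).
have {}h := h (eq_ind_r is_true (lerD sumg (lexx 5)) (ler_expR _ _)).
apply: le_trans (ler_wpM2l (pw_ge0 _ _) h); rewrite mulr_sumr.
apply: le_trans (_ : _ <= \sum_(1 <= a < N.+1 | (rough_part y a < B)%N) pw delta B * cmul g a) _.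
  apply: ler_sum_natP => a /andP[a0 _] ra.
  have D0 := rough_part_gt0 y a; have t0 := smooth_part_gt0 y a.
  rewrite {1 2}(rough_smooth_part y a0) cmulMn // pwM //.
  have -> : cmul g (rough_part y a) = pw (- 1) (rough_part y a).
    rewrite -cmul_pw //; apply: eq_cmul_prime => p pp /(rough_part_prime_gt pp) yp.
    by rewrite /g pp leqNgt yp.
  have -> : cmul g (smooth_part y a) = pw (- (1 - delta)) (smooth_part y a).
    rewrite -cmul_pw //; apply: eq_cmul_prime => p pp /(smooth_part_prime_le pp) yp.
    by rewrite /g pp yp.
  rewrite mulrA; apply: ler_wpM2r; first exact: pw_ge0.
  rewrite pw_split // pwN1 //; apply: ler_wpM2r; first by rewrite invr_ge0.
  by apply: pw_le; rewrite ?(ltW d0) // ltnW.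
apply: ler_sum_sub => a /andP[a0 _]; last by move=> _; rewrite mulr_ge0 ?pw_ge0 ?cmul_ge0.
move=> ra; apply/(smoothP _ a0) => p pp; rewrite {1}(rough_smooth_part y a0) Euclid_dvdM //.
case/orP => [/dvdn_leq|/(smooth_part_prime_le pp) py]; last by apply: leq_trans py (ltnW yB).
by move=> /(_ (rough_part_gt0 _ _)) h'; apply: leq_trans h' (ltnW ra).
Qed.

End Rankin.

Local Open Scope ring_scope.

Section Sparse.
Context {R : realType}.
Local Notation lnn := (@lnn R).
Local Notation pw := (@pw R).
Local Notation recip_sum := (@recip_sum R).
Implicit Types (delta : R).

Lemma max_pdiv_le n p : (0 < n)%N -> prime p -> (p %| n)%N -> (p <= max_pdiv n)%N.
Proof. by move=> n0 pp pn; apply: max_pdiv_max; rewrite mem_primes pp n0. Qed.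

Lemma pw_prime_sum_le delta N : 0 <= delta ->
  \sum_(1 <= p < N.+1 | prime p) pw (- (1 - delta)) p <= pw delta N * recip_sum N.
Proof.
move=> d0; rewrite /recip_sum mulr_sumr; apply: ler_sum_natP => p /andP[p0 pN] pp.
by rewrite pw_split // ler_wpM2r ?invr_ge0 // pw_le.
Qed.

Context (delta delta' H : R) (y K w M : nat).
Hypotheses (d01 : 0 < delta <= 1 / 8) (d01' : 0 < delta' <= 1 / 8).
Hypotheses (H0 : 0 <= H) (y0 : (0 < y)%N) (K0 : (0 < K)%N).
Hypothesis HH : forall a, (0 < a <= M)%N ->
  \sum_(w.+1 <= l < y.+1 | prime l && prime (a * l + 1)) l%:R^-1 <= H.

Let B := (y.+1 ^ K)%N.
(** Beyond this bound a rough part of [p - 1] below [B] forces the smooth part to exceed [y], as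
    [pred_bounds] shows. *)
Let B2 := (y.+1 ^ (K + 2))%N.
Let s := 1 - delta.

Let B0 : (0 < B)%N. Proof. by rewrite expn_gt0. Qed.
Let yB : (y < B)%N. Proof. by rewrite /B -[y.+1 in X in (X <= _)%N]expn1 leq_exp2l. Qed.

Let s0 : 0 <= s. Proof. by rewrite /s; case/andP: d01; lra. Qed.

Lemma small_part_sum :
  \sum_(1 <= p < M.+1 | sparse_prime y B p && (p <= B2)%N) pw (- s) p <=
  pw delta B2 * recip_sum B2.
Proof.
have /andP[d0 _] := d01; apply: le_trans (pw_prime_sum_le _ (ltW d0)).
rewrite -big_filter -[leRHS]big_filter; apply: (@sum_inj_le _ _ _ _ _ id).
- by rewrite filter_uniq // iota_uniq.
- by move=> p _; rewrite pw_ge0.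
- move=> p; rewrite !mem_filter !mem_index_iota.
  by move=> /andP[/andP[/andP[pp _] pB] /andP[p0 _]]; rewrite pp p0 ltnS pB.
- by [].
Qed.

Lemma pred_bounds p : sparse_prime y B p -> (B2 < p)%N ->
  [/\ (0 < p.-1)%N, (rough_part y p.-1 < B)%N & (y < smooth_part y p.-1)%N].
Proof.
move=> /andP[pp rB] pB; have p0 : (0 < p.-1)%N by rewrite -ltnS prednK ?prime_gt0 // prime_gt1.
split=> //; rewrite ltnNge; apply/negP => ty.
have := rough_smooth_part y p0; set D := rough_part _ _ in rB *; set t := smooth_part _ _ in ty *.
have B2E : B2 = (B * y.+1 * y.+1)%N by rewrite /B2 /B addn2 !expnSr.
have Bp := B0; clearbody D t B B2; move=> pE; clear -pE ty rB pB B2E Bp p0; nia.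
Qed.

Lemma pw_pred_le p : prime p -> pw (- s) p <= pw (- s) p.-1.
Proof.
have /andP[d0 d1] := d01; move=> pp; have p1 := prime_gt1 pp.
apply: pwN_le; [exact: s0|by rewrite -ltnS prednK // ltnW|exact: leq_pred].
Qed.

(** Here the smooth part [t] of [p - 1] exceeds [y] while all its prime factors are at most [w].
    Such [t] are rare: shifting the exponent by a further [delta'] gains [y^(- delta')]. The pair
    formed by the rough part and [t] determines [p]. *)
Lemma friable_part_sum :
  \sum_(1 <= p < M.+1 | [&& sparse_prime y B p, ~~ (p <= B2)%N &
      (max_pdiv (smooth_part y p.-1) <= w)%N]) pw (- s) p <=
  pw delta B * (1 + lnn B) * (pw (- delta') y.+1 *
    expR (pw (delta + delta') w * recip_sum w + 5)).
Proof.
have /andP[d0 d1] := d01; have /andP[d0' d1'] := d01'.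
pose tl := [seq t <- index_iota 1 M.+1 | smooth w t && (y < t)%N].
apply: le_trans (_ : _ <= \sum_(D <- index_iota 1 B.+1) \sum_(t <- tl) pw (- s) D * pw (- s) t) _.
  rewrite -big_filter -(big_allpairs (F := fun u => pw (- s) u.1 * pw (- s) u.2)).
  apply: (@sum_inj_le _ _ _ _ _ (fun p => (rough_part y p.-1, smooth_part y p.-1))).
  - by rewrite filter_uniq // iota_uniq.
  - by move=> u _; rewrite mulr_ge0 ?pw_ge0.
  - move=> p; rewrite mem_filter mem_index_iota => /andP[/and3P[sp pB mw] /andP[p0 pM]].
    rewrite -ltnNge in pB; have [q0 rB yt] := pred_bounds sp pB.
    have /andP[pp _] := sp; split; last first.
      apply: le_trans (pw_pred_le pp) _.
      by rewrite [X in pw _ X <= _](rough_smooth_part y q0) pwM ?rough_part_gt0 ?smooth_part_gt0.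
    apply/allpairsP; exists (rough_part y p.-1, smooth_part y p.-1); split=> //=.
      by rewrite mem_index_iota rough_part_gt0 ltnS ltnW.
    rewrite mem_filter mem_index_iota yt andbT smooth_part_gt0 /=; apply/andP; split.
      apply/(smoothP _ (smooth_part_gt0 _ _)) => q pq qd; apply: leq_trans mw.
      by apply: max_pdiv_le => //; exact: smooth_part_gt0.
    apply: leq_ltn_trans (leq_ltn_trans (leq_pred p) pM).
    by rewrite dvdn_leq // dvdn_part.
  - move=> p q; rewrite !mem_filter => /andP[/and3P[/andP[pp _] _ _] _] /andP[/and3P[/andP[pq _] _ _] _].
    have p1 := prime_gt1 pp; have q1 := prime_gt1 pq; move=> [e1 e2].
    have pq' : p.-1 = q.-1.
      by rewrite (@rough_smooth_part y p.-1) ?e1 ?e2 -?rough_smooth_part // -ltnS prednK // ltnW.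
    by rewrite -(prednK (ltnW p1)) pq' prednK // ltnW.
have -> : \sum_(D <- index_iota 1 B.+1) \sum_(t <- tl) pw (- s) D * pw (- s) t =
   (\sum_(D <- index_iota 1 B.+1) pw (- s) D) * \sum_(t <- tl) pw (- s) t.
  by rewrite mulr_suml; apply: eq_bigr => D _; rewrite mulr_sumr.
apply: ler_pM; [by apply: sumr_ge0 => *; rewrite pw_ge0|by apply: sumr_ge0 => *; rewrite pw_ge0| | ].
  apply: le_trans (ler_wpM2l (pw_ge0 _ _) (harmonic_le B)); rewrite mulr_sumr.
  apply: ler_sum_natP => D /andP[D0 DB] _; rewrite pw_split //.
  by rewrite ler_wpM2r ?invr_ge0 // pw_le // ltW.
rewrite big_filter.
have s34 : 3 / 4 <= 1 - (delta + delta') by lra.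
have := smooth_sum_le w M s34.
have := @pw_prime_sum_le (delta + delta') w (addr_ge0 (ltW d0) (ltW d0')).
set S1 := \sum_(1 <= p < w.+1 | _) _; set S2 := \sum_(1 <= a < M.+1 | smooth w a) _.
move=> h1 h2; apply: le_trans (_ : _ <= pw (- delta') y.+1 * S2) _; last first.
  apply: ler_wpM2l; first exact: pw_ge0.
  by apply: le_trans h2 _; rewrite ler_expR lerD2r.
rewrite /S2 mulr_sumr.
apply: le_trans (_ : _ <= \sum_(1 <= t < M.+1 | smooth w t && (y < t)%N) 
   pw (- delta') y.+1 * pw (- (1 - (delta + delta'))) t) _; last first.
  apply: ler_sum_sub => t _; first by case/andP.
  by move=> _; rewrite mulr_ge0 ?pw_ge0.
apply: ler_sum_natP => t /andP[t0 _] /andP[_ yt].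
have -> : - s = - delta' + (- (1 - (delta + delta'))) by rewrite /s; ring.
rewrite pwD; apply: ler_wpM2r; first exact: pw_ge0.
by apply: pwN_le => //; exact: ltW.
Qed.

(** Write [p - 1 = a l] with [l > w] the largest prime of the smooth part. Since [l <= y], removing
    it leaves the rough part unchanged, so [a] is summed by [sparse_sum_le]. For fixed [a] the
    primes [l] with [a l + 1] prime are summed by [H]. *)
Lemma large_part_sum :
  \sum_(1 <= p < M.+1 | [&& sparse_prime y B p, ~~ (p <= B2)%N &
      ~~ (max_pdiv (smooth_part y p.-1) <= w)%N]) pw (- s) p <=
  pw delta B * expR (\sum_(1 <= p < y.+1 | prime p) pw (- s) p +
     (lnn B + 3) / lnn y.+1 + 5) * (pw delta y * H).
Proof.
have /andP[d0 d1] := d01.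
pose al := [seq a <- index_iota 1 M.+1 | (rough_part y a < B)%N].
pose ll := [seq l <- index_iota w.+1 y.+1 | prime l].
pose G a l : R := if prime (a * l + 1) then pw (- s) a * pw (- s) l else 0.
apply: le_trans (_ : _ <= \sum_(a <- al) \sum_(l <- ll) G a l) _.
  rewrite -big_filter -(big_allpairs (F := fun u => G u.1 u.2)).
  apply: (@sum_inj_le _ _ _ _ _ (fun p => (p.-1 %/ max_pdiv (smooth_part y p.-1), max_pdiv (smooth_part y p.-1))%N)).
  - by rewrite filter_uniq // iota_uniq.
  - by move=> u _; rewrite /G; case: ifP => // _; rewrite mulr_ge0 ?pw_ge0.
  - move=> p; rewrite mem_filter mem_index_iota => /andP[/and3P[sp pB mw] /andP[p0 pM]].
    rewrite -ltnNge in pB; have [q0 rB yt] := pred_bounds sp pB.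
    have /andP[pp _] := sp; rewrite -ltnNge in mw.
    have t1 : (1 < smooth_part y p.-1)%N by apply: leq_ltn_trans yt.
    have lp := max_pdiv_prime t1; have ld := max_pdiv_dvd (smooth_part y p.-1).
    have ly := smooth_part_prime_le lp ld.
    set l := max_pdiv _ in mw lp ld ly *.
    have lp1 : (l %| p.-1)%N by rewrite (rough_smooth_part y q0) dvdn_mull.
    have pE : (p.-1 %/ l * l)%N = p.-1 by rewrite divnK.
    have a0 : (0 < p.-1 %/ l)%N by rewrite divn_gt0 ?prime_gt0 // dvdn_leq.
    split; last first.
      rewrite /G /= pE addn1 prednK // pp -pwM ?pE ?a0 //; [exact: pw_pred_le|exact: prime_gt0].
    apply/allpairsP; exists (p.-1 %/ l, l)%N; split=> //=.
      rewrite mem_filter mem_index_iota a0 /=; apply/andP; split; last first.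
        by rewrite ltnS (leq_trans (leq_div _ _)) // -ltnS prednK // ltnW.
      by move: rB; rewrite -{1}pE (rough_partM _ a0 (prime_gt0 lp)) (rough_part_small_prime lp ly) muln1.
    by rewrite mem_filter mem_index_iota lp mw ltnS ly.
  - move=> p q; rewrite !mem_filter !mem_index_iota.
    move=> /andP[/and3P[sp pB _] _] /andP[/and3P[sq qB _] _].
    rewrite -!ltnNge in pB qB.
    have [p0 _ py] := pred_bounds sp pB; have [q0 _ qy] := pred_bounds sq qB.
    move=> [e1 e2].
    have dv r : (0 < r.-1)%N -> (max_pdiv (smooth_part y r.-1) %| r.-1)%N.
      by move=> r0; rewrite {2}(rough_smooth_part y r0) dvdn_mull // max_pdiv_dvd.
    have : p.-1 = q.-1 by rewrite -(divnK (dv _ p0)) -(divnK (dv _ q0)) e1 e2.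
    by move: p0 q0; clear; lia.
have d2 : 0 < delta <= 1 / 4 by rewrite d0 /=; lra.
have := sparse_sum_le M d2 y0 yB; set S := \sum_(1 <= a < M.+1 | _) _ => hS.
apply: le_trans (_ : _ <= \sum_(a <- al) pw (- s) a * (pw delta y * H)) _; last first.
  rewrite -mulr_suml; apply: ler_wpM2r; first by rewrite mulr_ge0 ?pw_ge0.
  by rewrite big_filter.
rewrite !big_seq; apply: ler_sum => a; rewrite mem_filter mem_index_iota => /andP[_ aM].
apply: le_trans (_ : _ <= pw (- s) a * (pw delta y *
    \sum_(w.+1 <= l < y.+1 | prime l && prime (a * l + 1)) l%:R^-1)) _; last first.
  by rewrite !ler_wpM2l ?pw_ge0 // HH.
rewrite big_filter !mulr_sumr big_mkcondr /=; apply: ler_sum_natP => l /andP[wl ly] pl.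
rewrite /G; case: ifP => // _; apply: ler_wpM2l; first exact: pw_ge0.
rewrite /s pw_split ?prime_gt0 // ler_wpM2r ?invr_ge0 // pw_le ?prime_gt0 //; exact: ltW.
Qed.

Theorem sparse_prime_sum_le :
  \sum_(1 <= p < M.+1 | sparse_prime y B p) pw (- s) p <=
  pw delta B2 * recip_sum B2 +
  pw delta B * (1 + lnn B) * (pw (- delta') y.+1 *
    expR (pw (delta + delta') w * recip_sum w + 5)) +
  pw delta B * expR (\sum_(1 <= p < y.+1 | prime p) pw (- s) p +
     (lnn B + 3) / lnn y.+1 + 5) * (pw delta y * H).
Proof.
rewrite (bigID (fun p => p <= B2)%N) /= -addrA; apply: lerD; first exact: small_part_sum.
rewrite (bigID (fun p => max_pdiv (smooth_part y p.-1) <= w)%N) /=; apply: lerD.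
  by under eq_bigl do rewrite -andbA; exact: friable_part_sum.
by under eq_bigl do rewrite -andbA; exact: large_part_sum.
Qed.

End Sparse.

(** * Counting by Rankin's method, by square divisors and by pairs *)

Local Open Scope ring_scope.

Section Counts.
Context {R : realType}.
Local Notation lnn := (@lnn R).
Local Notation pw := (@pw R).
Local Notation recip_sum := (@recip_sum R).

Lemma cnt_sum N (P : pred nat) : (cnt N P)%:R = \sum_(1 <= n < N.+1 | P n) 1 :> R.
Proof.
rewrite big_const_seq iter_addr_0 /cnt /index_iota subn1.
by congr (_%:R); apply: eq_count => n; apply: asboolb.
Qed.

Lemma rankin_le s N (P : pred nat) : 0 <= s -> (0 < N)%N ->
  (cnt N P)%:R <= pw s N * \sum_(1 <= n < N.+1 | P n) pw (- s) n.
Proof.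
move=> s0 N0; rewrite cnt_sum mulr_sumr; apply: ler_sum_natP => n /andP[n0 nN] _.
rewrite {1}(_ : 1 = pw (s - s) n); last by rewrite subrr /pw mul0r expR0.
by rewrite pwD ler_wpM2r ?pw_ge0 // pw_le.
Qed.

Definition sparse y B n := all (sparse_prime y B) (primes n).

Lemma sparse_count delta y B N : 0 < delta <= 1 / 4 -> (0 < N)%N ->
  (cnt N (sparse y B))%:R <= pw (1 - delta) N *
    expR (\sum_(1 <= p < N.+1 | sparse_prime y B p) pw (- (1 - delta)) p + 5).
Proof.
move=> /andP[d0 d1] N0; have s0 : 0 <= 1 - delta by lra.
apply: le_trans (rankin_le _ s0 N0) _; apply: ler_wpM2l; first exact: pw_ge0.
pose g p : R := if sparse_prime y B p then pw (- (1 - delta)) p else 0.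
have g1 p : prime p -> 0 <= g p <= 3 / 5 /\ g p ^+ 2 <= pw (- (3 / 2)) p.
  move=> pp; rewrite /g; case: ifP => _; last first.
    by rewrite lexx expr0n /= pw_ge0 divr_ge0.
  by split; [apply: prime_pw34|apply: pw_sq_le; rewrite ?prime_gt0] => //; lra.
have gP p : 0 <= g p < 1.
  case pp : (prime p); last by rewrite /g /sparse_prime pp lexx ltr01.
  by have [/andP[h1 h2] _] := g1 _ pp; apply/andP; split=> //; lra.
have g0 p : 0 <= g p by have /andP[] := gP p.
have -> : \sum_(1 <= p < N.+1 | sparse_prime y B p) pw (- (1 - delta)) p =
   \sum_(1 <= p < N.+1 | prime p) g p.
  rewrite [RHS](bigID (sparse_prime y B)) /= [X in _ = _ + X]big1 ?addr0.
    apply: eq_big => p; first by rewrite /sparse_prime; case: (prime p).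
    by rewrite /g => ->.
  by move=> p /andP[_ /negbTE sp]; rewrite /g sp.
apply: le_trans (euler_prod_le _ g1); apply: le_trans (euler_sum_le N N gP).
apply: le_trans (_ : _ <= \sum_(1 <= n < N.+1 | sparse y B n) cmul g n) _.
  apply: ler_sum_natP => n /andP[n0 _] /allP sn.
  rewrite -cmul_pw // le_eqVlt; apply/orP; left; apply/eqP.
  apply: eq_cmul_prime => p pp pn; rewrite /g ifT //; apply: sn.
  by rewrite mem_primes pp n0.
apply: ler_sum_sub => n /andP[n0 nN]; last by move=> _; apply: cmul_ge0.
move=> _; apply/(smoothP _ n0) => p pp pn.
by apply: leq_trans (dvdn_leq n0 pn) _; rewrite -ltnS.
Qed.

Lemma smooth_count delta Q N : 0 < delta <= 1 / 4 -> (0 < N)%N ->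
  (cnt N (smooth Q))%:R <= pw (1 - delta) N * expR (pw delta Q * recip_sum Q + 5).
Proof.
move=> /andP[d0 d1] N0; have s0 : 0 <= 1 - delta by lra.
apply: le_trans (rankin_le _ s0 N0) _; apply: ler_wpM2l; first exact: pw_ge0.
apply: le_trans (smooth_sum_le _ _ _) _; first by lra.
by rewrite ler_expR lerD2r pw_prime_sum_le // ltW.
Qed.

Lemma cnt_sum_ex (T : eqType) N (s : seq T) (P : T -> nat -> Prop) :
  (cnt N (fun n => exists2 i, i \in s & P i n))%:R <=
  \sum_(i <- s) (cnt N (P i))%:R :> R.
Proof. by rewrite -natr_sum ler_nat cnt_ex. Qed.

Lemma pw_div_le s N j : 0 <= s -> (0 < j <= N)%N ->
  pw s (N %/ j) <= pw s N * pw (- s) j.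
Proof.
move=> s0 /andP[j0 jN]; have d0 : (0 < N %/ j)%N by rewrite divn_gt0.
have : pw s (N %/ j * j) <= pw s N by apply: pw_le; rewrite ?muln_gt0 ?d0 ?leq_trunc_div.
rewrite pwM // => h; have := ler_wpM2r (pw_ge0 (- s) j) h.
by rewrite -mulrA -pwD subrr /pw mul0r expR0 mulr1.
Qed.

(** Serves the degenerate case, where [n = a q] with [q - 1] smooth: hence the successor in [k.+1].
    For fixed [j] one counts smooth [k] up to [N / j]; summing [j^(delta - 1)] over [j <= J0] loses
    [J0^delta]. *)
Lemma friable_product_count delta Q N J0 : 0 < delta <= 1 / 4 -> (0 < N)%N ->
  (cnt N (fun n => exists2 j, j \in index_iota 1 J0.+1 &
      exists2 k, smooth Q k /\ (0 < k)%N & n = (j * k.+1)%N))%:R <=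
  pw (1 - delta) N * (pw delta J0 * (1 + lnn J0)) * expR (pw delta Q * recip_sum Q + 5).
Proof.
move=> dd N0; have /andP[d0 d1] := dd; apply: le_trans (cnt_sum_ex _ _ _) _.
set E := expR _; have E0 : 0 <= E by apply: expR_ge0.
apply: le_trans (_ : _ <= \sum_(1 <= j < J0.+1) pw (1 - delta) N * pw (- (1 - delta)) j * E) _.
  apply: ler_sum_natP => j /andP[j0 _] _.
  have [jN|Nj] := leqP j N; last first.
    have -> : cnt N (fun n => exists2 k, smooth Q k /\ (0 < k)%N & n = (j * k.+1)%N) = 0%N.
      apply/eqP; rewrite -leqn0; apply: (@leq_trans (size ([::] : seq nat))) => //.
      apply: (@cnt_inj _ _ _ id) => // n /andP[_ nN] [k _ nE].
      by move: nN; rewrite nE mulnS; move: Nj; clear; lia.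
    apply: mulr_ge0; last exact: E0.
    by apply: mulr_ge0; exact: pw_ge0.
  have jj : (0 < j <= N)%N by rewrite j0.
  apply: le_trans (_ : _ <= (cnt (N %/ j) (smooth Q))%:R) _.
    rewrite ler_nat [X in (_ <= X)%N]/cnt -size_filter; apply: (@cnt_inj _ _ _ (fun n => (n %/ j).-1)).
      move=> n /andP[n0 nN] [k [sk k0] nE]; rewrite nE mulKn //= mem_filter mem_iota k0 /=.
      apply/andP; split; first exact/asboolP.
      rewrite add1n ltnS; apply: leq_trans (leqnSn k) _; rewrite leq_divRL //.
      by rewrite mulnC -nE.
    by move=> m n _ _ [k [_ k0] ->] [l [_ l0] ->]; rewrite !mulKn //= => ->.
  have d0' : (0 < N %/ j)%N by rewrite divn_gt0.
  apply: le_trans (smooth_count Q dd d0') _; rewrite -/E; apply: ler_wpM2r => //.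
  by apply: pw_div_le => //; lra.
rewrite -mulr_suml -mulr_sumr; apply: ler_wpM2r => //; apply: ler_wpM2l; first exact: pw_ge0.
apply: le_trans (ler_wpM2l (pw_ge0 _ _) (harmonic_le J0)); rewrite mulr_sumr.
apply: ler_sum_natP => j /andP[j0 jJ] _; rewrite pw_split //.
by rewrite ler_wpM2r ?invr_ge0 // pw_le // ltW.
Qed.

Lemma cnt_dvd N m : (0 < m)%N -> (cnt N (fun n => (m %| n)%N))%:R <= N%:R / m%:R :> R.
Proof.
move=> m0; apply: le_trans (natdiv_le m N); rewrite ler_nat.
rewrite -[X in (_ <= X)%N](size_iota 1).
apply: (@cnt_inj _ _ _ (fun n => n %/ m)%N).
  move=> n /andP[n0 nN] mn; rewrite mem_iota add1n ltnS leq_div2r // andbT.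
  by rewrite divn_gt0 // dvdn_leq.
by move=> a b _ _ ma mb ab; rewrite -(divnK ma) ab divnK.
Qed.

Lemma square_count T0 N : (0 < T0)%N ->
  (cnt N (fun n => exists2 t, (T0 <= t)%N & (t ^ 2 %| n)%N))%:R <= N%:R * (2 / T0%:R) :> R.
Proof.
move=> T00.
apply: le_trans (_ : _ <= \sum_(t <- index_iota T0 (T0 + N.+1)) N%:R / (t ^ 2)%:R) _.
  apply: le_trans (_ : _ <= (cnt N (fun n => exists2 t, t \in index_iota T0 (T0 + N.+1) & (t ^ 2 %| n)%N))%:R) _.
    rewrite ler_nat; apply: cnt_le => n /andP[n0 nN] [t Tt tn]; exists t => //.
    rewrite mem_index_iota Tt /=.
    have := dvdn_leq n0 tn; move: nN; rewrite expnS expn1; clear; nia.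
  apply: le_trans (cnt_sum_ex _ _ _) _; rewrite !big_seq; apply: ler_sum => t.
  rewrite mem_index_iota => /andP[Tt _]; apply: cnt_dvd; rewrite expn_gt0.
  by rewrite (leq_trans T00).
rewrite -mulr_sumr; apply: ler_wpM2l => //.
suff H k : \sum_(t <- index_iota T0 (T0 + k)) (t ^ 2)%:R^-1 <= 2 / T0%:R - 2 / (T0 + k)%:R :> R.
  by apply: le_trans (H _) _; rewrite lerBlDr lerDl divr_ge0.
elim: k => [|k IHk]; first by rewrite addn0 big_geq // subrr.
rewrite addnS big_nat_recr ?leq_addr //=; apply: le_trans (lerD IHk (lexx _)) _.
rewrite -[(T0 + k).+1%:R]natr1 natrX.
have t1 : (1 : R) <= (T0 + k)%:R by rewrite ler1n addn_gt0 T00.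
move: t1; set t := (T0 + k)%:R => t1; have t0 : 0 < t by lra.
rewrite -subr_ge0.
have -> : 2 / T0%:R - 2 / (t + 1) - (2 / T0%:R - 2 / t + (t ^+ 2)^-1) =
  (t - 1) / (t ^+ 2 * (t + 1)).
  by field; rewrite !gt_eqF //= ?ltr0n //; lra.
by rewrite divr_ge0 ?mulr_ge0 ?exprn_ge0 //; lra.
Qed.

Lemma pair_count N E (P : nat -> nat -> nat -> Prop) :
  (forall a b m n, P a b m -> P a b n -> m = n) ->
  (cnt N (fun n => exists a b, [/\ (0 < a)%N, (0 < b)%N, (a * b <= E)%N & P a b n]))%:R <=
    E%:R * (1 + lnn E).
Proof.
move=> inj; pose s := [seq (a, b) | a <- iota 1 E, b <- iota 1 (E %/ a)].
apply: le_trans (_ : _ <= (cnt N (fun n => exists2 u, u \in s & P u.1 u.2 n))%:R) _.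
  rewrite ler_nat; apply: cnt_le => n _ [a [b [a0 b0 abE Pn]]]; exists (a, b) => //.
  apply/allpairsPdep; exists a, b; split=> //; rewrite mem_iota add1n ltnS.
    by rewrite a0 (leq_trans _ abE) // leq_pmulr.
  by rewrite b0 leq_divRL // mulnC.
apply: le_trans (cnt_sum_ex _ _ _) _.
apply: le_trans (_ : _ <= \sum_(u <- s) 1) _.
  apply: ler_sum => u _; rewrite lern1 -[1%N]/(size [:: tt]).
  apply: (@cnt_inj _ _ _ (fun=> tt)) => // m n _ _ Pm Pn _; exact: inj Pm Pn.
rewrite (big_allpairs_dep (F := fun=> 1)) /=.
apply: le_trans (ler_wpM2l (ler0n _ E) (harmonic_le E)); rewrite mulr_sumr /index_iota subn1.
apply: ler_sum => a _; rewrite big_const_seq count_predT size_iota iter_addr_0.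
exact: natdiv_le.
Qed.

End Counts.

(** * Lists of primes sharing the rough part of p - 1 *)

Local Open Scope nat_scope.

(* In a pair [(d, q)] of a linked list, [q] is a prime factor of [n + h] and [d] a common
   divisor of [q - 1] and of [p - 1] for a fixed prime [p | n]. *)
Definition linked y (s : seq (nat * nat)) :=
  uniq (map snd s) &&
  all (fun u => [&& prime u.2, u.1 %| u.2.-1 & y < u.1]) s.

Definition dprod (s : seq (nat * nat)) := \prod_(u <- s) u.1.
Definition pprod (s : seq (nat * nat)) := \prod_(u <- s) u.2.

Lemma leq_prod_const (T : eqType) (s : seq T) (F : T -> nat) c :
  (forall i, i \in s -> F i <= c) -> \prod_(i <- s) F i <= c ^ size s.
Proof.
elim: s => [|i s IHs] Fc; first by rewrite big_nil.
rewrite big_cons expnS leq_mul ?Fc ?inE ?eqxx // IHs // => j js.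
by rewrite Fc // inE js orbT.
Qed.

Lemma geq_prod_const (T : eqType) (s : seq T) (F : T -> nat) c :
  (forall i, i \in s -> c <= F i) -> c ^ size s <= \prod_(i <- s) F i.
Proof.
elim: s => [|i s IHs] Fc; first by rewrite big_nil.
rewrite big_cons expnS leq_mul ?Fc ?inE ?eqxx // IHs // => j js.
by rewrite Fc // inE js orbT.
Qed.

Lemma prod_pos_seq (T : eqType) (s : seq T) (F : T -> nat) :
  (forall i, i \in s -> 0 < F i) -> 0 < \prod_(i <- s) F i.
Proof. by move=> F0; rewrite big_seq; apply: prodn_cond_gt0 => i; apply: F0. Qed.

Lemma dprod_le_pprod y s : linked y s -> dprod s <= pprod s.
Proof.
move=> /andP[_ /allP ok]; apply: leq_prod_seq => u /ok /and3P[pu du _].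
have p1 := prime_gt1 pu; apply: leq_trans (leq_pred _).
by apply: dvdn_leq => //; rewrite -ltnS prednK // ltnW.
Qed.

(** With [t + 1] such primes, the [t]-th power of their product would be at least
    [N^(t+1) > (2 N)^t >= m^t]. *)
Lemma few_big_primes t N m : 0 < t -> 2 ^ t < N -> 0 < m <= N + N ->
  size [seq p <- primes m | N < p ^ t] <= t.
Proof.
move=> t0 tN /andP[m0 mN]; set s := [seq p <- primes m | N < p ^ t].
rewrite leqNgt; apply/negP => st.
have : \prod_(p <- s) p <= m.
  apply: dvdn_leq => //; apply: prod_primes_dvd.
  - by rewrite filter_uniq // primes_uniq.
  - by apply/allP => p; rewrite mem_filter => /andP[_ /primesP[]].
  - by move=> p; rewrite mem_filter => /andP[_ /primesP[]].
move=> sm; have : N ^ t.+1 <= m ^ t.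
  apply: (@leq_trans ((\prod_(p <- s) p) ^ t)); last by rewrite leq_exp2r.
  have -> : (\prod_(p <- s) p) ^ t = \prod_(p <- s) p ^ t.
    by apply: (big_morph (fun x => x ^ t)); [move=> a b; rewrite expnMn|rewrite exp1n].
  apply: (@leq_trans (N ^ size s)).
    by rewrite leq_exp2l // (leq_trans _ tN) // ltnS expn_gt0.
  by apply: geq_prod_const => p; rewrite mem_filter => /andP[/ltnW].
have : m ^ t <= 2 ^ t * N ^ t by rewrite -expnMn leq_exp2r // mul2n -addnn.
move=> h1 h2; have := leq_trans h2 h1; rewrite expnS leq_mul2r => /orP[|].
  by rewrite expn_eq0 => /andP[/eqP N0 _]; move: tN; rewrite N0.
by rewrite leqNgt tN.
Qed.

Lemma rough_part_divisor_gt y m d : d %| rough_part y m -> 1 < d -> y < d.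
Proof.
move=> dr d1; have pp := pdiv_prime d1.
apply: leq_trans (rough_part_prime_gt pp (dvdn_trans (pdiv_dvd d) dr)) _.
by apply: dvdn_leq; [exact: ltnW|exact: pdiv_dvd].
Qed.

Lemma prad_dvd_totient n p : prime p -> p %| n -> 0 < n -> p.-1 %| totient n.
Proof.
move=> pp pn n0; rewrite totient_excess // dvdn_mull //.
by apply: (dvdn_prod_mem (fun p => p.-1)); rewrite mem_primes pp n0.
Qed.

Section Structure.
Context (J y N n h p E : nat).
(** Budget for the rough part, in powers of [Q]: [2 J] may be lost to [excess m], and [K2] to each
    of the at most [t] primes [q] of [m] with [q^t > N], so that [K2] remains for the small primes.
    The value [t = 8 J] ensures that a product of at most [2 J] small primes is at most
    [N^(1/4)]. *)
Let K2 := 2 * J.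
Let t := 8 * J.
Let K := 2 * J + K2 * t.+1.
Let Q := y.+1.
Let m := n + h.
Let D0 := rough_part y p.-1.
Hypotheses (J0 : 0 < J) (y0 : 0 < y) (n0 : 0 < n) (nN : n <= N) (hN : h <= N).
Hypotheses (phi_eq : totient n = totient m) (pp : prime p) (pn : p %| n).
Hypotheses (D0K : Q ^ K <= D0) (em : excess m < Q ^ (2 * J)).
Hypothesis pair : forall p', prime p' -> p' %| m -> p * p' * E.+1 <= 2 * N ^ 2.
Hypotheses (EN : E < 2 * N) (tN : 2 ^ t < N).

Let m0 : 0 < m. Proof. by rewrite addn_gt0 n0. Qed.
Let t0 : 0 < t. Proof. by rewrite muln_gt0. Qed.
Let N0 : 0 < N. Proof. exact: leq_trans n0 nN. Qed.

(** The rough part of [p - 1] divides the totient of [n], hence that of [m], which is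
    [excess m * prad m]. Its common divisor with [excess m] is below [Q^(2 J)]; the cofactor divides
    the product of the [q - 1] and is distributed among them. *)
Lemma pred_factorization : exists d : nat -> nat,
  [/\ Q ^ (K2 * t.+1) < \prod_(q <- primes m) d q,
      \prod_(q <- primes m) d q %| D0 &
      forall q, q \in primes m -> d q %| q.-1].
Proof.
have D00 : 0 < D0 by apply: rough_part_gt0.
have D0phi : D0 %| excess m * prad m.
  rewrite -totient_excess // -phi_eq; apply: dvdn_trans (prad_dvd_totient pp pn n0).
  exact: dvdn_part.
set g := gcdn D0 (excess m).
have g0 : 0 < g by rewrite gcdn_gt0 D00.
have gD : g %| D0 by rewrite dvdn_gcdl.
have Dg0 : 0 < D0 %/ g by rewrite divn_gt0 // dvdn_leq.
have Dg : D0 %/ g %| prad m.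
  have cop : coprime (D0 %/ g) (excess m %/ g).
    by rewrite /coprime -(eqn_pmul2r g0) muln_gcdl !divnK ?dvdn_gcdl ?dvdn_gcdr // mul1n.
  rewrite -(Gauss_dvdr _ cop) -(dvdn_pmul2r g0) divnK // mulnAC divnK //.
  exact: dvdn_gcdr.
have [d [dE dF]] := dvdn_prod_split (primes_uniq m) Dg0 Dg.
exists d; split=> //; last by rewrite -dE dvdn_div.
rewrite -dE -(ltn_pmul2r g0) divnK //.
apply: leq_trans D0K; rewrite /K addnC expnD ltn_pmul2l ?expn_gt0 //.
by apply: leq_ltn_trans em; apply: dvdn_leq (dvdn_gcdr _ _); rewrite excess_gt0.
Qed.

(** If one large [q] already carries a divisor at least [Q^K2], the list is that single pair and
    [pair] applies to it. Otherwise the few large primes carry at most [Q^(K2 * t)], so more than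
    [Q^K2] remains on the small ones. *)
Lemma linked_list : exists s : seq (nat * nat),
  [/\ linked y s, size s <= K2, Q ^ K2 <= dprod s, dprod s %| p.-1 &
      all (fun u => u.2 %| m) s] /\
  (p * pprod s * E.+1 <= 2 * N ^ 2 \/ all (fun u => u.2 ^ t <= N) s).
Proof.
have [d [dlow dD dq]] := pred_factorization.
have dDp : D0 %| p.-1 by apply: dvdn_part.
pose big := [seq q <- primes m | N < q ^ t].
pose small := [seq q <- primes m | ~~ (N < q ^ t)].
have prodE : \prod_(q <- primes m) d q = (\prod_(q <- big) d q) * \prod_(q <- small) d q.
  by rewrite !big_filter (bigID (fun q => N < q ^ t)).
have K20 : 0 < K2 by rewrite muln_gt0.
have dr q : q \in primes m -> d q %| D0.
  by move=> qm; apply: dvdn_trans dD; apply: dvdn_prod_mem.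
have d0 q : q \in primes m -> 0 < d q.
  by move=> qm; have := dvdn_gt0 (rough_part_gt0 y p.-1) (dr _ qm).
have [/hasP[q qb Wd]|/hasPn nob] := boolP (has (fun q => Q ^ K2 <= d q) big).
  have qm : q \in primes m by move: qb; rewrite mem_filter => /andP[].
  have [pq _ qdm] := primesP qm.
  exists [:: (d q, q)]; rewrite /dprod /pprod /linked !big_seq1 /= !andbT; split.
    split=> //; last by apply: dvdn_trans dDp; apply: dr.
    rewrite pq dq //=; apply: (rough_part_divisor_gt (dr _ qm)).
    by apply: leq_trans Wd; apply: leq_trans (ltn_expl _ _); rewrite ?ltnS.
  by left; apply: pair.
have bigW : \prod_(q <- big) d q <= Q ^ (K2 * t).
  apply: (@leq_trans ((Q ^ K2) ^ size big)).
    by apply: leq_prod_const => q /nob; rewrite -ltnNge => /ltnW.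
  rewrite -expnM leq_exp2l // leq_mul2l few_big_primes ?orbT // m0 /= leq_add //.
have smallW : Q ^ K2 < \prod_(q <- small) d q.
  rewrite ltnNge; apply/negP => sW; move: dlow; rewrite prodE ltnNge.
  by rewrite mulnS addnC expnD leq_mul.
pose s0 := [seq q <- small | 1 < d q].
have s0E : \prod_(q <- s0) d q = \prod_(q <- small) d q.
  rewrite big_filter [RHS](bigID (fun q => 1 < d q)) /= [X in _ = _ * X]big_seq_cond.
  rewrite [X in _ = _ * X]big1 ?muln1 // => q /andP[]; rewrite mem_filter => /andP[_ qm].
  by rewrite -leqNgt; have := d0 _ qm; case: (d q) => // -[].
have mem_s0 q : q \in s0 -> [/\ q \in primes m, q ^ t <= N & 1 < d q].
  by rewrite !mem_filter -leqNgt => /and3P[].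
(* A divisor of a rough part other than 1 is at least [Q], so [K2] nontrivial divisors already have
   product at least [Q^K2]. *)
pose s1 := take K2 s0.
have mem_s1 q : q \in s1 -> q \in s0 by apply: mem_take.
exists [seq (d q, q) | q <- s1].
have us0 : uniq s0 by rewrite !filter_uniq // primes_uniq.
split; last first.
  by right; rewrite all_map; apply/allP => q /= /mem_s1/mem_s0[].
have dpE : dprod [seq (d q, q) | q <- s1] = \prod_(q <- s1) d q by rewrite /dprod big_map.
split.
- rewrite /linked -map_comp map_id take_uniq //= all_map; apply/allP => q /= /mem_s1/mem_s0[qm _ d1].
  have [pq _ _] := primesP qm; rewrite pq dq //=.
  exact: (rough_part_divisor_gt (dr _ qm)).
- by rewrite size_map size_take_min geq_minl.
- rewrite dpE; have [sz|sz] := leqP (size s0) K2.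
    by rewrite /s1 take_oversize // s0E ltnW.
  have <- : size s1 = K2 by rewrite size_takel // ltnW.
  apply: geq_prod_const => q /mem_s1/mem_s0[qm _ d1].
  exact: (rough_part_divisor_gt (dr _ qm)).
- rewrite dpE; apply: dvdn_trans dDp; apply: dvdn_trans dD.
  rewrite prodE dvdn_mull // -s0E -[s0](cat_take_drop K2) big_cat dvdn_mulr //.
- by rewrite all_map; apply/allP => q /= /mem_s1/mem_s0[/primesP[]].
Qed.

(** When all primes of the list are small, [P = pprod s] satisfies [P^4 <= N]. If [p^2 <= N], then
    [p P <= N] and the first bound follows from [E < 2 N]. Otherwise [n / p] is at most [N^(1/2)],
    and so is [dprod s * P <= P^2]. *)
Lemma linked_list_cases : exists s : seq (nat * nat),
  [/\ linked y s, size s <= K2, Q ^ K2 <= dprod s, dprod s %| p.-1 &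
      all (fun u => u.2 %| m) s] /\
  (p * pprod s * E.+1 <= 2 * N ^ 2 \/ (n %/ p) * (dprod s * pprod s) <= N).
Proof.
have [s [[ls sK Ds Dp sm] [|small]]] := linked_list; first by move=> H; exists s; split=> //; left.
exists s; split=> //.
have P4 : pprod s ^ 4 <= N.
  have J4 : 0 < K2 by rewrite muln_gt0.
  rewrite -(@leq_exp2r _ _ K2) // -expnM.
  have -> : 4 * K2 = t by rewrite /t /K2; lia.
  have -> : pprod s ^ t = \prod_(u <- s) u.2 ^ t.
    by apply: (big_morph (fun x => x ^ t)); [move=> a b; rewrite expnMn|rewrite exp1n].
  apply: (@leq_trans (N ^ size s)); first by apply: leq_prod_const => u; apply: (allP small).
  by rewrite leq_exp2l //; apply: leq_trans tN; rewrite ltnS expn_gt0.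
have DP := dprod_le_pprod ls.
set P := pprod s in P4 DP *; set D := dprod s in DP *.
have [p2|p2] := leqP (p ^ 2) N.
  left; have pPN : p * P <= N.
    rewrite -(@leq_exp2r _ _ 4) // expnMn (@leq_trans (N ^ 2 * N)) //.
      by rewrite leq_mul // (expnM p 2 2) leq_exp2r.
    by rewrite -expnSr leq_exp2l //; apply: leq_trans tN; rewrite ltnS expn_gt0.
  by rewrite mulnC; apply: leq_trans (leq_mul EN pPN) _; rewrite -mulnA.
right; set a := n %/ p.
have apn : a * p <= N by apply: leq_trans nN; rewrite leq_trunc_div.
have a2 : a ^ 2 <= N.
  have [->//|a0] := posnP a.
  rewrite -(leq_pmul2r N0); apply: (@leq_trans (a ^ 2 * p ^ 2)).
    by rewrite leq_mul2l ltnW ?orbT.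
  by rewrite -expnMn mulnn leq_exp2r.
have DP2 : (D * P) ^ 2 <= N.
  apply: leq_trans P4; rewrite (expnM P 2 2) leq_exp2r // -mulnn leq_mul //.
by rewrite -(@leq_exp2r _ _ 2) // expnMn -mulnn leq_mul.
Qed.

End Structure.

(** * Congruence counts for a fixed list and their sum over all lists *)

Local Open Scope nat_scope.

(** Ordered lists with repetition overcount the linked lists, but their total weight is exactly a
    [k]-th power, see [words_sum]. *)
Fixpoint words (T : Type) (Al : seq T) k : seq (seq T) :=
  if k is k'.+1 then [seq u :: s | u <- Al, s <- words Al k'] else [:: [::]].

Lemma mem_words (T : eqType) (Al : seq T) s : all (mem Al) s -> s \in words Al (size s).
Proof.
elim: s => [|u s IHs] //= /andP[uA /IHs sA].
by apply/allpairsP; exists (u, s).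
Qed.

Lemma cnt0 N (P : nat -> Prop) : (forall n, 0 < n <= N -> ~ P n) -> cnt N P = 0.
Proof.
move=> P0; apply/eqP; rewrite -leqn0.
by apply: (@cnt_inj _ _ _ id ([::] : seq nat)) => // n nN /(P0 _ nN).
Qed.

Lemma eq_mod_shift P h a b : P %| a + h -> P %| b + h -> a = b %[mod P].
Proof.
move=> /eqP Pa /eqP Pb; apply/eqP; rewrite -(eqn_modDr h); apply/eqP.
by rewrite Pa Pb.
Qed.

Lemma eq_mod_lcm a b m1 m2 : a = b %[mod m1] -> a = b %[mod m2] ->
  a = b %[mod lcmn m1 m2].
Proof.
wlog ab : a b / a <= b => [H|].
  have [/H//|/ltnW/H h] := leqP a b.
  by move=> h1 h2; apply/esym/h; apply/esym.
move=> /esym/eqP h1 /esym/eqP h2; apply/esym/eqP.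
by rewrite !eqn_mod_dvd // in h1 h2 *; rewrite dvdn_lcm h1.
Qed.

Lemma linked_prime y s u : linked y s -> u \in s -> prime u.2 /\ y < u.2.
Proof.
move=> /andP[_ /allP ok] us; have /and3P[pu du yu] := ok _ us; split=> //.
apply: leq_trans yu _; have p1 := prime_gt1 pu; apply: leq_trans (leq_pred _).
by apply: dvdn_leq => //; rewrite -ltnS prednK // ltnW.
Qed.

Lemma linked_gt0 y s : linked y s -> 0 < dprod s /\ 0 < pprod s.
Proof.
move=> /andP[_ /allP ok]; split; apply: prod_pos_seq => u /ok /and3P[pu _ yu].
  exact: leq_ltn_trans yu.
exact: prime_gt0.
Qed.

Lemma pprod_dvd y s m : linked y s -> all (fun u => u.2 %| m) s -> pprod s %| m.
Proof.
move=> ls /allP sm; rewrite /pprod -(big_map snd xpredT id).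
have /andP[us _] := ls; apply: prod_primes_dvd => //.
  by apply/allP => q /mapP[u us' ->]; have [] := linked_prime ls us'.
by move=> q /mapP[u us' ->]; apply: sm.
Qed.

(** A common prime would divide both [n] and [n + h], hence [h]; but the primes of a linked list
    exceed [y >= h]. *)
Lemma coprime_pprod y h n a s : linked y s -> 0 < h <= y -> 0 < n ->
  a %| n -> all (fun u => u.2 %| n + h) s -> coprime a (pprod s).
Proof.
move=> ls /andP[h0 hy] n0 an /allP sm; rewrite coprime_sym.
rewrite /coprime; apply: contraT => g1.
have P0 := (linked_gt0 ls).2.
have gP : 1 < gcdn (pprod s) a by rewrite ltn_neqAle eq_sym g1 gcdn_gt0 P0.
have pp := pdiv_prime gP; have := pdiv_dvd (gcdn (pprod s) a).
set r := pdiv _ in pp *; rewrite dvdn_gcd => /andP[rP ra].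
have [u us ru] := prime_dvd_prod pp rP.
have [pu yu] := linked_prime ls us.
move: ru; rewrite dvdn_prime2 // => /eqP ru.
have rn : r %| n := dvdn_trans ra an.
have : r %| h by rewrite -(dvdn_addr h rn) ru; exact: sm.
move=> rh; have := dvdn_leq h0 rh.
by rewrite leqNgt ru (leq_ltn_trans hy).
Qed.

Lemma fixed_pair_count y h N p s : 0 < p -> linked y s -> 0 < h <= y ->
  cnt N (fun n => p %| n /\ all (fun u => u.2 %| n + h) s) <= N %/ (p * pprod s) + 1.
Proof.
move=> p0 ls hy; have P0 := (linked_gt0 ls).2; apply: cnt_spaced; rewrite ?muln_gt0 ?p0 //.
move=> a b /andP[a0 _] _ [pa sa] [pb sb].
have cop := coprime_pprod ls hy a0 pa sa.
have : a == b %[mod p * pprod s].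
  rewrite chinese_remainder //; apply/andP; split; last first.
    by apply/eqP; apply: (@eq_mod_shift _ h); apply: pprod_dvd ls _.
  by rewrite (eqP pa) (eqP pb).
by move/eqP.
Qed.

(** With [D = dprod s] and [P = pprod s], the integer [n] is fixed modulo [a D] (as [p = 1] modulo
    [D]) and modulo [P]. The two moduli may share the factor [g = gcdn D P]; then the classes are
    compatible only if [g] divides [a + h]. This condition is kept because it will compensate the
    loss of [g] in the modulus. *)
Lemma fixed_cofactor_count y h N a s : 0 < a -> linked y s -> 0 < h <= y ->
  cnt N (fun n => exists p, [/\ 0 < p, n = a * p, dprod s %| p.-1 &
     all (fun u => u.2 %| n + h) s]) <=
  (if gcdn (dprod s) (pprod s) %| a + h then
     (N * gcdn (dprod s) (pprod s)) %/ (a * (dprod s * pprod s)) + 1 else 0).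
Proof.
move=> a0 ls hy; set g := gcdn _ _; set D := dprod s in g *; set P := pprod s in g *.
have [D0 P0] := linked_gt0 ls.
have g0 : 0 < g by rewrite gcdn_gt0 D0.
have [/andP[cop gah]|no] := boolP (coprime a P && (g %| a + h)); last first.
  rewrite cnt0 // => n /andP[n0 nN] [p [p0 nE Dp sn]].
  move/negP: no; apply; have Pn := pprod_dvd ls sn; apply/andP; split.
    by apply: coprime_pprod ls hy n0 _ sn; rewrite nE dvdn_mulr.
  have nE' : n + h = a * p.-1 + (a + h) by rewrite nE -{1}(prednK p0) mulnS; lia.
  have : g %| n + h by apply: dvdn_trans Pn; apply: dvdn_gcdr.
  rewrite nE' dvdn_addr // dvdn_mull //; apply: dvdn_trans Dp; exact: dvdn_gcdl.
rewrite gah; set L := lcmn (a * D) P.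
have Lg : L * g = a * (D * P).
  have -> : g = gcdn (a * D) P by rewrite gcdnC Gauss_gcdr 1?coprime_sym // gcdnC.
  by rewrite muln_lcm_gcd mulnA.
have L0 : 0 < L by rewrite lcmn_gt0 muln_gt0 a0 D0.
rewrite -Lg divnMr //; apply: cnt_spaced => //.
move=> m n _ _ [p [p0 mE Dp sm]] [q [q0 nE Dq sn]]; apply: eq_mod_lcm; last first.
  by apply: (@eq_mod_shift _ h); apply: pprod_dvd ls _.
have cl x : 0 < x -> D %| x.-1 -> a * x = a %[mod a * D].
  move=> x0 /dvdnP[k xE]; rewrite -(prednK x0) xE mulnS.
  by rewrite mulnCA addnC modnMDl.
by rewrite mE nE !cl.
Qed.

Local Open Scope ring_scope.

Section CaseCounts.
Context {R : realType}.
Local Notation lnn := (@lnn R).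

Lemma progression_sum d M : (0 < d)%N ->
  \sum_(2 <= q < M.+1 | (d %| q.-1)%N) q%:R^-1 <= (1 + lnn M) / d%:R :> R.
Proof.
move=> d0; apply: le_trans (_ : _ <= \sum_(1 <= k < M.+1) k%:R^-1 / d%:R) _; last first.
  by rewrite -mulr_suml ler_wpM2r ?invr_ge0 // harmonic_le.
rewrite -big_filter; apply: (@sum_inj_le _ _ _ _ _ (fun q => (q.-1 %/ d)%N)).
- by rewrite filter_uniq // iota_uniq.
- by move=> k _; rewrite divr_ge0 // invr_ge0.
- move=> q; rewrite mem_filter mem_index_iota => /andP[dq /andP[q2 qM]].
  have q0 : (0 < q.-1)%N by move: q2; clear; lia.
  have k0 : (0 < q.-1 %/ d)%N by rewrite divn_gt0 // dvdn_leq.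
  split.
    rewrite mem_index_iota k0 /=; apply: leq_ltn_trans (leq_div _ _) _.
    exact: leq_ltn_trans (leq_pred q) qM.
  rewrite -invfM -natrM lef_pV2 ?posrE ?ltr0n ?muln_gt0 ?k0 //; last exact: ltnW.
  by rewrite ler_nat divnK // leq_pred.
- move=> q r; rewrite !mem_filter !mem_index_iota.
  move=> /andP[dq /andP[q2 _]] /andP[dr /andP[r2 _]] e.
  have : q.-1 = r.-1 by rewrite -(divnK dq) e divnK.
  by move: q2 r2; clear; lia.
Qed.

(** Letters [(d, q)] with [q = 1] modulo [d]: the reciprocals of [q] in this progression sum to at
    most [(1 + ln M) / d], so even the sum over all [d] costs only logarithms. *)
Definition alphabet M := [seq u <- [seq (d, q) | d <- iota 1 M, q <- index_iota 2 M.+1] | (u.1 %| u.2.-1)%N].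

Lemma alphabet_sum M : (0 < M)%N ->
  \sum_(u <- alphabet M) (u.2)%:R^-1 <= (1 + lnn M) ^+ 2 :> R.
Proof.
move=> M0; rewrite /alphabet big_filter big_mkcond.
rewrite (big_allpairs (F := fun u => if (u.1 %| u.2.-1)%N then u.2%:R^-1 else 0)) /=.
apply: le_trans (_ : _ <= \sum_(d <- iota 1 M) (1 + lnn M) / d%:R) _.
  rewrite !big_seq; apply: ler_sum => d; rewrite mem_iota => /andP[d0 _].
  by rewrite -big_mkcond; apply: progression_sum.
rewrite -mulr_sumr expr2; apply: ler_wpM2l; first by rewrite addr_ge0 ?lnn_ge0.
by have := harmonic_le (R := R) M; rewrite /index_iota subn1.
Qed.

Lemma words_sum (T : Type) (Al : seq T) (w : T -> R) k :
  \sum_(s <- words Al k) \prod_(u <- s) w u = (\sum_(u <- Al) w u) ^+ k.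
Proof.
elim: k => [|k IHk] /=; first by rewrite big_seq1 big_nil.
rewrite big_allpairs_dep exprS -IHk mulr_suml; apply: eq_bigr => u _.
by rewrite mulr_sumr; apply: eq_bigr => s _; rewrite big_cons.
Qed.

Lemma linked_mem_words y s m M : linked y s -> all (fun u => u.2 %| m)%N s ->
  (0 < m <= M)%N -> s \in words (alphabet M) (size s).
Proof.
move=> ls /allP sm /andP[m0 mM]; apply: mem_words; apply/allP => u us.
have /andP[_ /allP /(_ _ us) /and3P[pu du yu]] := ls.
have uM : (u.2 <= M)%N by apply: leq_trans mM; apply: dvdn_leq => //; apply: sm.
have p1 := prime_gt1 pu.
rewrite inE /= mem_filter du /=; apply/allpairsP; exists u; split.
- rewrite mem_iota add1n ltnS (leq_ltn_trans _ yu) //=.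
  apply: leq_trans uM; apply: leq_trans (leq_pred _).
  by apply: dvdn_leq => //; rewrite -ltnS prednK // ltnW.
- by rewrite mem_index_iota p1 ltnS.
- by case: (u).
Qed.

Lemma inv_pprod s : (pprod s)%:R^-1 = \prod_(u <- s) (u.2)%:R^-1 :> R.
Proof. by rewrite /pprod natr_prod prodfV. Qed.

Lemma words_total_le M k2 : (0 < M)%N ->
  \sum_(k <- iota 0 k2.+1) \sum_(s <- words (alphabet M) k) (pprod s)%:R^-1 <=
  k2.+1%:R * (1 + lnn M) ^+ (2 * k2) :> R.
Proof.
move=> M0; have l1 : 1 <= 1 + lnn M by rewrite lerDl lnn_ge0.
apply: le_trans (_ : _ <= \sum_(k <- iota 0 k2.+1) (1 + lnn M) ^+ (2 * k2)) _; last first.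
  by rewrite big_const_seq count_predT size_iota iter_addr_0 -[leLHS]mulr_natl.
rewrite !big_seq; apply: ler_sum => k; rewrite mem_iota add0n /= => kk.
under eq_bigr do rewrite inv_pprod.
rewrite words_sum; apply: le_trans (_ : _ <= ((1 + lnn M) ^+ 2) ^+ k) _.
  have b0 : 0 <= (1 + lnn M) ^+ 2 :> R by apply: exprn_ge0; apply: le_trans l1.
  have a0 : 0 <= \sum_(u <- alphabet M) (u.2)%:R^-1 :> R.
    by apply: sumr_ge0 => u _; rewrite invr_ge0.
  by rewrite lerXn2r // alphabet_sum.
by rewrite -exprM ler_weXn2l // leq_mul2l -ltnS kk orbT.
Qed.

Context (N h y E W k2 : nat).
Hypotheses (N0 : (0 < N)%N) (hy : (0 < h <= y)%N) (hN : (h <= N)%N) (W0 : (1 < W)%N).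

Let base p s n := [/\ prime p, (p %| n)%N & linked y s] /\
  [/\ (size s <= k2)%N, (W <= dprod s)%N, (dprod s %| p.-1)%N &
      all (fun u => u.2 %| n + h)%N s].

Let M := (N + N)%N.
Let l : R := 1 + lnn M.

Let M0 : (0 < M)%N. Proof. by rewrite addn_gt0 N0. Qed.
Let l0 : 0 <= l. Proof. by rewrite addr_ge0 ?lnn_ge0. Qed.

Lemma base_words p s n : (0 < n <= N)%N -> base p s n ->
  size s \in iota 0 k2.+1 /\ s \in words (alphabet M) (size s).
Proof.
move=> /andP[n0 nN] [[_ _ ls] [sk _ _ sn]]; split; first by rewrite mem_iota ltnS.
by apply: linked_mem_words ls sn _; rewrite addn_gt0 n0 /= leq_add.
Qed.

(** For a fixed list, [p] runs through the class of 1 modulo [dprod s >= W], so the sum of [1 / p]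
    saves [W]. The sum over lists is a power of a logarithm. *)
Lemma caseA_count :
  (cnt N (fun n => exists p s, base p s n /\ (p * pprod s * E.+1 <= 2 * N ^ 2)%N))%:R <=
  (N%:R + 2 * N%:R ^+ 2 / E.+1%:R) * (l / W%:R) * (k2.+1%:R * l ^+ (2 * k2)).
Proof.
set c := N%:R + _; have c0 : 0 <= c.
  by rewrite /c addr_ge0 // divr_ge0 // mulr_ge0 // exprn_ge0.
pose ps := index_iota 2 M.+1.
pose S p s n := base p s n /\ (p * pprod s * E.+1 <= 2 * N ^ 2)%N.
apply: le_trans (_ : _ <= (cnt N (fun n => exists2 k, k \in iota 0 k2.+1 &
    exists2 s, s \in words (alphabet M) k & exists2 p, p \in ps & S p s n))%:R) _.
  rewrite ler_nat; apply: cnt_le => n nN [p [s [bn pE]]].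
  have [h1 h2] := base_words nN bn; have [[pp pn _] _] := bn.
  exists (size s) => //; exists s => //; exists p; last by split.
  have /andP[n0 nN'] := nN; rewrite mem_index_iota prime_gt1 // ltnS.
  by apply: leq_trans (dvdn_leq n0 pn) _; apply: leq_trans nN' _; rewrite leq_addr.
apply: le_trans (cnt_sum_ex _ _ _) _.
apply: le_trans (ler_wpM2l (mulr_ge0 c0 (divr_ge0 l0 (ler0n _ W))) (words_total_le k2 M0)).
rewrite mulr_sumr; apply: ler_sum => k _.
apply: le_trans (cnt_sum_ex _ _ _) _; rewrite mulr_sumr; apply: ler_sum => s _.
apply: le_trans (cnt_sum_ex _ _ _) _.
have ip0 : 0 <= (pprod s)%:R^-1 :> R by rewrite invr_ge0.
have [WD|DW] := leqP W (dprod s); last first.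
  rewrite big1 ?mulr_ge0 // ?invr_ge0 // => p _.
  by rewrite cnt0 // => n _ [[_ [_ WD _ _]] _]; rewrite ltnNge WD in DW.
have D0 : (0 < dprod s)%N by apply: leq_trans WD; exact: ltnW.
apply: le_trans (_ : _ <= \sum_(2 <= p < M.+1 | (dprod s %| p.-1)%N) p%:R^-1 * (c * (pprod s)%:R^-1)) _.
  rewrite [leRHS]big_mkcond; apply: ler_sum_natP => p /andP[p2 pM] _.
  have p0 : (0 < p)%N by apply: ltnW.
  case: ifP => Dp; last by rewrite cnt0 // => n _ [[_ [_ _ Dp' _]] _]; rewrite Dp' in Dp.
  have [/andP[ls pE]|no] := boolP (linked y s && (p * pprod s * E.+1 <= 2 * N ^ 2)%N); last first.
    rewrite cnt0 ?mulr_ge0 ?invr_ge0 // => n _ [[[_ _ ls] _] pE].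
    by rewrite ls pE in no.
  have P0 := (linked_gt0 ls).2.
  apply: le_trans (_ : _ <= (N %/ (p * pprod s) + 1)%:R) _.
    rewrite ler_nat; apply: leq_trans (fixed_pair_count N p0 ls hy).
    by apply: cnt_le => n _ [[[_ pn _] [_ _ _ sn]] _].
  have pP0 : (0 : R) < (p * pprod s)%:R by rewrite ltr0n muln_gt0 p0.
  rewrite mulrCA -invfM -natrM mulrDl natrD; apply: lerD; first exact: natdiv_le.
  (* The [+ 1] of the congruence count is absorbed here, which explains the second summand of
     [c]. *)
  have pE' : (p * pprod s)%:R * E.+1%:R <= 2 * N%:R ^+ 2 :> R.
    by rewrite -natrX -!natrM ler_nat.
  by rewrite ler_pdivlMr // mul1r ler_pdivlMr // ltr0Sn.
rewrite -mulr_suml.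
have h1 := progression_sum M D0.
have h2 : l / (dprod s)%:R <= l / W%:R.
  by apply: ler_wpM2l => //; rewrite lef_pV2 ?posrE ?ltr0n ?ler_nat // (leq_trans _ W0).
have := ler_wpM2r (mulr_ge0 c0 ip0) (le_trans h1 h2); rewrite /ps => /le_trans; apply.
by rewrite mulrA [c * _]mulrC.
Qed.

(** Put [a + h = g k]; then [g / a = (a + h) / (a k) <= (1 + h) / k]. The divisibility thus pays for
    the numerator [g], at the price of a factor [1 + h]. *)
Lemma shifted_sum g : (0 < g)%N ->
  \sum_(1 <= a < N.+1 | (g %| a + h)%N) g%:R / a%:R <= (1 + h%:R) * l.
Proof.
move=> g0; apply: le_trans (_ : _ <= \sum_(1 <= k < M.+1) (1 + h%:R) * k%:R^-1) _; last first.
  by rewrite -mulr_sumr ler_wpM2l ?addr_ge0 // harmonic_le.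
rewrite -big_filter; apply: (@sum_inj_le _ _ _ _ _ (fun a => ((a + h) %/ g)%N)).
- by rewrite filter_uniq // iota_uniq.
- by move=> k _; rewrite mulr_ge0 ?addr_ge0 ?invr_ge0.
- move=> a; rewrite mem_filter mem_index_iota => /andP[ga /andP[a0 aN]].
  have ah0 : (0 < a + h)%N by rewrite addn_gt0 a0.
  have k0 : (0 < (a + h) %/ g)%N by rewrite divn_gt0 // dvdn_leq.
  split.
    rewrite mem_index_iota k0 ltnS; apply: leq_trans (leq_div _ _) _.
    by rewrite leq_add.
  have E0 := divnK ga; move: k0 E0; set k := (_ %/ _)%N => k0 E0.
  have k0' : (0 : R) < k%:R by rewrite ltr0n.
  have a0' : (0 : R) < a%:R by rewrite ltr0n.
  rewrite ler_pdivrMr // mulrAC ler_pdivlMr // -natrM mulnC E0.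
  rewrite natrD mulrDl mul1r lerD2l ler_peMr // ler1n //.
- move=> a b; rewrite !mem_filter => /andP[ga _] /andP[gb _] e.
  by apply: (@addIn h); rewrite -(divnK ga) e divnK.
Qed.

(** Now [a = n / p] and the list are fixed, and the saving [1 / W] comes from the congruence [p = 1]
    modulo [dprod s]. The bound [a D P <= N] absorbs the [+ 1] of the congruence count and gives the
    factor 2. *)
Lemma caseB_count :
  (cnt N (fun n => exists p s, base p s n /\ (n %/ p * (dprod s * pprod s) <= N)%N))%:R <=
  2 * N%:R * (1 + h%:R) * (l / W%:R) * (k2.+1%:R * l ^+ (2 * k2)).
Proof.
set c := 2 * N%:R * (1 + h%:R); have c0 : 0 <= c.
  by rewrite /c mulr_ge0 // ?addr_ge0 // mulr_ge0.
pose S a s n := exists2 p, base p s n /\ (a * (dprod s * pprod s) <= N)%N & n = (a * p)%N.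
apply: le_trans (_ : _ <= (cnt N (fun n => exists2 k, k \in iota 0 k2.+1 &
    exists2 s, s \in words (alphabet M) k & exists2 a, a \in index_iota 1 N.+1 & S a s n))%:R) _.
  rewrite ler_nat; apply: cnt_le => n nN [p [s [bn pE]]].
  have [h1 h2] := base_words nN bn; have [[pp pn _] _] := bn.
  exists (size s) => //; exists s => //; exists (n %/ p)%N.
    have /andP[n0 nN'] := nN; rewrite mem_index_iota divn_gt0 ?prime_gt0 //.
    by rewrite dvdn_leq //= ltnS; apply: leq_trans (leq_div _ _) nN'.
  by exists p; rewrite ?divnK.
apply: le_trans (cnt_sum_ex _ _ _) _.
apply: le_trans (ler_wpM2l (mulr_ge0 c0 (divr_ge0 l0 (ler0n _ W))) (words_total_le k2 M0)).
rewrite mulr_sumr; apply: ler_sum => k _.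
apply: le_trans (cnt_sum_ex _ _ _) _; rewrite mulr_sumr; apply: ler_sum => s _.
apply: le_trans (cnt_sum_ex _ _ _) _.
have ip0 : 0 <= (pprod s)%:R^-1 :> R by rewrite invr_ge0.
have rhs0 : 0 <= c * (l / W%:R) * (pprod s)%:R^-1.
  by rewrite mulr_ge0 // mulr_ge0 // divr_ge0.
have [/andP[WD ls]|no] := boolP ((W <= dprod s)%N && linked y s); last first.
  rewrite big1 // => a _; rewrite cnt0 // => n _ [p [[[_ _ ls] [_ WD _ _]] _] _].
  by rewrite WD ls in no.
have [D0 P0] := linked_gt0 ls; set g := gcdn (dprod s) (pprod s).
have g0 : (0 < g)%N by rewrite gcdn_gt0 D0.
set D := dprod s in WD D0 g g0 *; set P := pprod s in ip0 rhs0 P0 g g0 *.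
have D0' : (0 : R) < D%:R by rewrite ltr0n.
have P0' : (0 : R) < P%:R by rewrite ltr0n.
apply: le_trans (_ : _ <= \sum_(1 <= a < N.+1 | (g %| a + h)%N)
   (2 * N%:R / (D%:R * P%:R)) * (g%:R / a%:R)) _.
  rewrite [leRHS]big_mkcond; apply: ler_sum_natP => a /andP[a0 aN] _.
  have [aE|no] := leqP (a * (D * P)) N; last first.
    rewrite cnt0; last by move=> n _ [p [_ aE] _]; rewrite leqNgt no in aE.
    by case: ifP => // _; rewrite !mulr_ge0 // ?invr_ge0 ?mulr_ge0 // ltW.
  have := fixed_cofactor_count N a0 ls hy; rewrite -/g -/D -/P.
  set T := cnt N _ => hT; have cT : (cnt N (S a s) <= T)%N.
    apply: cnt_le => n nN [p [[[pp pn _] [_ _ Dp sn]] _] nE].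
    by exists p; split=> //; exact: prime_gt0.
  move: (leq_trans cT hT); case: ifP => _ h1; last first.
    by move: h1; rewrite leqn0 => /eqP->.
  apply: le_trans (_ : _ <= ((N * g) %/ (a * (D * P)) + 1)%:R) _; first by rewrite ler_nat.
  have a0' : (0 : R) < a%:R by rewrite ltr0n.
  have q0 : (0 : R) < (a * (D * P))%:R by rewrite ltr0n !muln_gt0 a0 D0.
  have -> : 2 * N%:R / (D%:R * P%:R) * (g%:R / a%:R) = (2 * N%:R * g%:R) / (a * (D * P))%:R :> R.
    by rewrite !natrM; field; rewrite !gt_eqF.
  have -> : 2 * N%:R * g%:R / (a * (D * P))%:R =
      (N * g)%:R / (a * (D * P))%:R + (N * g)%:R / (a * (D * P))%:R :> R.
    by rewrite [(N * g)%:R]natrM; ring.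
  rewrite natrD; apply: lerD; first exact: natdiv_le.
  rewrite ler_pdivlMr // mul1r ler_nat; apply: leq_trans aE _.
  by rewrite leq_pmulr.
rewrite -mulr_sumr.
have h1 := shifted_sum g0.
have h3 : 0 <= 2 * N%:R / (D%:R * P%:R) :> R by rewrite divr_ge0 ?mulr_ge0.
apply: le_trans (ler_wpM2l h3 h1) _.
have -> : 2 * N%:R / (D%:R * P%:R) * ((1 + h%:R) * l) = (c * P%:R^-1) * (l / D%:R) :> R.
  by rewrite /c; field; rewrite !gt_eqF.
rewrite [leRHS]mulrAC; apply: ler_wpM2l; first by rewrite mulr_ge0.
by apply: ler_wpM2l => //; rewrite lef_pV2 ?posrE ?ltr0n ?ler_nat // (leq_trans _ W0).
Qed.

End CaseCounts.

(** * The exceptional solutions *)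

Local Open Scope nat_scope.

Lemma totient_mul_prime a q : prime q -> ~~ (q %| a) -> totient (a * q) = totient a * q.-1.
Proof.
move=> pq qa; have cop : coprime a q by rewrite coprime_sym prime_coprime.
by rewrite totient_coprime // (totient_prime pq).
Qed.

(** Equal radicals make [totient j / j] and [totient (j + h) / (j + h)] equal. After division by the
    gcd this reads [totient j * A = totient (j + h) * B], and the two prime factors contribute [A r]
    and [B r]. *)
Lemma diag_repr_totient (R : realType) h (Y : R) n j r :
  diag_repr h Y n j r -> totient n = totient (n + h).
Proof.
move=> [[j0 rj] r0 [-> ->] [pA pB] [cA cB _]].
set d := diag_gcd h j; have d0 : 0 < d by rewrite gcdn_gt0 j0.
have jh0 : 0 < j + h by rewrite addn_gt0 j0.
have tr := totient_ratio_rad j0 jh0 rj.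
have AE : diag_A h j * d = j + h by rewrite divnK // dvdn_gcdr.
have BE : diag_B h j * d = j by rewrite divnK // dvdn_gcdl.
rewrite !totient_mul_prime //; last 2 first.
  by rewrite -prime_coprime.
  by rewrite -prime_coprime.
rewrite !addn1 /= !mulnA; congr (_ * _).
apply/eqP; rewrite -(eqn_pmul2r d0); apply/eqP.
by rewrite -!mulnA AE BE.
Qed.

(** Integers with equal radicals have the same parity. *)
Lemma odd_no_diag (R : realType) h (Y x : R) : odd h -> D_phi h Y x = 0.
Proof.
move=> oh; apply: cnt0 => n _ [j [r [[j0 rj] _ _ _ _]]].
have e : primes j = primes (j + h) by rewrite -primes_rad rj primes_rad.
have : (2 \in primes j) = (2 \in primes (j + h)) by rewrite e.
rewrite !mem_primes j0 addn_gt0 j0 /= !dvdn2 oddD oh addbT.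
by case: (odd j).
Qed.

Lemma totient_pair_inj a b h q1 q2 q1' q2' :
  0 < a -> 0 < b -> 0 < q1 -> 0 < q2 -> 0 < q1' -> 0 < q2' ->
  totient a * b <> totient b * a ->
  totient a * q1.-1 = totient b * q1'.-1 -> totient a * q2.-1 = totient b * q2'.-1 ->
  a * q1 + h = b * q1' -> a * q2 + h = b * q2' -> q1 = q2.
Proof.
wlog q12 : q1 q2 q1' q2' / q1 <= q2.
  move=> H; have [le|lt] := leqP q1 q2; first exact: H le.
  move=> a0 b0 h1 h2 h3 h4 ne e1 e2 e3 e4; symmetry.
  exact: (H _ _ _ _ (ltnW lt) a0 b0 h2 h1 h4 h3 ne e2 e1 e4 e3).
case: q1 q12 => // u1; case: q2 => // u2; case: q1' => // v1; case: q2' => // v2.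
rewrite ltnS /= => u12 a0 b0 _ _ _ _ ne e1 e2 e3 e4; congr _.+1.
apply/eqP; rewrite eqn_leq u12 leqNgt; apply/negP => lu.
have d1 : a * (u2 - u1) = b * (v2 - v1) by rewrite !mulnBr; move: e3 e4; clear; lia.
have d2 : totient a * (u2 - u1) = totient b * (v2 - v1) by rewrite !mulnBr e1 e2.
have du : 0 < u2 - u1 by rewrite subn_gt0.
move: d1 d2 du; set dv := v2 - v1; set du := u2 - u1 => d1 d2 du0.
apply: ne; have dv0 : 0 < dv.
  by move: d1; case: dv {d2} => // /eqP; rewrite muln0 muln_eq0 -!leqn0 leqNgt a0 leqNgt du0.
apply/eqP; rewrite -(eqn_pmul2r dv0) -mulnA -d1 [X in _ == X]mulnAC -d2.
by rewrite mulnA [X in _ == X]mulnAC.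
Qed.

Section Cover.
Context (J y N h E J0 Yn : nat).
Let K := 2 * J + 2 * J * (8 * J).+1.
Let Q := y.+1.
Let B := Q ^ K.
Let T0 := Q ^ J.
Hypotheses (J1 : 0 < J) (y0 : 0 < y) (h0 : 0 < h) (hy : h <= y) (hN : h <= N).
Hypotheses (EN : E < 2 * N) (tN : 2 ^ (8 * J) < N) (J0E : 2 * y * N <= J0 ^ 2).

(* These [n] are determined by [(a, b)]: [n = a q], [n + h = b q'] and the equality of the
   totients are two independent linear equations in [(q, q')]. *)
Definition nondeg a b n := exists q q', [/\ prime q, prime q', ~~ (q %| a) & ~~ (q' %| b)] /\
  [/\ n = a * q, n + h = b * q', 0 < a, 0 < b &
    totient n = totient (n + h) /\ totient a * b <> totient b * a].

Lemma nondeg_inj a b m n : nondeg a b m -> nondeg a b n -> m = n.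
Proof.
move=> [q1 [q1' [[p1 p1' na1 nb1] [mE mhE a0 b0 [tm ne]]]]].
move=> [q2 [q2' [[p2 p2' na2 nb2] [nE nhE _ _ [tn _]]]]].
rewrite mE nE; congr (_ * _).
move: tm tn; rewrite mE nE in mhE nhE *; rewrite mhE nhE !totient_mul_prime // => e1 e2.
by apply: (totient_pair_inj a0 b0 _ _ _ _ ne e1 e2 mhE nhE); exact: prime_gt0.
Qed.

(* In case A the congruences [n = 0 (mod p)], [n + h = 0 (mod pprod s)] localise [n]; in
   case B one fixes [n / p] instead and uses [p = 1 (mod dprod s)]. *)
Definition caseA n := exists p s, ([/\ prime p, p %| n & linked y s] /\
  [/\ size s <= 2 * J, Q ^ (2 * J) <= dprod s, dprod s %| p.-1 &
      all (fun u => u.2 %| n + h) s]) /\ p * pprod s * E.+1 <= 2 * N ^ 2.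

Definition caseB n := exists p s, ([/\ prime p, p %| n & linked y s] /\
  [/\ size s <= 2 * J, Q ^ (2 * J) <= dprod s, dprod s %| p.-1 &
      all (fun u => u.2 %| n + h) s]) /\ n %/ p * (dprod s * pprod s) <= N.

Definition has_square n := exists2 t, T0 <= t & t ^ 2 %| n.

(** A non-sparse prime factor [p] has [p - 1 >= B >= T0], so the largest prime factor is also at
    least [T0], and its square would be a forbidden divisor. *)
Lemma max_pdiv_once n : 0 < n -> ~ sparse y B n -> ~ has_square n ->
  exists a, [/\ prime (max_pdiv n), n = a * max_pdiv n, 0 < a & ~~ (max_pdiv n %| a)].
Proof.
move=> n0 ns nsq; have [p pn sp] : exists2 p, p \in primes n & ~~ sparse_prime y B p.
  by have /allPn := introN idP ns.
have [pp _ pdn] := primesP pn.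
have pT : T0 <= p.
  move: sp; rewrite /sparse_prime pp /= -leqNgt => rB.
  apply: leq_trans (leq_pred p).
  have p0 : 0 < p.-1 by rewrite -ltnS prednK ?prime_gt0 // prime_gt1.
  apply: leq_trans (dvdn_leq p0 (dvdn_part _ _)); apply: leq_trans rB.
  by rewrite leq_exp2l // /K -[X in X <= _]mul1n -addnA mulnDl leq_add // mul1n leq_pmull.
have n1 : 1 < n by apply: leq_trans (dvdn_leq n0 pdn); apply: prime_gt1.
have pq := max_pdiv_prime n1; have qn := max_pdiv_dvd n.
exists (n %/ max_pdiv n); split=> //; first by rewrite divnK.
  by rewrite divn_gt0 ?prime_gt0 // dvdn_leq.
apply/negP => qa; apply: nsq; exists (max_pdiv n).
  by apply: leq_trans pT _; apply: max_pdiv_le.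
by rewrite -[X in _ %| X](divnK qn) expnS expn1 dvdn_mul.
Qed.

Theorem exceptional_cover (R : realType) (Y : R) n : Yn = Num.truncn Y -> (0 <= Y)%R ->
  0 < n <= N -> totient n = totient (n + h) ->
  ~ (exists j r, diag_repr h Y n j r) ->
  [\/ sparse y B n, sparse y B (n + h), has_square n | has_square (n + h)] \/
  [\/ exists a b, [/\ 0 < a, 0 < b, a * b <= E & nondeg a b n],
      exists2 j, j \in index_iota 1 J0.+1 &
        exists2 k, smooth Yn k /\ 0 < k & n = j * k.+1,
      caseA n | caseB n].
Proof.
move=> YnE Y0 /andP[n0 nN] phi nD; have m0 : 0 < n + h by rewrite addn_gt0 n0.
have [s1|s1] := pselect (sparse y B n); first by left; apply: Or41.
have [s2|s2] := pselect (sparse y B (n + h)); first by left; apply: Or42.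
have [q1|q1] := pselect (has_square n); first by left; apply: Or43.
have [q2|q2] := pselect (has_square (n + h)); first by left; apply: Or44.
right; have [a [pq nE a0 qa]] := max_pdiv_once n0 s1 q1.
have [b [pq' mE b0 qb]] := max_pdiv_once m0 s2 q2.
have qmax p : prime p -> p %| n -> p <= max_pdiv n by apply: max_pdiv_le.
have qmax' p : prime p -> p %| n + h -> p <= max_pdiv (n + h) by apply: max_pdiv_le.
set q := max_pdiv n in pq nE qa qmax; set q' := max_pdiv (n + h) in pq' mE qb qmax'.
have phi' : totient a * q.-1 = totient b * q'.-1.
  by rewrite -!totient_mul_prime // -nE -mE.
have q10 := prime_gt1 pq; have q10' := prime_gt1 pq'.
have mN : n + h <= 2 * N by rewrite mul2n -addnn leq_add.
have [deg|ndeg] := pselect (totient a * b = totient b * a).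
  apply: Or42; have ta0 : 0 < totient a by rewrite totient_gt0.
  have tb0 : 0 < totient b by rewrite totient_gt0.
  (* Dividing the totient equation by the degenerate relation gives this; subtracting it from
     [n = a q] and [n + h = b q'] leaves [b = a + h]. *)
  have ab : a * q.-1 = b * q'.-1.
    apply/eqP; rewrite -(eqn_pmul2l tb0); apply/eqP.
    by rewrite mulnA -deg mulnAC phi' -mulnA [q'.-1 * b]mulnC.
  have bE : b = a + h.
    have e1 : a * q = a * q.-1 + a by rewrite -mulnSr prednK // ltnW.
    have e2 : b * q' = b * q'.-1 + b by rewrite -mulnSr prednK // ltnW.
    by move: nE mE; rewrite e1 e2 ab; clear; lia.
  have sm : smooth Yn q.-1.
    have q0 : 0 < q.-1 by rewrite -ltnS prednK // ltnW.
    apply/(smoothP _ q0) => p pp pq1.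
    (* A prime factor of [q - 1] above [Y] would put [n] on the diagonal, with [j = a] and
       [r = (q - 1) / A]; it divides [r] or [A], hence [diag_Gamma h a * r]. *)
    rewrite YnE truncn_ge_nat // leNgt; apply/negP => Yp; apply: nD.
    set d := diag_gcd h a; have d0 : 0 < d by rewrite gcdn_gt0 a0.
    have AE : diag_A h a * d = b by rewrite bE divnK // dvdn_gcdr.
    have BE : diag_B h a * d = a by rewrite divnK // dvdn_gcdl.
    have AB : diag_B h a * q.-1 = diag_A h a * q'.-1.
      apply/eqP; rewrite -(eqn_pmul2r d0); apply/eqP.
      by rewrite mulnAC BE mulnAC AE.
    have cop : coprime (diag_A h a) (diag_B h a).
      have : gcdn (diag_A h a * d) (diag_B h a * d) = d.
        by rewrite AE BE gcdnC /d /diag_gcd bE.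
      rewrite -muln_gcdl -[X in _ = X]mul1n => /eqP; rewrite eqn_pmul2r //.
    have Aq : diag_A h a %| q.-1.
      by rewrite -(Gauss_dvdr _ cop) AB dvdn_mulr.
    have [r rE] := dvdnP Aq; have A0 : 0 < diag_A h a.
      by move: b0; rewrite -AE muln_gt0 => /andP[].
    have qE : diag_A h a * r + 1 = q by rewrite mulnC -rE addn1 prednK // ltnW.
    have q'E : diag_B h a * r + 1 = q'.
      rewrite addn1 -(@prednK q'); last exact: ltnW.
      congr _.+1; apply/eqP; rewrite -(eqn_pmul2l A0); apply/eqP.
      by rewrite -AB rE mulnCA [r * _]mulnC.
    have r0 : 0 < r by move: q0; rewrite rE muln_gt0 => /andP[].
    exists a, r; split=> //; rewrite ?qE ?q'E -?bE //.
    - split=> //; have := totient_ratio_primes a0 b0 deg.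
      by rewrite /Defs.rad bE => ->.
    split; rewrite ?prime_coprime //; apply: lt_le_trans Yp _; rewrite ler_nat.
    apply: max_pdiv_le => //.
      by rewrite /diag_Gamma !muln_gt0 ta0 A0.
    by apply: dvdn_trans pq1 _; rewrite rE /diag_Gamma -mulnA dvdn_mull // mulnC.
  exists a.
    rewrite mem_index_iota a0 ltnS -(@leq_exp2r _ _ 2) //; apply: leq_trans J0E.
    (* From [a (q - q') = h (q' - 1)] and [q > q'] one gets [a <= h q'], hence
       [a^2 <= h a q' <= h (n + h) <= 2 y N]. So [a] is at most about [x^(1/2)], apart from a power
       of [y]. *)
    have qq : q' < q.
      rewrite ltnNge; apply/negP => qq.
      have : a * q.-1 < b * q'.-1.
        apply: (@leq_trans (b * q.-1)).
          by rewrite ltn_mul2r -ltnS prednK ?q10 ?(ltnW q10) // bE -addn1 leq_add2l.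
        by rewrite leq_mul2l; apply/orP; right; rewrite -!subn1 leq_sub2r.
      by rewrite ab ltnn.
    have aq : a <= h * q'.
      have e : a * (q - q') = h * q'.-1.
        rewrite mulnBr -nE; move: mE ab; rewrite bE; clear -q10 q10' nE; nia.
      apply: (@leq_trans (a * (q - q'))); first by rewrite leq_pmulr // subn_gt0.
      by rewrite e leq_mul2l leq_pred orbT.
    rewrite expnS expn1; apply: (@leq_trans (h * (n + h))).
      rewrite mE; apply: (@leq_trans (h * q' * a)); first by rewrite leq_mul2r aq orbT.
      rewrite -mulnA leq_mul2l mulnC leq_mul2r bE leq_addr !orbT //.
    by rewrite -mulnA mulnCA leq_mul // mul2n -addnn leq_add.
  exists q.-1; last by rewrite prednK // ltnW.
  by split=> //; rewrite -ltnS prednK // ltnW.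
have nd : nondeg a b n by exists q, q'; split=> //; split=> //; split.
have [abE|abE] := leqP (a * b) E; first by apply: Or41; exists a, b.
(* The product [n (n + h) <= 2 N^2] equals [a b q q'], where [a b > E] and [q], [q'] are the largest
   prime factors. *)
have pair p p' : prime p -> p %| n -> prime p' -> p' %| n + h -> p * p' * E.+1 <= 2 * N ^ 2.
  move=> pp pn pp' pn'; apply: (@leq_trans (n * (n + h))).
    rewrite mE {1}nE mulnACA [X in _ <= X]mulnC; apply: leq_mul => //.
    by apply: leq_mul; [exact: qmax|exact: qmax'].
  by rewrite expnS expn1 mulnCA leq_mul.
have [p pn sp] : exists2 p, p \in primes n & ~~ sparse_prime y B p.
  by have /allPn := introN idP s1.
have [pp _ pdn] := primesP pn.
have D0B : Q ^ K <= rough_part y p.-1 by move: sp; rewrite /sparse_prime pp /= -leqNgt.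
have em : excess (n + h) < Q ^ (2 * J).
  have [t [tn et]] := excess_square m0; apply: leq_ltn_trans et _.
  rewrite mulnC expnM ltn_exp2r // ltnNge; apply/negP => Tt.
  by apply: q2; exists t.
have [s [bs [cA|cB]]] := linked_list_cases J1 y0 n0 nN hN phi pp pdn D0B em
   (fun p' pp' pn' => pair p p' pp pdn pp' pn') EN tN.
  by apply: Or43; exists p, s; split=> //; have [ls sK Ds Dp sn] := bs; split.
by apply: Or44; exists p, s; split=> //; have [ls sK Ds Dp sn] := bs; split.
Qed.

End Cover.

Local Open Scope ring_scope.

Lemma cnt_widen N M (P : nat -> Prop) : (N <= M)%N -> (cnt N P <= cnt M P)%N.
Proof. by move=> NM; rewrite /cnt -(subnKC NM) iotaD count_cat leq_addr. Qed.

Section Diff.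
Context {R : realType}.
Local Notation lnn := (@lnn R).
Local Notation pw := (@pw R).
Local Notation recip_sum := (@recip_sum R).

(** One summand for each class of [exceptional_cover]. Conditions on [n + h] are counted up to
    [2 N], which turns the constant 2 of [square_count] into [2 + 4 = 6]. *)
Theorem phi_diff_le (x Y delta delta2 : R) (J y h E J0 : nat) :
  let N := Num.truncn x in let Q := y.+1 in
  let B := (Q ^ (2 * J + 2 * J * (8 * J).+1))%N in
  let l := 1 + lnn (N + N) in
  let Yn := Num.truncn Y in
  (0 < J)%N -> (0 < y)%N -> (0 < h <= y)%N -> (y <= N)%N -> 0 <= Y ->
  (E < 2 * N)%N -> (2 ^ (8 * J) < N)%N -> (2 * y * N <= J0 ^ 2)%N ->
  0 < delta <= 1 / 4 -> 0 < delta2 <= 1 / 4 ->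
  `| (S_phi h x)%:R - (D_phi h Y x)%:R | <=
  2 * (pw (1 - delta) (N + N) *
    expR (\sum_(1 <= p < (N + N).+1 | sparse_prime y B p) pw (- (1 - delta)) p + 5)) +
  N%:R * (6 / (Q ^ J)%:R) + E%:R * (1 + lnn E) +
  pw (1 - delta2) N * (pw delta2 J0 * (1 + lnn J0)) *
    expR (pw delta2 Yn * recip_sum Yn + 5) +
  (N%:R + 2 * N%:R ^+ 2 / E.+1%:R + 2 * N%:R * (1 + h%:R)) *
    (l / (Q ^ (2 * J))%:R) * ((2 * J).+1%:R * l ^+ (2 * (2 * J))).
Proof.
move=> N Q B l Yn J1 y0 /andP[h0 hy] yN Y0 EN tN J0E dd dd2.
have hN : (h <= N)%N := leq_trans hy yN.
have N0 : (0 < N)%N := leq_trans y0 yN.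
have NN0 : (0 < N + N)%N by rewrite addn_gt0 N0.
have DS : (D_phi h Y x <= S_phi h x)%N.
  by apply: cnt_le => n _ [j [r dr]]; exact: diag_repr_totient dr.
rewrite ger0_norm ?subr_ge0 ?ler_nat // lerBlDl.
pose bad n := totient n = totient (n + h) /\ ~ (exists j r, diag_repr h Y n j r).
have S1 : (S_phi h x <= D_phi h Y x + cnt N bad)%N.
  apply: leq_trans (cnt_or _ _ _); apply: cnt_le => n _ tn.
  by have [d|d] := pselect (exists j r, diag_repr h Y n j r); [left|right].
apply: le_trans (_ : _ <= (D_phi h Y x)%:R + (cnt N bad)%:R) _.
  by rewrite -natrD ler_nat.
rewrite lerD2l.
pose P1 := sparse y B : nat -> Prop.
pose P2 n := sparse y B (n + h) : Prop.
pose P3 := has_square J y.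
pose P4 n := has_square J y (n + h).
pose P5 n := exists a b, [/\ (0 < a)%N, (0 < b)%N, (a * b <= E)%N & nondeg h a b n].
pose P6 n := exists2 j, j \in index_iota 1 J0.+1 &
        exists2 k, smooth Yn k /\ (0 < k)%N & n = (j * k.+1)%N.
pose P7 := caseA J y N h E.
pose P8 := caseB J y N h.
have cover : (cnt N bad <= (cnt N P1 + cnt N P2) + (cnt N P3 + cnt N P4) +
   (cnt N P5 + cnt N P6) + (cnt N P7 + cnt N P8))%N.
  do ?[apply: leq_trans (leq_add (cnt_or _ _ _) (leqnn _))].
  apply: leq_trans (leq_add (leqnn _) (cnt_or _ _ _)).
  apply: leq_trans (leq_add (leq_add (leqnn _) (cnt_or _ _ _)) (leqnn _)).
  apply: leq_trans (leq_add (leq_add (leq_add (cnt_or _ _ _) (cnt_or _ _ _)) (leqnn _)) (leqnn _)).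
  apply: leq_trans (leq_add (leq_add (cnt_or _ _ _) (leqnn _)) (leqnn _)).
  apply: leq_trans (leq_add (cnt_or _ _ _) (leqnn _)).
  apply: leq_trans (cnt_or _ _ _).
  apply: cnt_le => n nN [tn nd].
  have [] := exceptional_cover J1 y0 h0 hy hN EN tN J0E (erefl Yn) Y0 nN tn nd.
    by case=> H; left; left; [left; left|left; right|right; left|right; right].
  by case=> H; [left; right; left|left; right; right|right; left|right; right].
have sp : (cnt (N + N) (sparse y B))%:R <= pw (1 - delta) (N + N) *
    expR (\sum_(1 <= p < (N + N).+1 | sparse_prime y B p) pw (- (1 - delta)) p + 5).
  exact: sparse_count.
have c1 : (cnt N P1)%:R <= (cnt (N + N) (sparse y B))%:R :> R.
  by rewrite ler_nat cnt_widen // leq_addr.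
have c2 : (cnt N P2)%:R <= (cnt (N + N) (sparse y B))%:R :> R.
  by rewrite ler_nat; apply: leq_trans (cnt_shift N h (sparse y B)) _; rewrite cnt_widen // leq_add.
have T00 : (0 < Q ^ J)%N by rewrite expn_gt0.
have c3 : (cnt N P3)%:R <= N%:R * (2 / (Q ^ J)%:R) :> R by exact: square_count.
have c4 : (cnt N P4)%:R <= (N + N)%:R * (2 / (Q ^ J)%:R) :> R.
  apply: le_trans (square_count _ T00); rewrite ler_nat.
  by apply: leq_trans (cnt_shift N h (has_square J y)) _; rewrite cnt_widen // leq_add.
have c5 : (cnt N P5)%:R <= E%:R * (1 + lnn E).
  by apply: pair_count => a b m n; exact: nondeg_inj.
have c6 := friable_product_count Yn J0 dd2 N0.
have W1 : (1 < Q ^ (2 * J))%N.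
  by apply: leq_trans (_ : Q <= _)%N; rewrite ?ltnS // -[X in (X <= _)%N]expn1 leq_exp2l // muln_gt0.
have hy' : (0 < h <= y)%N by rewrite h0.
have c7 := caseA_count (R := R) E (2 * J) N0 hy' hN W1.
have c8 := caseB_count (R := R) (2 * J) N0 hy' hN W1.
have := cover; rewrite -(ler_nat R) !natrD.
move: c1 c2 sp c3 c4 c5 c6 c7 c8; rewrite natrD -/P1 -/P2 -/P3 -/P4 -/P5 -/P6 -/P7 -/P8 -/l.
move: (cnt N P1)%:R (cnt N P2)%:R (cnt N P3)%:R (cnt N P4)%:R (cnt N P5)%:R (cnt N P6)%:R
  (cnt N P7)%:R (cnt N P8)%:R (cnt (N + N) _)%:R (cnt N bad)%:R.
clear=> X1 X2 X3 X4 X5 X6 X7 X8 X9 X c1 c2 sp c3 c4 c5 c6 c7 c8 cX.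
move: c1 c2 sp c3 c4 c5 c6 c7 c8 cX.
move: (pw _ _ * expR _) (pw _ _ * _ * expR _) (E%:R * _) (l / _) (_ * l ^+ _) => S1 S2 S3 u k.
move: ((Q ^ J)%:R) (E.+1%:R) (N%:R : R) (h%:R : R) => q e n hh.
move=> c1 c2 sp c3 c4 c5 c6 c7 c8 cX.
have -> : (n + 2 * n ^+ 2 / e + 2 * n * (1 + hh)) * u * k =
  (n + 2 * n ^+ 2 / e) * u * k + 2 * n * (1 + hh) * u * k by ring.
have -> : n * (6 / q) = n * (2 / q) + (n + n) * (2 / q) by ring.
move: c3 c4 c7 c8; move: (n * (2 / q)) ((n + n) * (2 / q)) (_ * u * k) (_ * u * k) => *; lra.
Qed.

End Diff.

(** * Asymptotics of the scales *)

Local Open Scope ring_scope.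

Section Frame.
Context {R : realType}.
Local Notation lnn := (@lnn R).
Local Notation pw := (@pw R).
Local Notation recip_sum := (@recip_sum R).

Lemma expR_ge_mul (c t : R) : 1 <= c -> 2 * c <= t -> c * t <= expR t.
Proof.
move=> c1 ct; have t0 : 0 <= t by lra.
have := expR_ge1Dxn 1 t0; rewrite (_ : 2`!%:R = 2) // => h; apply: le_trans h.
rewrite expr2; nra.
Qed.

Lemma ln_gt0_gt1 (t : R) : 0 < ln t -> 1 < t.
Proof. by rewrite ltNge => h; rewrite ltNge; apply: contra h => /ln_le0. Qed.

Lemma ln2_bounds : 1 / 2 <= ln (2 : R) <= 1.
Proof.
apply/andP; split; last first.
  by have := @le_ln1Dx R 1; rewrite (_ : 1 + 1 = 2) //; apply; lra.
have h : ln (1 / 2) <= - (1 / 2) :> R.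
  have e : 1 / 2 = 1 + (- (1 / 2)) :> R by lra.
  by rewrite [X in ln X]e; apply: le_ln1Dx; lra.
by move: h; rewrite div1r lnV ?posrE //; lra.
Qed.

(* [la], [mu], [nu] are the iterated logarithms of [L = log x]; the single largeness
   parameter [c] controls all the asymptotic comparisons. *)
Record frame (J : nat) (c x L la mu nu A T V : R) : Prop := Frame {
  fr_L : expR L = x; fr_la : expR la = L; fr_mu : expR mu = la; fr_nu : expR nu = mu;
  fr_c1 : 1 <= c; fr_c : c <= nu; fr_cnu : c * nu <= mu; fr_cmu : c * mu <= la;
  fr_cla : c * la <= L;
  fr_A : A = mu + nu - ln 2;
  fr_T : T = expR ((la + ln A - ln J%:R) / 2);
  fr_V : V = expR ((la - ln A) / 2) }.

(** The bound on the fourth logarithm propagates upwards: [t >= 2 c] implies [e^t >= c t], so each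
    iterated logarithm exceeds [c] times the next. *)
Lemma frame_exists (J : nat) (c x : R) : (0 < J)%N -> 1 <= c -> 2 * c <= iter 4 (@ln R) x ->
  frame J c x (ln x) (iter 2 (@ln R) x) (iter 3 (@ln R) x) (iter 4 (@ln R) x)
    (scaleA x) (scaleT J x) (scaleV x).
Proof.
move=> J0 c1 cn; set nu := iter 4 _ x in cn *; set mu := iter 3 _ x; set la := iter 2 _ x.
have nuE : nu = ln mu by []. have muE : mu = ln la by []. have laE : la = ln (ln x) by [].
have nu0 : 0 < nu by lra.
have mu1 : 1 < mu by apply: ln_gt0_gt1; rewrite -nuE.
have la1 : 1 < la by apply: ln_gt0_gt1; rewrite -muE; lra.
have L1 : 1 < ln x by apply: ln_gt0_gt1; rewrite -laE; lra.
have x1 : 1 < x by apply: ln_gt0_gt1; lra.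
have eL : expR (ln x) = x by rewrite lnK // posrE; lra.
have ela : expR la = ln x by rewrite laE lnK // posrE; lra.
have emu : expR mu = la by rewrite muE lnK // posrE; lra.
have enu : expR nu = mu by rewrite nuE lnK // posrE; lra.
have h1 : c * nu <= mu by rewrite -enu; apply: expR_ge_mul.
have h2 : c * mu <= la by rewrite -emu; apply: expR_ge_mul => //; nra.
have h3 : c * la <= ln x by rewrite -ela; apply: expR_ge_mul => //; nra.
have AE : scaleA x = mu + nu - ln 2 by [].
have /andP[l2 l2'] := ln2_bounds.
have A0 : 0 < scaleA x by rewrite AE; nra.
have LE : ln x = expR la by [].
have GE : scaleG x = expR ((la + ln (scaleA x)) / 2).
  rewrite /scaleG /scaleL -ela -{1}[scaleA x]lnK ?posrE // -expRD.
  have {1}-> : la + ln (scaleA x) = 2 * ((la + ln (scaleA x)) / 2) by field.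
  by rewrite expRM_natl sqrtr_sqr ger0_norm // expR_ge0.
split=> //; first by lra.
  rewrite /scaleT GE -[X in Num.sqrt X]lnK ?posrE ?ltr0n //.
  have {1}-> : ln J%:R = 2 * (ln J%:R / 2) :> R by field.
  rewrite expRM_natl sqrtr_sqr ger0_norm ?expR_ge0 // -expRN -expRD.
  by congr expR; field.
by rewrite /scaleV GE /scaleL -ela -expRN -expRD; congr expR; field.
Qed.

Section Facts.
Context (J : nat) (c x L la mu nu A T V : R) (F : frame J c x L la mu nu A T V).
Hypothesis J0 : (0 < J)%N.

Lemma fr_pos : [/\ 1 <= nu, nu <= mu, mu <= la, la <= L & 1 <= A] /\
  [/\ mu <= A, A <= 2 * mu, 0 <= ln A, ln A <= mu + 1 & 0 <= ln (J%:R : R)].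
Proof.
case: F => eL ela emu enu c1 cn cnu cmu cla AE TE VE.
have /andP[l2 l2'] := ln2_bounds.
have n1 : 1 <= nu by lra.
have nm : nu <= mu by nra.
have ml : mu <= la by nra.
have lL : la <= L by nra.
have A1 : 1 <= A by lra.
have mA : mu <= A by lra.
have Am : A <= 2 * mu by lra.
split; split=> //.
- exact: ln_ge0.
- have : ln A <= ln (2 * mu) by rewrite ler_ln ?posrE //; lra.
  rewrite lnM ?posrE //; last by lra.
  by have : ln mu <= mu by [apply/ltW/ln_sublinear; lra]; lra.
- by rewrite ln_ge0 // ler1n.
Qed.

Lemma T_sq : J%:R * T ^+ 2 = L * A.
Proof.
have [[_ _ _ _ A1] _] := fr_pos; case: F => eL ela emu enu c1 cn cnu cmu cla AE TE VE.
rewrite TE -expRM_natl -{1}[J%:R]lnK ?posrE ?ltr0n // -ela -[A in RHS]lnK ?posrE; last by lra.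
by rewrite -!expRD; congr expR; field.
Qed.

Lemma L_div_T : L / T = expR (ln J%:R / 2) * V.
Proof.
case: F => eL ela emu enu c1 cn cnu cmu cla AE TE VE.
by rewrite TE VE -ela -expRN -!expRD; congr expR; field.
Qed.

Lemma expA : expR A = la * mu / 2.
Proof.
case: F => eL ela emu enu c1 cn cnu cmu cla AE TE VE.
by rewrite AE expRD expRD emu enu expRN lnK // posrE.
Qed.

Lemma T_bounds : 6 * ln (J%:R : R) <= c -> expR (la / 3) <= T /\ T <= expR la.
Proof.
have [[n1 nm ml lL A1] [mA Am a0 am j0]] := fr_pos.
case: F => eL ela emu enu c1 cn cnu cmu cla AE TE VE jc.
have h1 : c <= c * mu by rewrite ler_peMr //; lra.
have h2 : 1 + mu <= la by rewrite -emu; apply: expR_ge1Dx.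
by rewrite TE !ler_expR; split; lra.
Qed.

End Facts.

(** The left side is [L^k] times a power of [log L], while [V = (L / A)^(1/2)] with [ln A <= mu + 1]
    and [mu = o(la)]. All errors in exponents are brought to this shape. *)
Lemma le_V (J : nat) (k K eps : R) : (0 < J)%N -> k < 1 / 2 -> 0 <= K -> 0 < eps ->
  exists c0, forall c x L la mu nu A T V, frame J c x L la mu nu A T V -> c0 <= c ->
    expR (k * la + K * mu + K) <= eps * V.
Proof.
move=> J0 k2 K0 e0; exists ((2 * K + 2 + `|ln eps|) / (1 / 2 - k)).
move=> c x L la mu nu A T V F cc.
have [[n1 nm ml lL A1] [mA Am a0 am j0]] := fr_pos F J0.
case: F => eL ela emu enu c1 cn cnu cmu cla AE TE VE.
rewrite VE -{1}[eps]lnK ?posrE // -expRD ler_expR.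
have k0 : 0 < 1 / 2 - k by lra.
rewrite ler_pdivrMr // in cc.
have h := ler_norm (- ln eps); rewrite normrN in h.
have e1 : c * mu * (1 / 2 - k) <= la * (1 / 2 - k) by rewrite ler_pM2r.
have mu1 : 1 <= mu := le_trans n1 nm.
have mu0 : 0 <= mu := le_trans ler01 mu1.
have e2 : (2 * K + 2 + `|ln eps|) * mu <= c * (1 / 2 - k) * mu by rewrite ler_wpM2r.
have e3 : `|ln eps| <= `|ln eps| * mu by rewrite ler_peMr.
have e4 : K <= K * mu by rewrite ler_peMr.
move: h e1 e2 e3 e4 am mu1; clear; set le := `|_|; set l1 := ln eps; set l2 := ln A; lra.
Qed.

Definition truncexp (s : R) := Num.truncn (expR s).

Lemma truncexp_bounds s : (truncexp s)%:R <= expR s /\ expR s < (truncexp s).+1%:R.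
Proof. by have /andP[] := truncn_itv (expR_ge0 s). Qed.

Lemma truncexp_ge s n : n%:R <= expR s -> (n <= truncexp s)%N.
Proof. by move=> h; rewrite truncn_ge_nat // expR_ge0. Qed.

Lemma ln_truncexp_le s : 0 <= s -> lnn (truncexp s) <= s.
Proof.
move=> s0; have [h _] := truncexp_bounds s.
have [->|f0] := posnP (truncexp s); first by rewrite /lnn ln0.
by rewrite -[leRHS]expRK ler_ln ?posrE ?ltr0n // expR_gt0.
Qed.

Lemma ln_truncexpS_ge s : s <= lnn (truncexp s).+1.
Proof.
have [_ h] := truncexp_bounds s.
by rewrite -[leLHS]expRK ler_ln ?posrE ?expR_gt0 ?ltr0n // ltW.
Qed.

Lemma ln_truncexpS_le s : 0 <= s -> lnn (truncexp s).+1 <= s + 1.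
Proof.
move=> s0; have [h _] := truncexp_bounds s.
rewrite -[leRHS]expRK ler_ln ?posrE ?expR_gt0 ?ltr0n // -natr1 expRD.
have e1 := expR_ge1Dx (1 : R); have es : 1 <= expR s by rewrite -[leLHS]expR0 ler_expR.
nra.
Qed.

Lemma ln_truncexp_ge s : 1 <= s -> s - 1 <= lnn (truncexp s).
Proof.
move=> s1; have [h1 h2] := truncexp_bounds s.
have e1 := expR_ge1Dx (1 : R).
have e2 : expR s = expR (s - 1) * expR 1 by rewrite -expRD subrK.
have es : 1 <= expR (s - 1) by rewrite -[leLHS]expR0 ler_expR; lra.
have h : expR (s - 1) <= (truncexp s)%:R by move: h2; rewrite -natr1; nra.
rewrite -[leLHS]expRK ler_ln ?posrE ?expR_gt0 //.
by apply: lt_le_trans h; apply: expR_gt0.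
Qed.

End Frame.

(** * The reciprocal sum of primes l with a l + 1 prime *)

Local Open Scope ring_scope.

Section TwinSum.
Context {R : realType}.
Local Notation lnn := (@lnn R).
Local Notation pw := (@pw R).
Local Notation recip_sum := (@recip_sum R).

Lemma polylog_le_T (J : nat) (c x L la mu nu A T V K : R) : (0 < J)%N ->
  frame J c x L la mu nu A T V -> 0 <= K -> 6 * K <= c -> 6 * ln (J%:R : R) <= c ->
  expR (K * mu + K) <= T.
Proof.
move=> J0 F K0 Kc Jc; have [h _] := T_bounds F J0 Jc; apply: le_trans h.
have [[n1 nm ml lL A1] _] := fr_pos F J0.
case: F => eL ela emu enu c1 cn cnu cmu cla AE TE VE.
have mu1 : 1 <= mu := le_trans n1 nm.
rewrite ler_expR; have h1 : K <= K * mu by rewrite ler_peMr.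
have h2 : 6 * K * mu <= c * mu by rewrite ler_wpM2r // (le_trans ler01).
move: h1 h2 cmu; clear; lra.
Qed.

(** The range is covered by [O(T)] dyadic blocks, each contributing a power of [log L] divided by
    [T^2]. It starts at [w], above which the sieve can use all primes up to [z] with [ln z] still
    [T] up to powers of [la]. *)
Lemma twin_sum_bound (J : nat) : (0 < J)%N -> exists K c0 : R, 0 <= K /\
  forall c x L la mu nu A T V, frame J c x L la mu nu A T V -> c0 <= c ->
  forall a, (0 < a)%N -> lnn a <= L + 1 ->
  \sum_((truncexp (T / la ^+ 2)).+1 <= l < (truncexp T).+1 | prime l && prime (a * l + 1)) l%:R^-1
    <= expR (K * mu + K) / T.
Proof.
move=> J0; have [C C0 twin] := @twin_count_le R; have [C2 C20 mert] := mertens2 (R := R).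
pose k1 : R := expR 2 * (2 + 2 * C) + 1.
have k10 : 1 <= k1 by rewrite /k1 lerDr mulr_ge0 ?expR_ge0 //; lra.
pose K := 70 + 2 * C + 2 * C2; exists K, (6 * K + 24 + 6 * ln (J%:R : R) + 4 * k1 + 600).
split; first by rewrite /K; lra.
move=> c x L la mu nu A T V F cc a a0 La.
have [[n1 nm ml lL A1] [mA Am la0 am j0]] := fr_pos F J0.
have K0 : 70 <= K by move: C0 C20; rewrite /K; clear; lra.
have [c600 jc] : 600 <= c /\ 6 * ln (J%:R : R) <= c.
  by move: cc K0 k10 j0; clear; move: K => K' *; split; lra.
have [T1 T2] := T_bounds F J0 jc.
have Tp m : 0 <= m -> m <= 100 -> expR (m * mu + m) <= T.
  by move=> m0 m1; apply: (polylog_le_T J0 F) => //; move: m1 c600; clear; lra.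
have [eL ela emu enu c1 cn cnu cmu cla AE TE VE] := F.
have mu1 : 1 <= mu := le_trans n1 nm.
have la1 : 1 <= la := le_trans mu1 ml.
have lac : c <= la by apply: le_trans cmu; rewrite ler_peMr //; move: c600; clear; lra.
have T0 : 0 < T by rewrite TE expR_gt0.
clear TE.
have L1 : 1 <= L := le_trans la1 lL.
have ck1 : 4 * k1 <= la.
  by move: cc lac K0 j0; clear; move: K k1 => K' k' *; lra.
clear cc c600 n1 nm lL A1 mA Am la0 am j0 jc T1 eL enu c1 cn cnu cmu cla AE VE lac ml.
have lam n : la ^+ n = expR (n%:R * mu) by rewrite expRM_natl emu.
have e4 : 4 * la ^+ 4 <= T.
  apply: le_trans (Tp 4 _ _); [|by []|by rewrite ler_nat].
  rewrite lam expRD mulrC ler_wpM2l ?expR_ge0 //.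
  by have := expR_ge1Dx (4 : R); clear; lra.
have la00 : 0 < la := lt_le_trans ltr01 la1.
have lp n : 0 < la ^+ n by apply: exprn_gt0.
(* [ln w] is about [s1] and [ln z] about [s2]. The sieve depth is [O(la)], so its remainder needs
   [O(la * s2)], and the gap [la^2] between [s2] and [s1] leaves room. *)
pose s1 := T / la ^+ 2; pose s2 := T / la ^+ 4.
have s24 : 4 <= s2 by rewrite /s2 ler_pdivlMr.
have s12 : s1 = s2 * la ^+ 2 by rewrite /s1 /s2; field; rewrite gt_eqF.
have s2s1 : s2 <= s1 by rewrite s12 ler_peMr ?exprn_ege1 //; move: s24; clear; lra.
have s2T : s2 <= T by rewrite /s2 ler_pdivrMr // ler_peMr ?exprn_ege1 // ltW.
have la0 : 0 <= la := le_trans ler01 la1.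
have s20 : 0 <= s2 := le_trans (ler0n _ 4) s24.
rewrite -/s1; set w := truncexp s1; pose z := truncexp s2.
have z3 : (3 <= z)%N by apply: truncexp_ge; have := expR_ge1Dx s2; move: s24; clear; lra.
have zw : (z <= w)%N by apply: le_truncn; rewrite ler_expR.
have lz1 : s2 / 2 <= lnn z.
  by apply: le_trans (ln_truncexp_ge _); move: s24; clear; lra.
have lz2 : lnn z <= s2 by apply: ln_truncexp_le.
have llz : ln (lnn z) <= la.
  rewrite -[leRHS]expRK ler_ln ?posrE ?expR_gt0 //; last by move: lz1 s24; clear; lra.
  exact: le_trans lz2 (le_trans s2T T2).
have l3z : lnn (3 * z) <= 2 * s2.
  rewrite lnnM //; last exact: leq_trans z3.
  have l3 : lnn 3 <= 2.
    have := @le_ln1Dx R 2; rewrite (_ : 1 + 2 = 3); last by ring.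
    by apply; rewrite (lt_trans _ (ltr0n R 2)) // ltrN10.
  move: lz2 s24 l3; clear; lra.
have hyp Z : (w.+1 <= Z)%N ->
  (expR 2 * (2 * (ln (lnn z) + C)) + 1) * lnn (3 * z)%N + 2 * ln (lnn z) <= lnn Z.
  move=> wZ; apply: (@le_trans _ _ s1); last first.
    by apply: le_trans (ln_truncexpS_ge s1) _; apply: lnn_le.
  have e2 := expR_gt0 (2 : R).
  have h1 : expR 2 * (2 * (ln (lnn z) + C)) + 1 <= k1 * la.
    have : expR 2 * (2 * (ln (lnn z) + C)) <= expR 2 * ((2 + 2 * C) * la).
      rewrite ler_pM2l //; have : C <= C * la by rewrite ler_peMr // ltW.
      by move: llz; clear; set t := ln _; lra.
    by move: la1; rewrite /k1; clear; move: (expR 2 * _) => t; lra.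
  have h2 : k1 * la * lnn (3 * z) <= k1 * la * (2 * s2).
    by rewrite ler_wpM2l // mulr_ge0 // (le_trans ler01).
  have h3 : (expR 2 * (2 * (ln (lnn z) + C)) + 1) * lnn (3 * z) <= k1 * la * lnn (3 * z).
    by rewrite ler_wpM2r // lnn_ge0.
  have h4 : 4 * k1 * (la * s2) <= la * (la * s2).
    exact: ler_wpM2r (mulr_ge0 la0 s20) _ _ ck1.
  have h5 : 4 * la <= s1.
    have g1 : 4 * 1 <= s2 * la by apply: ler_pM.
    have g2 : 4 * 1 * la <= s2 * la * la by apply: ler_wpM2r.
    rewrite s12 expr2; move: g2; clear; lra.
  have h6 : s1 = la * (la * s2) by rewrite s12; ring.
  move: h2 h3 h4 h5 h6 llz; clear.
  set X := (_ + 1) * _; set Y := k1 * la * lnn _; set ll := ln _; move=> *; lra.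
pose H := 3 * expR (2 * C + 2 * recip_div a) / lnn z ^+ 2.
have blk Z : (w.+1 <= Z)%N ->
    (count (fun l => prime l && prime (a * l + 1)) (index_iota Z (Z + Z)))%:R <= Z%:R * H.
  by move=> wZ; apply: twin => //; [exact: leq_ltn_trans zw wZ|exact: hyp].
pose I := (Num.truncn (2 * T + 2)).+1.
have I0 : 0 <= 2 * T + 2 by move: T0; clear; lra.
have /andP[I1 I2] := truncn_itv I0; rewrite -/I in I2.
have I3 : I%:R <= 2 * T + 3 by rewrite /I -natr1; move: I1; clear; lra.
have dy := sum_dyadic_le I (ltn0Sn w) blk.
have yI : ((truncexp T).+1 <= w.+1 * 2 ^ I)%N.
  apply: leq_trans (_ : 2 ^ I <= _)%N; last by rewrite leq_pmull.
  rewrite -(ler_nat R) natrX -[(2 : R)]lnK ?posrE // -expRM_natl.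
  have [f1 _] := truncexp_bounds T.
  apply: le_trans (_ : _ <= expR (T + 1)) _.
    rewrite -natr1 expRD; have := expR_ge1Dx (1 : R).
    have : 1 <= expR T by rewrite -[leLHS]expR0 ler_expR ltW.
    by move: f1; clear; nra.
  rewrite ler_expR; have /andP[l2 _] := @ln2_bounds R.
  have : I%:R * (1 / 2) <= I%:R * ln 2 :> R by rewrite ler_wpM2l.
  by move: I2 l2; clear; lra.
have [wy|yw] := leqP w.+1 (truncexp T).+1; last first.
  by rewrite big_geq ?divr_ge0 ?expR_ge0 ?(ltW T0) // ltnW.
apply: le_trans (_ : _ <= I%:R * H) _.
  apply: le_trans dy; rewrite [leRHS](@big_cat_nat _ _ _ (truncexp T).+1) //= lerDl.
  by apply: sumr_ge0_natP => k _ _; rewrite invr_ge0.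
(* Cutting the prime factors of [a] near [L] makes the large ones contribute [O(1)], since
   [ln a <= L + 1], and the small ones [ln ln L + O(1) = mu + O(1)]. *)
pose Tn := (truncexp la).+1.
have [_ Tn1] := truncexp_bounds la; rewrite -/Tn ela in Tn1.
have Tn2 : (2 <= Tn)%N by rewrite /Tn ltnS; apply: truncexp_ge; have := expR_ge1Dx la; move: la1; clear; lra.
have rd : recip_div a <= mu + 5 + C2.
  apply: le_trans (recip_div_le a0 (ltn0Sn (truncexp la))) _; rewrite -/Tn.
  have [_ m2] := mert Tn Tn2.
  have lT : lnn Tn <= 2 * la by apply: le_trans (ln_truncexpS_le la0) _; move: la1; clear; lra.
  have llT : ln (lnn Tn) <= 1 + mu.
    apply: le_trans (_ : _ <= ln (2 * la)) _.
      by rewrite ler_ln ?posrE ?lnn_gt0 // mulr_gt0.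
    rewrite lnM ?posrE // -emu expRK; have /andP[_ l2] := @ln2_bounds R.
    by move: l2; clear; lra.
  have q : lnn a / ln 2 / Tn%:R <= 4.
    have /andP[l2 _] := @ln2_bounds R.
    rewrite ler_pdivrMr ?ltr0n // ler_pdivrMr; last by move: l2; clear; lra.
    have t1 : L * (1 / 2) <= Tn%:R * ln 2 by apply: ler_pM => //; [exact: le_trans L1|exact: ltW].
    by move: t1 La L1; clear; lra.
  by move: m2 llT q; clear; lra.
have H1 : H <= 12 * expR (2 * mu + (10 + 2 * C2 + 2 * C)) / s2 ^+ 2.
  rewrite /H -[12]/((3 * 4)%N%:R) natrM -!mulrA ler_pM2l // mulrCA.
  rewrite ler_pM ?expR_ge0 ?invr_ge0 ?exprn_ge0 ?lnn_ge0 //.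
    by rewrite ler_expR; move: rd; clear; lra.
  have s200 : 0 < s2 by move: s24; clear; lra.
  have lz0 : 0 < lnn z by move: lz1 s200; clear; lra.
  have -> : 4 * (s2 ^+ 2)^-1 = ((s2 / 2) ^+ 2)^-1 by field; rewrite gt_eqF.
  rewrite lef_pV2 ?posrE ?exprn_gt0 ?divr_gt0 //.
  by rewrite lerXn2r ?nnegrE ?divr_ge0 // ltW.
have H0 : 0 <= H.
  by rewrite /H divr_ge0 ?mulr_ge0 ?expR_ge0 ?exprn_ge0 ?lnn_ge0.
apply: le_trans (_ : _ <= (5 * T) * (12 * expR (2 * mu + (10 + 2 * C2 + 2 * C)) / s2 ^+ 2)) _.
  by apply: ler_pM => //; have := Tp 0 (lexx _) (ler0n _ _); rewrite mul0r addr0 expR0; move: I3; clear; lra.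
have -> : 5 * T * (12 * expR (2 * mu + (10 + 2 * C2 + 2 * C)) / s2 ^+ 2) =
  60 * expR (2 * mu + (10 + 2 * C2 + 2 * C)) * la ^+ 8 / T.
  by rewrite /s2; field; rewrite !gt_eqF.
rewrite ler_pM2r ?invr_gt0 // lam -mulrA -expRD.
have h60 : 60 <= expR 60 :> R by have := expR_ge1Dx (60 : R); clear; lra.
apply: le_trans (ler_wpM2r (expR_ge0 _) h60) _; rewrite -expRD ler_expR.
have : 10 * mu <= K * mu by rewrite ler_wpM2r // ?(le_trans ler01) // (le_trans _ K0) // ler_nat.
by move: mu1 C0 C20; rewrite /K; clear; lra.
Qed.

End TwinSum.

(** * The prime sum up to y at the critical exponent *)

Local Open Scope ring_scope.

Section SmallPrimes.
Context {R : realType}.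
Local Notation lnn := (@lnn R).
Local Notation pw := (@pw R).
Local Notation recip_sum := (@recip_sum R).
Local Notation mertens := (@mertens R).

Lemma recip_sum_le_ln (C : R) (mert : forall N, (2 <= N)%N ->
    ln (lnn N) - C <= recip_sum N /\ recip_sum N <= ln (lnn N) + C) N (t : R) :
  0 <= C -> (0 < N)%N -> 0 <= t -> lnn N <= expR t -> recip_sum N <= t + C.
Proof.
move=> C0 N0 t0 Nt; have [N1|N2] := leqP N 1.
  have -> : N = 1%N by apply/eqP; rewrite eqn_leq N1.
  by rewrite /recip_sum big_mkcond big_nat1 /= addr_ge0.
have [_ h] := mert N N2; apply: le_trans h _; rewrite lerD2r.
by rewrite -[leRHS]expRK ler_ln ?posrE ?expR_gt0 // lnn_gt0.
Qed.

(** [prime_sum_pw_le] is cut at [e^(th T)]. The part above gives about [e^eta / (th' eta)]; since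
    [eta >= mu] and [e^eta = e^(- e) la mu / 2], this is at most [la / 2] times [e^(- e)], times
    [e^(e/4)] from [1 / th'], times [e^(e/4)] from [2^delta]: in all [e^(- e/2) la / 2]. The part
    below is about [la^th], absorbed by [tau * la]. *)
Lemma small_prime_sum_bound (C T la mu eta e th th' tau : R)
  (mert : forall N, (2 <= N)%N ->
    ln (lnn N) - C <= recip_sum N /\ recip_sum N <= ln (lnn N) + C) :
  0 <= C -> 0 < e <= 1 -> 1 <= mu -> 1 <= la -> mu <= eta -> eta <= 2 * mu ->
  expR eta = expR (- e) * (la * mu / 2) ->
  0 < th' -> th' < th -> th <= 1 -> expR (- e) / th' = expR (- (3 / 4 * e)) ->
  2 <= th * T -> 1 / (th - th') <= T -> eta / T <= e / 4 ->
  6 * la * mu <= th' * T -> (2 * mu + 1) * expR (th * eta) <= tau * la ->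
  \sum_(1 <= p < (truncexp T).+1 | prime p) pw (- (1 - eta / T)) p <=
    ln T + C + (expR (- (e / 2)) / 2 + tau) * la + 1.
Proof.
move=> C0 /andP[e0 e1] mu1 la1 me em eE th'0 th'th th1 eth thT thT' de laT tauP.
have t0 : 0 < th := lt_trans th'0 th'th.
have T2 : 2 <= T by move: thT th1 t0; clear; nra.
have T0 : 0 < T by move: T2; clear; lra.
have eta0 : 0 < eta by move: me mu1; clear; lra.
have la00 : 0 < la := lt_le_trans ltr01 la1.
have mu0 : 0 < mu := lt_le_trans ltr01 mu1.
have thT0 : 0 <= th * T := le_trans (ler0n _ 2) thT.
set d := eta / T; have d0 : 0 < d by rewrite divr_gt0.
have dT : d * T = eta by rewrite /d divfK // gt_eqF.
set y := truncexp T; set q := truncexp (th * T).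
have y2 : (2 <= y)%N by apply: truncexp_ge; have := expR_ge1Dx T; move: T2; clear; lra.
have q2 : (1 < q)%N by apply: truncexp_ge; have := expR_ge1Dx (th * T); move: thT; clear; lra.
apply: le_trans (prime_sum_pw_le d0 (ltnW y2) q2) _.
have r1 : recip_sum y <= ln T + C.
  have [_ h] := mert y y2; apply: le_trans h _; rewrite lerD2r ler_ln ?posrE ?lnn_gt0 //.
  by apply: ln_truncexp_le; exact: ltW.
have lq1 : lnn q <= th * T by apply: ln_truncexp_le.
have lq2 : th * T - 1 <= lnn q by apply: ln_truncexp_ge; move: thT; clear; lra.
have thT2 : th' * T <= th * T - 1.
  have : 1 <= (th - th') * T by rewrite mulrC -ler_pdivrMr ?subr_gt0.
  by clear; lra.
have lq3 : th' * T <= lnn q := le_trans thT2 lq2.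
have pq : pw d q <= expR (th * eta).
  rewrite /pw ler_expR -dT mulrCA; apply: ler_wpM2l => //; exact: ltW.
have py : pw d y <= expR eta.
  rewrite /pw ler_expR -dT; apply: ler_wpM2l; first exact: ltW.
  by apply: ln_truncexp_le; exact: ltW.
have r2 : d * pw d q * mertens q <= tau * la.
  apply: le_trans tauP; have m1 := mertens_le (R := R) (ltnW q2).
  have m2 : d * (lnn q + 3) <= 2 * mu + 1.
    have h : d * lnn q <= d * T by apply: ler_wpM2l; [exact: ltW|apply: le_trans lq1 _; rewrite ler_piMl ?(ltW T0)].
    by rewrite dT in h; move: h de em e1; rewrite -/d mulrDr; clear; lra.
  rewrite mulrAC; apply: le_trans (_ : _ <= d * (lnn q + 3) * pw d q) _.
    by rewrite ler_wpM2r ?pw_ge0 // ler_wpM2l // ltW.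
  by apply: ler_pM; rewrite ?pw_ge0 // mulr_ge0 ?(ltW d0) // addr_ge0 // lnn_ge0.
have r3 : wsum (pw d) y / lnn q <= expR (- (e / 2)) / 2 * la + 1.
  have tT0 : 0 < th' * T by rewrite mulr_gt0.
  have lq0 : 0 < lnn q by apply: lt_le_trans lq3.
  have d2 : expR (d * ln 2) <= expR (e / 4).
    rewrite ler_expR; have /andP[l2 l2'] := @ln2_bounds R.
    by apply: le_trans de; rewrite -/d ler_piMr // ltW.
  have w1 : wsum (pw d) y <= (6 + expR (e / 4) / d) * expR eta.
    apply: le_trans (wsum_pw d0 (ltnW y2)) _; apply: ler_pM; rewrite ?pw_ge0 //.
      by rewrite addr_ge0 // divr_ge0 ?expR_ge0 // ltW.
    by rewrite lerD2l ler_pM2r ?invr_gt0.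
  apply: le_trans (_ : _ <= (6 + expR (e / 4) / d) * expR eta / (th' * T)) _.
    apply: le_trans (_ : _ <= (6 + expR (e / 4) / d) * expR eta / lnn q) _.
      by rewrite ler_pM2r ?invr_gt0.
    apply: ler_wpM2l; last by rewrite lef_pV2 ?posrE.
    by rewrite mulr_ge0 ?expR_ge0 // addr_ge0 // divr_ge0 ?expR_ge0 // ltW.
  have -> : (6 + expR (e / 4) / d) * expR eta / (th' * T) =
     6 * expR eta / (th' * T) + expR (e / 4) * expR eta / (th' * (d * T)).
    by field; rewrite !gt_eqF.
  rewrite dT addrC; apply: lerD.
    rewrite eE.
    have -> : expR (e / 4) * (expR (- e) * (la * mu / 2)) / (th' * eta) =
      expR (e / 4) * (expR (- e) / th') * (la / 2) * (mu / eta).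
      by field; rewrite !gt_eqF.
    rewrite eth -expRD (_ : e / 4 + - (3 / 4 * e) = - (e / 2)); last by field.
    have -> : expR (- (e / 2)) / 2 * la = expR (- (e / 2)) * (la / 2) * 1 by ring.
    apply: ler_wpM2l; first by rewrite mulr_ge0 ?expR_ge0 // divr_ge0 // ltW.
    by rewrite ler_pdivrMr ?mul1r.
  rewrite ler_pdivrMr // mul1r; apply: le_trans laT; rewrite eE.
  have : expR (- e) <= 1 by rewrite -[leRHS]expR0 ler_expR oppr_le0 ltW.
  have lm : 0 <= la * mu by rewrite mulr_ge0 // ltW.
  by move=> h; have := ler_wpM2r lm h; move: lm; clear; lra.
by move: r1 r2 r3; clear; lra.
Qed.

End SmallPrimes.

(** * The sum over sparse primes is o(V) *)

Local Open Scope ring_scope.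

Section SparseAsym.
Context {R : realType}.
Local Notation lnn := (@lnn R).
Local Notation pw := (@pw R).
Local Notation recip_sum := (@recip_sum R).

Lemma natr_le_exp n : n%:R <= expR n%:R :> R.
Proof. by have := expR_ge1Dx (n%:R : R); lra. Qed.

Lemma pw_pow_le (d mu : R) Q m : (0 < Q)%N -> d * lnn Q <= 2 * mu + 1 ->
  pw d (Q ^ m) <= expR (m%:R * (2 * mu + 1)).
Proof.
move=> Q0 dQ; rewrite /pw ler_expR lnnX // mulrnAr -mulr_natl.
by rewrite ler_wpM2l.
Qed.

Lemma ln_pow_le (la : R) Q m : (0 < Q)%N -> lnn Q <= expR (la + 1) ->
  lnn (Q ^ m) <= expR (m%:R + la + 1).
Proof.
move=> Q0 lQ; rewrite lnnX // -[leLHS]mulr_natl -addrA expRD.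
by rewrite ler_pM ?lnn_ge0 // natr_le_exp.
Qed.

Lemma part_a_bound (C d la mu : R) Q m
  (mert : forall N, (2 <= N)%N ->
    ln (lnn N) - C <= recip_sum N /\ recip_sum N <= ln (lnn N) + C) :
  0 <= C -> (0 < Q)%N -> 1 <= la -> expR mu = la ->
  d * lnn Q <= 2 * mu + 1 -> lnn Q <= expR (la + 1) ->
  pw d (Q ^ m) * recip_sum (Q ^ m) <= expR (m%:R * (2 * mu + 1) + mu + (m%:R + 1 + C)).
Proof.
move=> C0 Q0 la1 emu dQ lQ; have m0 : 0 <= m%:R :> R by [].
have QM : (0 < Q ^ m)%N by rewrite expn_gt0 Q0.
have r : recip_sum (Q ^ m) <= m%:R + la + 1 + C.
  apply: (recip_sum_le_ln mert) => //; last exact: ln_pow_le.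
  by move: la1 m0; clear; lra.
rewrite -addrA expRD; apply: ler_pM; rewrite ?pw_ge0 //.
- by apply: sumr_ge0 => p _; rewrite invr_ge0.
- exact: pw_pow_le.
apply: le_trans r _; rewrite expRD emu.
have h := expR_ge1Dx (m%:R + 1 + C).
have h2 : la * (1 + (m%:R + 1 + C)) <= la * expR (m%:R + 1 + C).
  by apply: ler_wpM2l h; exact: le_trans la1.
have h3 : 1 * (m%:R + 1 + C) <= la * (m%:R + 1 + C).
  by apply: ler_wpM2r la1; rewrite !addr_ge0.
by move: h2 h3; clear; lra.
Qed.

(** The choice [delta' = la^2 / T] makes the saving [e^(- la^2)], which beats every other factor,
    all being [e^(O(la))]; at the same time [w^(delta + delta') <= e^2], because
    [ln w <= T / la^2]. *)
Lemma part_b1_bound (C d T la mu : R) Q K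
  (mert : forall N, (2 <= N)%N ->
    ln (lnn N) - C <= recip_sum N /\ recip_sum N <= ln (lnn N) + C) :
  0 <= C -> (0 < Q)%N -> 1 <= mu -> 2 * mu <= la -> T <= expR la -> 0 < T ->
  0 <= d -> d * T <= 2 * mu ->
  d * lnn Q <= 2 * mu + 1 -> lnn Q <= expR (la + 1) -> T <= lnn Q ->
  3 * K%:R + K%:R + 2 + expR 2 * (1 + C) + 6 <= la -> 2 <= expR (T / la ^+ 2) ->
  pw d (Q ^ K) * (1 + lnn (Q ^ K)) * (pw (- (la ^+ 2 / T)) Q *
    expR (pw (d + la ^+ 2 / T) (truncexp (T / la ^+ 2)) * recip_sum (truncexp (T / la ^+ 2)) + 5)) <= 1.
Proof.
move=> C0 Q0 mu1 mula Tla T0 d0 dT dQ lQ TQ laK fl2.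
have K0 : 0 <= K%:R :> R by [].
have la1 : 1 <= la by lra.
have la0 : 0 < la := lt_le_trans ltr01 la1.
have la2 : 0 < la ^+ 2 by apply: exprn_gt0.
set s := T / la ^+ 2; set w := truncexp s.
have s0 : 0 <= s by rewrite divr_ge0 // ltW.
have w2 : (2 <= w)%N by apply: truncexp_ge.
have p1 := pw_pow_le K Q0 dQ.
have p2 : 1 + lnn (Q ^ K) <= expR (K%:R + la + 2).
  have := ln_pow_le K Q0 lQ; rewrite (_ : K%:R + la + 2 = K%:R + la + 1 + 1); last by ring.
  rewrite [X in _ -> _ <= X]expRD; have := expR_ge1Dx (1 : R).
  have : 1 <= expR (K%:R + la + 1) by rewrite -[leLHS]expR0 ler_expR; move: K0 la1; clear; lra.
  by clear; nra.
have p3 : pw (- (la ^+ 2 / T)) Q <= expR (- la ^+ 2).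
  rewrite /pw ler_expR mulNr lerN2 -[leLHS](@divfK _ T) ?gt_eqF //.
  by rewrite ler_wpM2l // divr_ge0 // ltW.
have p4 : pw (d + la ^+ 2 / T) w <= expR 2.
  rewrite /pw ler_expR; have lw : lnn w <= s by apply: ln_truncexp_le.
  have lw0 : 0 <= lnn w := lnn_ge0 w.
  apply: le_trans (_ : _ <= (d + la ^+ 2 / T) * s) _.
    by apply: ler_wpM2l lw; rewrite addr_ge0 // divr_ge0 // ltW.
  have -> : (d + la ^+ 2 / T) * s = d * T / la ^+ 2 + 1 by rewrite /s; field; rewrite !gt_eqF //.
  have : d * T / la ^+ 2 <= 1.
    rewrite ler_pdivrMr // mul1r; apply: le_trans dT _; apply: le_trans mula _.
    by rewrite expr2 ler_peMr //; lra.
  by clear; lra.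
have p5 : recip_sum w <= la + C.
  apply: (recip_sum_le_ln mert) => //; [exact: ltnW|lra|].
  apply: le_trans (ln_truncexp_le s0) _; apply: le_trans Tla.
  by rewrite ler_pdivrMr // ler_peMr ?exprn_ege1 // ltW.
have p5' : 0 <= recip_sum w by apply: sumr_ge0 => p _; rewrite invr_ge0.
have p6 : pw (d + la ^+ 2 / T) w * recip_sum w <= expR 2 * (la + C).
  by apply: ler_pM => //; exact: pw_ge0.
apply: le_trans (_ : _ <= expR (K%:R * (2 * mu + 1)) * expR (K%:R + la + 2) *
   (expR (- la ^+ 2) * expR (expR 2 * (la + C) + 5))) _.
  apply: ler_pM; first by rewrite mulr_ge0 ?pw_ge0 // addr_ge0 ?lnn_ge0.
  - exact: mulr_ge0 (pw_ge0 _ _) (expR_ge0 _).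
  - by apply: ler_pM => //; rewrite ?pw_ge0 // addr_ge0 ?lnn_ge0.
  - by apply: ler_pM => //; rewrite ?pw_ge0 ?expR_ge0 // ler_expR lerD2r.
rewrite -!expRD -[leRHS]expR0 ler_expR.
have h1 : K%:R * (2 * mu + 1) <= K%:R * (2 * la).
  by apply: ler_wpM2l => //; move: mula mu1; clear; lra.
have e2 := expR_ge0 (2 : R).
have h2 : expR 2 * C <= expR 2 * C * la by rewrite ler_peMr // mulr_ge0.
have h3 := ler_wpM2r (le_trans ler01 la1) laK.
have h4 : K%:R <= K%:R * la by rewrite ler_peMr.
rewrite expr2; move: h1 h2 h3 h4 la1 K0; clear; lra.
Qed.

(** The critical cancellation: [e^S] contains the factor [T] from Mertens' theorem, and [H] supplies
    [1 / T]. *)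
Lemma part_b2_bound (C d T la mu S H k1 k2 : R) y K :
  0 <= C -> (0 < y)%N -> 1 <= mu -> 1 <= T -> 0 <= H ->
  d * lnn y.+1 <= 2 * mu + 1 -> 0 <= d -> T <= lnn y.+1 ->
  S <= ln T + C + k1 * la + 1 -> H <= expR (k2 * mu + k2) / T ->
  pw d (y.+1 ^ K) * expR (S + (lnn (y.+1 ^ K) + 3) / lnn y.+1 + 5) * (pw d y * H) <=
  expR (k1 * la + (2 * K%:R + 2 + k2) * mu + (K%:R + C + K%:R + 10 + k2)).
Proof.
move=> C0 y0 mu1 T1 H0 dQ d0 TQ SP HT.
have T0 : 0 < T by lra.
have Q0 : 0 < lnn y.+1 by apply: lt_le_trans TQ.
have p1 := pw_pow_le K (ltn0Sn y) dQ.
have p2 : (lnn (y.+1 ^ K) + 3) / lnn y.+1 <= K%:R + 3.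
  rewrite lnnX // ler_pdivrMr // mulrDl mulr_natl lerD2l ler_peMr //.
  exact: le_trans TQ.
have p3 : pw d y <= expR (2 * mu + 1).
  rewrite ler_expR; apply: le_trans dQ; apply: ler_wpM2l => //; exact: lnn_le.
apply: le_trans (_ : _ <= expR (K%:R * (2 * mu + 1)) *
   expR (ln T + C + k1 * la + 1 + (K%:R + 3) + 5) *
   (expR (2 * mu + 1) * (expR (k2 * mu + k2) / T))) _.
  apply: ler_pM.
  - exact: mulr_ge0 (pw_ge0 _ _) (expR_ge0 _).
  - exact: mulr_ge0 (pw_ge0 _ _) H0.
  - apply: ler_pM; [exact: pw_ge0|exact: expR_ge0|exact: p1|].
    by rewrite ler_expR lerD2r; apply: lerD.
  - by apply: ler_pM; first exact: pw_ge0.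
rewrite -[X in _ / X]lnK ?posrE // -expRN -!expRD ler_expR.
by lra.
Qed.

Theorem sparse_asym (J K : nat) (e : R) : (0 < J)%N -> (0 < K)%N -> 0 < e <= 1 ->
  exists k K' c0 : R, [/\ k < 1 / 2, 0 <= K' &
  forall c x L la mu nu A T V, frame J c x L la mu nu A T V -> c0 <= c ->
    0 < (A - e) / T <= 1 / 8 /\ forall M, lnn M <= L + 1 ->
    \sum_(1 <= p < M.+1 | sparse_prime (truncexp T) ((truncexp T).+1 ^ K) p) pw (- (1 - (A - e) / T)) p
     <= expR (k * la + K' * mu + K')].
Proof.
move=> J0 K0 /andP[e0 e1].
have [C C0 mert] := mertens2 (R := R).
have [k2 [c2 [k20 twin]]] := @twin_sum_bound R J J0.
(* [th < 1] makes [la^th] negligible against [la], and the gap down to [th'] absorbs the rounding in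
   [truncexp (th * T)]. *)
pose th := expR (- (e / 8)); pose th' := expR (- (e / 4)).
pose kap := expR (- (e / 2)) / 2.
have kap2 : kap < 1 / 2.
  rewrite /kap ltr_pM2r ?invr_gt0 // -[ltRHS]expR0 ltr_expR; move: e0; clear; lra.
(* Half of the gap below [1/2], so that the final exponent [kap + tau] still satisfies the
   requirement of [le_V]. *)
pose tau := (1 / 2 - kap) / 2.
have tau0 : 0 < tau by rewrite /tau; move: kap2; clear; lra.
have th'th : th' < th by rewrite ltr_expR; move: e0; clear; lra.
have th1 : th <= 1 by rewrite -[leRHS]expR0 ler_expR; move: e0; clear; lra.
have th1' : th < 1 by rewrite -[ltRHS]expR0 ltr_expR; move: e0; clear; lra.
have th0 : 0 < th := expR_gt0 _.
have th'0 : 0 < th' := expR_gt0 _.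
have eth : expR (- e) / th' = expR (- (3 / 4 * e)).
  by rewrite /th' -expRN -expRD; congr expR; field.
pose KK := 2 * (K + 2)%:R + 2 + k2 + 2 * K%:R + C + 20 + (K + 2)%:R.
have K0R : 0 <= K%:R :> R by [].
have KK0 : 0 <= KK.
  by rewrite /KK natrD; move: k20 C0 K0R; clear; lra.
pose c1 := 6 * ln (J%:R : R).
pose c3 := 4 + `|ln tau|.
pose c0 := c2 + `|c2| + 600 + c1 + 10 * (1 / (th - th')) + 100 / e + 60 / th' + 60 / th + c3 / (1 - th) + 4 * K%:R +
  expR 2 * (1 + C).
exists (kap + tau), (KK + 2), c0; split; [by rewrite /tau; move: kap2; clear; lra|by rewrite addr_ge0|].
move=> c x L la mu nu A T V F cc.
have jj : 0 <= ln (J%:R : R) by rewrite ln_ge0 // ler1n.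
have n1 : 0 <= 1 / (th - th') by apply: divr_ge0; [exact: ler01|rewrite subr_ge0; exact: ltW].
have n2 : 0 <= 100 / e by rewrite divr_ge0 // ltW.
have n3 : 0 <= 60 / th' by rewrite divr_ge0 // ltW.
have n4 : 0 <= 60 / th by rewrite divr_ge0 // ltW.
have n5 : 0 <= c3 / (1 - th) by apply: divr_ge0; [apply: addr_ge0|rewrite subr_ge0].
have n6 : 0 <= expR 2 * (1 + C) by rewrite mulr_ge0 ?expR_ge0 ?addr_ge0 // ltW.
have n7 := normr_ge0 c2.
have [g1 g2 g3 g4] : [/\ c2 <= c, 600 <= c, c1 <= c & 10 * (1 / (th - th')) <= c].
  rewrite /c0 in cc; have := ler_norm (- c2); rewrite normrN.
  move: cc jj n1 n2 n3 n4 n5 n6 n7 K0R; rewrite /c1; clear.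
  move: (1 / (th - th')) (100 / e) (60 / th') (60 / th) (c3 / _) (expR 2 * _) `|c2| (ln J%:R).
  by move=> *; split; lra.
have [g5 g6 g7 g8] : [/\ 100 / e <= c, 60 / th' <= c, 60 / th <= c & c3 / (1 - th) <= c].
  rewrite /c0 in cc; have := ler_norm (- c2); rewrite normrN.
  move: cc jj n1 n2 n3 n4 n5 n6 n7 K0R; rewrite /c1; clear.
  move: (1 / (th - th')) (100 / e) (60 / th') (60 / th) (c3 / _) (expR 2 * _) `|c2| (ln J%:R).
  by move=> *; split; lra.
have g9 : 4 * K%:R + 100 + expR 2 * (1 + C) <= c.
  rewrite /c0 in cc; have := ler_norm (- c2); rewrite normrN.
  move: cc jj n1 n2 n3 n4 n5 n6 n7 K0R; rewrite /c1; clear.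
  move: (1 / (th - th')) (100 / e) (60 / th') (60 / th) (c3 / _) (expR 2 * _) `|c2| (ln J%:R).
  by move=> *; lra.
clear cc n1 n2 n3 n4 n5 n6 n7 jj.
have twinF := twin _ _ _ _ _ _ _ _ _ F g1.
have [T1 T2] := T_bounds F J0 g3.
have T3 : expR (3 * mu + 3) <= T.
  by apply: (polylog_le_T J0 F _ _ g3); move: g2; clear; lra.
have eA := expA F.
have [[h1 h2 h3 h4 h5] [h6 h7 _ _ _]] := fr_pos F J0.
have [_ _ emu enu _ cn cnu cmu _ AE TE _] := F.
have T0 : 0 < T by rewrite TE expR_gt0.
clear TE twin F T1 h4 c0 x V.
have cmu' : c <= mu.
  by apply: le_trans cnu; rewrite ler_peMr //; move: g2; clear; lra.
have mu1 : 1 <= mu := le_trans h1 h2.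
have la1 : 1 <= la := le_trans mu1 h3.
have la0 : 0 < la := lt_le_trans ltr01 la1.
have cla : c <= la := le_trans cmu' h3.
have laT : la * la ^+ 2 <= T.
  apply: le_trans T3; rewrite -exprS -emu -expRM_natl ler_expR; clear; lra.
have la2 : 1 <= la ^+ 2 by apply: exprn_ege1.
have lamu : 600 * mu <= la.
  by apply: le_trans cmu; rewrite ler_wpM2r // (le_trans ler01).
have laleT : la <= T by apply: le_trans laT; rewrite ler_peMr // ltW.
set eta := A - e.
have /andP[l2 l2'] := @ln2_bounds R.
have eta1 : mu <= eta by rewrite /eta AE; move: g2 cn l2' e1; clear; lra.
have eta2 : eta <= 2 * mu by rewrite /eta; move: h7 e0; clear; lra.
have eta3 : eta <= mu + nu by rewrite /eta AE; move: l2 e0; clear; lra.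
have etaE : expR eta = expR (- e) * (la * mu / 2) by rewrite /eta expRD eA mulrC.
have eta0 : 0 < eta by apply: lt_le_trans eta1; exact: lt_le_trans mu1.
have d0 : 0 < eta / T by apply: divr_gt0.
have d1 : eta / T <= 1 / 8.
  rewrite ler_pdivrMr //; move: eta2 lamu laleT mu1; clear; lra.
have d2 : eta / T <= e / 4.
  rewrite ler_pdivrMr //.
  have : 100 <= e * la by rewrite mulrC -ler_pdivrMr //; exact: le_trans cla.
  have q1 : 100 / e * mu <= la.
    by apply: le_trans cmu; rewrite ler_wpM2r // (le_trans ler01).
  have q2 : 100 * mu <= e * la.
    have := ler_wpM2l (ltW e0) q1; rewrite mulrA mulrCA divff ?gt_eqF // mulr1.
    by [].
  have q3 : e * la <= e * T by rewrite ler_pM2l.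
  by move: q2 q3 eta2 mu1; clear; lra.
split; first by rewrite d0.
move=> M lM.
set y := truncexp T; set Q := y.+1.
have y0 : (0 < y)%N by apply: truncexp_ge; have := expR_ge1Dx T; move: T0; clear; lra.
have TQ : T <= lnn Q := ln_truncexpS_ge T.
have QT : lnn Q <= T + 1 by apply: ln_truncexpS_le; exact: ltW.
have lQ : lnn Q <= expR (la + 1).
  apply: le_trans QT _; rewrite expRD; have := expR_ge1Dx (1 : R); have := expR_ge1Dx la.
  by move: T2 la1; clear; nra.
have dQ : eta / T * lnn Q <= 2 * mu + 1.
  apply: le_trans (ler_wpM2l (ltW d0) QT) _; rewrite mulrDr divfK ?gt_eqF // mulr1.
  by move: eta2 d1; clear; lra.
have thT : 2 <= th * T.
  have : 60 <= th * la by rewrite mulrC -ler_pdivrMr //; exact: le_trans cla.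
  have : th * la <= th * T by rewrite ler_pM2l.
  by clear; lra.
have thT' : 1 / (th - th') <= T.
  have q : 0 <= 1 / (th - th') by apply: divr_ge0; [exact: ler01|rewrite subr_ge0; exact: ltW].
  by apply: le_trans laleT; apply: le_trans cla; move: q g4; clear; lra.
have laT' : 6 * la * mu <= th' * T.
  have q1 : 60 <= th' * la by rewrite mulrC -ler_pdivrMr //; exact: le_trans cla.
  have q2 : th' * (la * la ^+ 2) <= th' * T by rewrite ler_pM2l.
  have q3 : 60 * la ^+ 2 <= th' * la * la ^+ 2 by rewrite ler_wpM2r // (le_trans ler01).
  have q4 : la * mu <= la ^+ 2 by rewrite expr2 ler_pM2l.
  by move: q1 q2 q3 q4 la2; rewrite mulrA; clear; lra.
(* The left side is at most [la^th] times a constant multiple of [mu^2]. In logarithms the gap is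
   [(1 - th) * mu], and it dominates any fixed multiple of [nu = ln mu]. *)
have tauP : (2 * mu + 1) * expR (th * eta) <= tau * la.
  have q1 : 2 * mu + 1 <= expR (2 + nu).
    rewrite expRD enu; have := expR_ge1Dx (2 : R); move: mu1; clear; nra.
  apply: le_trans (ler_wpM2r (expR_ge0 _) q1) _.
  rewrite -[tau in leRHS]lnK ?posrE // -emu -!expRD ler_expR.
  have q2 : th * eta <= th * mu + nu.
    have : th * eta <= th * (mu + nu) by rewrite ler_pM2l.
    have : th * nu <= nu by rewrite ler_piMl // (le_trans ler01).
    by clear; lra.
  have q3 : c3 * nu <= (1 - th) * mu.
    have t1 : 0 < 1 - th by rewrite subr_gt0.
    have : c3 <= c * (1 - th) by rewrite -ler_pdivrMr.
    move=> /(ler_wpM2r (le_trans ler01 h1)) q.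
    have := ler_wpM2r (ltW t1) cnu; move: q; clear; lra.
  have q4 : c3 <= c3 * nu by rewrite ler_peMr // addr_ge0.
  have q5 : nu * 4 <= c3 * nu.
    by rewrite mulrC ler_wpM2r ?(le_trans ler01) // lerDl.
  have q6 : (4 + `|ln tau|) * nu <= (1 - th) * mu by [].
  have q7 : `|ln tau| <= `|ln tau| * nu by rewrite ler_peMr.
  have q8 := ler_norm (- ln tau); rewrite normrN in q8.
  by move: q2 q6 q7 q8 h1; clear; lra.
have S1 := small_prime_sum_bound mert (ltW C0) (introT andP (conj e0 e1)) mu1 la1 eta1 eta2
  etaE th'0 th'th th1 eth thT thT' d2 laT' tauP.
have H0 : 0 <= expR (k2 * mu + k2) / T by rewrite divr_ge0 ?expR_ge0 // ltW.
have dd : 0 < eta / T <= 1 / 8 by rewrite d0.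
have dd' : 0 < la ^+ 2 / T <= 1 / 8.
  rewrite divr_gt0 ?exprn_gt0 //= ler_pdivrMr //.
  have : 600 * la ^+ 2 <= la * la ^+ 2 by rewrite ler_wpM2r ?(le_trans ler01) // (le_trans g2).
  by move: laT la2; clear; lra.
have HH a : (0 < a <= M)%N ->
  \sum_((truncexp (T / la ^+ 2)).+1 <= l < y.+1 | prime l && prime (a * l + 1)) l%:R^-1 <=
    expR (k2 * mu + k2) / T.
  move=> /andP[a0 aM]; apply: twinF => //; apply: le_trans lM; exact: lnn_le.
apply: le_trans (sparse_prime_sum_le dd dd' H0 y0 K0 HH) _.
have PA := part_a_bound (K + 2) mert (ltW C0) (ltn0Sn y) la1 emu dQ lQ.
have mula2 : 2 * mu <= la by move: lamu mu1; clear; lra.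
have dT : eta / T * T <= 2 * mu by rewrite divfK // gt_eqF.
have laK : 3 * K%:R + K%:R + 2 + expR 2 * (1 + C) + 6 <= la.
  by apply: le_trans cla; apply: le_trans g9; move: (expR 2 * _); clear; move=> *; lra.
have fl2 : 2 <= expR (T / la ^+ 2).
  have : 1 <= T / la ^+ 2.
    rewrite ler_pdivlMr ?exprn_gt0 // mul1r; apply: le_trans laT.
    by rewrite ler_peMl // (le_trans ler01).
  by have := expR_ge1Dx (T / la ^+ 2); clear; lra.
have PB1 := part_b1_bound mert (ltW C0) (ltn0Sn y) mu1 mula2 T2 T0 (ltW d0) dT dQ lQ TQ laK fl2.
have T1 : 1 <= T := le_trans la1 laleT.
have PB2 := part_b2_bound K (ltW C0) y0 mu1 T1 H0 dQ (ltW d0) TQ S1 (lexx _).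
set X := (kap + tau) * la + KK * mu + KK.
have kl : 0 <= (kap + tau) * la.
  by rewrite mulr_ge0 ?addr_ge0 ?(ltW tau0) ?(ltW la0) // divr_ge0 ?expR_ge0.
have E1 : (K + 2)%:R * (2 * mu + 1) + mu + ((K + 2)%:R + 1 + C) <= X.
  have km : 0 <= K%:R * mu by rewrite mulr_ge0 // (le_trans ler01).
  have km2 : 0 <= k2 * mu by rewrite mulr_ge0 // (le_trans ler01).
  have km3 : 0 <= C * mu by rewrite mulr_ge0 ?(ltW C0) // (le_trans ler01).
  rewrite /X /KK natrD; move: kl km km2 km3 K0R k20 C0 mu1; clear.
  by move: ((kap + tau) * la) => *; lra.
have E2 : (kap + tau) * la + (2 * K%:R + 2 + k2) * mu + (K%:R + C + K%:R + 10 + k2) <= X.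
  have km : 0 <= K%:R * mu by rewrite mulr_ge0 // (le_trans ler01).
  have km3 : 0 <= C * mu by rewrite mulr_ge0 ?(ltW C0) // (le_trans ler01).
  rewrite /X /KK natrD; move: kl km km3 K0R k20 C0 mu1; clear.
  by move: ((kap + tau) * la) => *; lra.
have X0 : 0 <= X.
  exact: addr_ge0 (addr_ge0 kl (mulr_ge0 KK0 (le_trans ler01 mu1))) KK0.
apply: le_trans (_ : _ <= expR X + 1 + expR X) _.
  apply: lerD; first apply: lerD.
  - by apply: le_trans PA _; rewrite ler_expR.
  - exact: PB1.
  - by apply: le_trans PB2 _; rewrite ler_expR.
have eX : 1 <= expR X by rewrite -[leLHS]expR0 ler_expR.
apply: le_trans (_ : _ <= expR (X + 2)) _; last first.
  have gen (t u : R) : 1 <= mu -> t + u * mu + u + 2 <= t + (u + 2) * mu + (u + 2).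
    by clear; lra.
  by rewrite ler_expR; exact: gen.
by rewrite [expR (X + 2)]expRD; have := ler_wpM2l (expR_ge0 X) (expR_ge1Dx (2 : R)); move: eX; clear; lra.
Qed.

End SparseAsym.

(** * The size of each error term *)

Local Open Scope ring_scope.

Section ErrorTerms.
Context {R : realType}.
Local Notation lnn := (@lnn R).
Local Notation pw := (@pw R).
Local Notation recip_sum := (@recip_sum R).

(** The saving is [delta * L = J T - e L / T], by [J T^2 = L A]; the loss [e L / T = e C V] fits
    into [eps V / 4]. *)
Lemma term_sparse (L T A V e eps C SP : R) N J :
  0 < T -> J%:R * T ^+ 2 = L * A -> L / T = C * V -> e * C <= eps / 4 -> 0 <= V -> 0 <= eps ->
  0 < (A - e) / T <= 1 -> lnn (N + N) <= L + 1 -> SP <= eps / 4 * V ->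
  2 * (pw (1 - (A - e) / T) (N + N) * expR (SP + 5)) <=
  2 * expR 6 * (expR (L - J%:R * T) * expR (eps * V)).
Proof.
move=> T0 TE LT eC V0 eps0 /andP[d0 d1] lN SPV.
rewrite -mulrA ler_pM2l // /pw -!expRD ler_expR.
have h1 : (1 - (A - e) / T) * lnn (N + N) <= (1 - (A - e) / T) * (L + 1).
  by rewrite ler_wpM2l // subr_ge0.
have h2 : (A - e) / T * L = J%:R * T - e * (L / T).
  have -> : J%:R * T = L * A / T by rewrite -TE expr2 mulrA mulfK // gt_eqF.
  by ring.
have h3 : e * (L / T) <= eps / 4 * V by rewrite LT mulrA ler_wpM2r.
have h4 : 0 <= eps * V by rewrite mulr_ge0.
move: h1 h2 h3 h4 d0 SPV; set d := (A - e) / T; set X := (1 - d) * lnn _; set LT' := e * _.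
by set W := J%:R * T; clear; lra.
Qed.

Lemma term_square (L T : R) Q J N : 0 <= T -> N%:R <= expR L -> expR T <= Q%:R ->
  N%:R * (6 / (Q ^ J)%:R) <= 6 * expR (L - J%:R * T).
Proof.
move=> T0 NL TQ; rewrite expRD expRN expRM_natl.
have e0 : 0 < expR T := expR_gt0 T.
have Q0 : 0 < Q%:R :> R by apply: lt_le_trans TQ.
have -> : 6 * (expR L / expR T ^+ J) = expR L * (6 / expR T ^+ J) by ring.
have h0 : 0 <= 6 / (Q ^ J)%:R :> R by apply: divr_ge0.
have h1 : 6 / (Q ^ J)%:R <= 6 / expR T ^+ J.
  rewrite natrX ler_wpM2l // lef_pV2 ?posrE ?exprn_gt0 //.
  by rewrite lerXn2r // nnegrE ltW.
exact: ler_pM (ler0n _ _) h0 NL h1.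
Qed.

(** With [delta = 3 J T / L] Rankin's method saves [3 J T], and [J0], about [e^(2 L / 3)], returns
    [2 J T]. The exponent is harmless for smooth numbers: [delta * J T = 3 J A], so [Yn^delta] is
    only a power of [log L]. The term [0 * la] keeps the form required by [le_V]. *)
Lemma term_friable (C L T A la mu : R) J N J0 Yn
  (mert : forall N, (2 <= N)%N ->
    ln (lnn N) - C <= recip_sum N /\ recip_sum N <= ln (lnn N) + C) :
  0 <= C -> 1 <= mu -> 1 <= la -> expR mu = la -> expR la = L -> 0 < T -> J%:R * T ^+ 2 = L * A ->
  A <= 2 * mu -> J%:R * T <= L -> 0 < 3 * J%:R * T / L <= 1 / 4 ->
  (0 < N)%N -> lnn N <= L -> lnn J0 <= 2 / 3 * L + 1 -> (0 < Yn)%N -> lnn Yn <= J%:R * T ->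
  12 <= L ->
  pw (1 - 3 * J%:R * T / L) N * (pw (3 * J%:R * T / L) J0 * (1 + lnn J0)) *
    expR (pw (3 * J%:R * T / L) Yn * recip_sum Yn + 5) <=
  expR 6 * (expR (L - J%:R * T) * ((1 + L) *
     expR (expR (0 * la + (6 * J%:R + 1 + C) * mu + (6 * J%:R + 1 + C))))).
Proof.
move=> C0 mu1 la1 emu ela T0 TE Amu JTL /andP[]; set d := 3 * _ * _ / _.
move=> d0 d1 N0 lN lJ Y0 lY L12.
have L0 : 0 < L by lra.
have d1' : 0 <= 1 - d by lra.
have a1 : pw (1 - d) N <= expR ((1 - d) * L) by rewrite ler_expR ler_wpM2l.
have a2 : pw d J0 <= expR (d * (2 / 3 * L + 1)) by rewrite ler_expR ler_wpM2l // ltW.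
have a3 : 1 + lnn J0 <= 1 + L by move: lJ L12; clear; lra.
have dL : d * L = 3 * (J%:R * T) by rewrite /d divfK ?gt_eqF // mulrA.
have JT2 : d * (J%:R * T) = 3 * J%:R * A.
  have -> : d * (J%:R * T) = 3 * J%:R * (J%:R * T ^+ 2) / L by rewrite /d; ring.
  by rewrite TE; field; rewrite gt_eqF.
have a4 : pw d Yn <= expR (6 * J%:R * mu).
  rewrite ler_expR; apply: le_trans (ler_wpM2l (ltW d0) lY) _; rewrite JT2.
  have : J%:R * A <= J%:R * (2 * mu) by rewrite ler_wpM2l.
  by clear; lra.
have a5 : recip_sum Yn <= la + C.
  apply: (recip_sum_le_ln mert) => //; first by lra.
  by rewrite ela; apply: le_trans lY JTL.
have r0 : 0 <= recip_sum Yn by apply: sumr_ge0 => p _; rewrite invr_ge0.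
have a6 : la + C <= expR (mu + C).
  rewrite expRD emu; have := ler_wpM2l (le_trans ler01 la1) (expR_ge1Dx C).
  have : C <= la * C by rewrite ler_peMl.
  by clear; lra.
have J0' : 0 <= J%:R :> R by [].
have a7 : pw d Yn * recip_sum Yn <=
    expR (0 * la + (6 * J%:R + 1 + C) * mu + (6 * J%:R + 1 + C)).
  apply: le_trans (ler_pM (pw_ge0 _ _) r0 a4 (le_trans a5 a6)) _.
  rewrite -expRD ler_expR.
  have : 0 <= C * mu by rewrite mulr_ge0 // (le_trans ler01).
  by move: mu1 C0 J0'; clear; lra.
have l0 : 0 <= 1 + lnn J0 by rewrite addr_ge0 ?lnn_ge0.
apply: le_trans (_ : _ <= expR ((1 - d) * L) * (expR (d * (2 / 3 * L + 1)) * (1 + L)) *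
    expR (expR (0 * la + (6 * J%:R + 1 + C) * mu + (6 * J%:R + 1 + C)) + 5)) _.
  apply: ler_pM; [|exact: expR_ge0| |].
  - exact: mulr_ge0 (pw_ge0 _ _) (mulr_ge0 (pw_ge0 _ _) l0).
  - apply: ler_pM a1 _; [exact: pw_ge0|exact: mulr_ge0 (pw_ge0 _ _) l0|].
    exact: ler_pM (pw_ge0 _ _) l0 a2 a3.
  - by rewrite ler_expR lerD2r.
rewrite expRD; set Z := expR (expR _).
have -> : expR ((1 - d) * L) * (expR (d * (2 / 3 * L + 1)) * (1 + L)) * (Z * expR 5) =
  (expR ((1 - d) * L) * expR (d * (2 / 3 * L + 1)) * expR 5) * ((1 + L) * Z) by ring.
rewrite [leRHS]mulrA; apply: ler_wpM2r.
  by apply: mulr_ge0; [rewrite addr_ge0 // ltW|exact: expR_ge0].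
rewrite -!expRD ler_expR; move: dL d1; clear; set W := J%:R * T; lra.
Qed.

(** The prefactor is at most [7 x e^(J T)], because [E] is about [x e^(- J T)] and [h <= e^T]. The
    congruences save [Q^(2 J) >= e^(2 J T)], leaving [x e^(- J T)]; this is why products as large as
    [Q^(2 J)] were collected. *)
Lemma term_cases (L T l : R) J N E h Q : (0 < J)%N -> 0 < T -> 0 <= L - J%:R * T -> N%:R <= expR L ->
  expR (L - J%:R * T) <= E.+1%:R -> h%:R <= expR T -> expR T <= Q%:R -> 0 <= l ->
  (N%:R + 2 * N%:R ^+ 2 / E.+1%:R + 2 * N%:R * (1 + h%:R)) *
    (l / (Q ^ (2 * J))%:R) * ((2 * J).+1%:R * l ^+ (2 * (2 * J))) <=
  7 * (2 * J).+1%:R * (expR (L - J%:R * T) * l ^+ (4 * J).+1).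
Proof.
move=> J1 T0 LJ NL EL hT TQ l0.
have JT : T <= J%:R * T by rewrite ler_peMl ?(ltW T0) // ler1n.
have JT0 : 0 <= J%:R * T := le_trans (ltW T0) JT.
have eJ : 1 <= expR (J%:R * T) by rewrite -[leLHS]expR0 ler_expR.
have x0 := expR_gt0 L.
have e1 : N%:R ^+ 2 / E.+1%:R <= expR L * expR (J%:R * T).
  rewrite ler_pdivrMr ?ltr0n //.
  apply: le_trans (_ : _ <= expR L * expR (J%:R * T) * expR (L - J%:R * T)) _; last first.
    by rewrite ler_wpM2l // mulr_ge0 ?expR_ge0.
  rewrite -!expRD (_ : L + J%:R * T + (L - J%:R * T) = 2 * L); last by ring.
  by rewrite expRM_natl lerXn2r ?nnegrE ?expR_ge0.
have e2 : N%:R * (1 + h%:R) <= expR L * (1 + expR (J%:R * T)).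
  apply: ler_pM => //; rewrite ?addr_ge0 // lerD2l.
  by apply: le_trans hT _; rewrite ler_expR.
have e3 : N%:R + 2 * N%:R ^+ 2 / E.+1%:R + 2 * N%:R * (1 + h%:R) <=
    7 * (expR L * expR (J%:R * T)).
  have h1 : expR L <= expR L * expR (J%:R * T) by rewrite ler_peMr ?(ltW x0).
  have -> : N%:R + 2 * N%:R ^+ 2 / E.+1%:R + 2 * N%:R * (1 + h%:R) =
    N%:R + 2 * (N%:R ^+ 2 / E.+1%:R) + 2 * (N%:R * (1 + h%:R)) :> R by ring.
  have gen (a b n u v : R) : a <= u -> b <= v + u -> v <= u -> n <= v ->
      n + 2 * a + 2 * b <= 7 * u by clear; lra.
  apply: gen e1 _ h1 NL; apply: le_trans e2 _.
  by rewrite [leLHS]mulrDr mulr1.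
have Q0 : 0 < Q%:R :> R by apply: lt_le_trans TQ; exact: expR_gt0.
have e4 : l / (Q ^ (2 * J))%:R <= l * expR (- (2 * (J%:R * T))).
  apply: ler_wpM2l => //; rewrite expRN mulrA -natrM expRM_natl natrX.
  rewrite lef_pV2 ?posrE ?exprn_gt0 ?expR_gt0 //.
  by rewrite lerXn2r // nnegrE ?expR_ge0 // ltW.
have s0 : 0 <= (2 * J).+1%:R * l ^+ (2 * (2 * J)) by rewrite mulr_ge0 // exprn_ge0.
have w0 : 0 <= N%:R + 2 * N%:R ^+ 2 / E.+1%:R + 2 * N%:R * (1 + h%:R) :> R.
  by rewrite !addr_ge0 // ?divr_ge0 ?mulr_ge0 ?addr_ge0 // exprn_ge0.
have q0 : 0 <= l / (Q ^ (2 * J))%:R by rewrite divr_ge0.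
apply: le_trans (ler_wpM2r s0 (ler_pM w0 q0 e3 e4)) _.
rewrite le_eqVlt; apply/orP; left; apply/eqP.
have -> : (4 * J).+1 = (1 + 2 * (2 * J))%N by clear; lia.
have -> : expR (L - J%:R * T) = expR L * expR (J%:R * T) * expR (- (2 * (J%:R * T))).
  by rewrite -!expRD; congr expR; ring.
by rewrite exprD expr1; ring.
Qed.

End ErrorTerms.

(** * Assembly, and the passage from fixed eps to a function tending to 0 *)

Local Open Scope classical_set_scope.
Local Open Scope ring_scope.

Section Final.
Context {R : realType}.
Local Notation lnn := (@lnn R).
Local Notation pw := (@pw R).
Local Notation recip_sum := (@recip_sum R).

Lemma scaleY_T (J : nat) (x : R) : (0 < J)%N ->
  Num.sqrt J%:R * scaleG x = J%:R * scaleT J x.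
Proof.
move=> J0; rewrite /scaleT; have s0 : 0 < Num.sqrt J%:R :> R by rewrite sqrtr_gt0 ltr0n.
rewrite -{2}[J%:R](@sqr_sqrtr R) // expr2; field; rewrite gt_eqF //.
Qed.

(** In order: sparse integers, squares (6) together with pairs (1), the degenerate case, and cases A
    and B. *)
Definition error_const (J : nat) : R := 2 * expR 6 + 7 + expR 6 + 7 * (2 * J).+1%:R.

Theorem phi_asym (J : nat) (eps : R) : (0 < J)%N -> 0 < eps ->
  exists c0 : R, forall x, c0 <= iter 4 (@ln R) x ->
  forall h : nat, (1 <= h)%N -> h%:R <= scaley J x ->
  `| (S_phi h x)%:R - (D_phi h (scaleY J x) x)%:R | <=
    error_const J * (x * expR (- (Num.sqrt J%:R * scaleG x) + eps * scaleV x)).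
Proof.
move=> J0 eps0.
have [C C0 mert] := mertens2 (R := R).
pose sJ := expR (ln (J%:R : R) / 2).
have sJ0 : 0 < sJ by apply: expR_gt0.
(* [sJ] is the square root of [J], the ratio of [L / T] to [V]; hence the margin [e] costs at most
   [eps V / 4]. *)
pose e := Num.min 1 (eps / (4 * sJ)).
have e01 : 0 < e <= 1.
  rewrite /e lt_min ltr01 ge_min lexx /= andbT; apply: divr_gt0 => //; exact: mulr_gt0.
have eC : e * sJ <= eps / 4.
  apply: le_trans (_ : _ <= eps / (4 * sJ) * sJ) _.
    by rewrite ler_pM2r // /e ge_min lexx orbT.
  by rewrite le_eqVlt; apply/orP; left; apply/eqP; field; rewrite gt_eqF.
pose K := (2 * J + 2 * J * (8 * J).+1)%N.
have K0 : (0 < K)%N by rewrite addn_gt0 muln_gt0 J0.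
have [k [K' [c1 [k2 K'0 sp]]]] := sparse_asym J0 K0 e01.
have eps4 : 0 < eps / 4 by apply: divr_gt0.
have eps2 : 0 < eps / 2 by apply: divr_gt0.
have [c2 V1] := le_V J0 k2 K'0 eps4.
have half0 : (0 : R) < 1 / 2 by apply: divr_gt0.
have J0R : 0 <= J%:R :> R by [].
have m1 : 0 <= 6 * J%:R + 1 + C by rewrite !addr_ge0 ?mulr_ge0 ?(ltW C0).
have [c3 V2] := le_V J0 half0 m1 eps4.
have m2 : 0 <= 4 * J%:R + 2 :> R by rewrite addr_ge0 ?mulr_ge0.
have [c4 V3] := le_V J0 half0 m2 eps2.
pose c := `|c1| + `|c2| + `|c3| + `|c4| + 6 * ln (J%:R : R) + 600 + (2 ^ (8 * J)).+1%:R.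
have jj : 0 <= ln (J%:R : R) by rewrite ln_ge0 // ler1n.
have q0 : 0 <= (2 ^ (8 * J)).+1%:R :> R by [].
have [g1 g2 g3 g4] : [/\ c1 <= c, c2 <= c, c3 <= c & c4 <= c].
  have := ler_norm c1; have := ler_norm c2; have := ler_norm c3; have := ler_norm c4.
  have := normr_ge0 c1; have := normr_ge0 c2; have := normr_ge0 c3; have := normr_ge0 c4.
  move: jj q0; rewrite /c; clear.
  by move: `|c1| `|c2| `|c3| `|c4| (ln _) (_.+1%:R) => *; split; lra.
have [g5 g6 g7] : [/\ 600 <= c, 6 * ln (J%:R : R) <= c & (2 ^ (8 * J)).+1%:R <= c].
  have := normr_ge0 c1; have := normr_ge0 c2; have := normr_ge0 c3; have := normr_ge0 c4.
  move: jj q0; rewrite /c; clear.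
  by move: `|c1| `|c2| `|c3| `|c4| (ln _) (_.+1%:R) => *; split; lra.
exists (2 * c) => x cx h h1 hy.
have c11 : 1 <= c by move: g5; clear; lra.
have F := frame_exists J0 c11 cx.
have V1F := V1 _ _ _ _ _ _ _ _ _ F g2.
have V2F := V2 _ _ _ _ _ _ _ _ _ F g3.
have V3F := V3 _ _ _ _ _ _ _ _ _ F g4.
have [d01 spF] := sp _ _ _ _ _ _ _ _ _ F g1.
have [T1 T2] := T_bounds F J0 g6.
have T3 : expR (2 * iter 3 (@ln R) x + 2) <= scaleT J x.
  by apply: (polylog_le_T J0 F _ _ g6) => //; move: g5; clear; lra.
have TE := T_sq F J0; have LT := L_div_T F.
have [[n1 nm ml lL A1] [mA Am _ _ _]] := fr_pos F J0.
have [eL ela emu enu _ cn cnu cmu cla AE TTE VVE] := F.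
have yE : scaley J x = expR (scaleT J x) by [].
have YE : scaleY J x = expR (J%:R * scaleT J x) by rewrite /scaleY scaleY_T.
rewrite scaleY_T // YE; rewrite yE in hy.
have rhsE : x * expR (- (J%:R * scaleT J x) + eps * scaleV x) =
    expR (ln x - J%:R * scaleT J x) * expR (eps * scaleV x).
  by rewrite -{1}eL -!expRD; congr expR; ring.
rewrite rhsE.
have T0 : 0 < scaleT J x by rewrite TTE expR_gt0.
have V0 : 0 < scaleV x by rewrite VVE expR_gt0.
clear TTE VVE rhsE yE YE cx F V1 V2 V3 sp g1 g2 g3 g4 c11 enu cn cnu.
move: (ln x) (iter 2 (@ln R) x) (iter 3 (@ln R) x) (iter 4 (@ln R) x) (scaleA x) (scaleT J x) (scaleV x)
  V1F V2F V3F d01 spF T1 T2 T3 TE LT n1 nm ml lL A1 mA Am eL ela emu cmu cla AE T0 V0 hy.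
move=> L la mu nu A T V V1F V2F V3F d01 spF T1 T2 T3 TE LT n1 nm ml lL A1 mA Am eL ela emu cmu cla AE T0 V0 hy.
have mu1 : 1 <= mu := le_trans n1 nm.
have la1 : 1 <= la := le_trans mu1 ml.
have L1 : 1 <= L := le_trans la1 lL.
have L0 : 0 < L := lt_le_trans ltr01 L1.
have muc : 600 * mu <= la by apply: le_trans cmu; rewrite ler_wpM2r // (le_trans ler01).
have lac : 600 * la <= L by apply: le_trans cla; rewrite ler_wpM2r // (le_trans ler01).
have laT : la <= T.
  apply: le_trans T3; rewrite -emu ler_expR; move: mu1; clear; lra.
have AT : 12 * A <= T by move: Am muc laT mu1; clear; lra.
have JTE : J%:R * T = L * A / T by rewrite -TE expr2 mulrA mulfK // gt_eqF.
have JT12 : 12 * (J%:R * T) <= L.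
  rewrite JTE mulrA ler_pdivrMr //; have := ler_wpM2l (ltW L0) AT; clear; lra.
have J1R : 1 <= J%:R :> R by rewrite ler1n.
have TJT : T <= J%:R * T by rewrite ler_peMl // ltW.
have JT0 : 0 < J%:R * T := lt_le_trans T0 TJT.
have TL : T <= L by move: JT12 TJT JT0; clear; lra.
have LJ0 : 0 <= L - J%:R * T by move: JT12 JT0; clear; lra.
have L600 : 600 <= L by move: lac la1; clear; lra.
pose N := Num.truncn x.
have NL : N = truncexp L by rewrite /N /truncexp eL.
(* [E] is as large as the target error allows for the pairs. [J0'] must exceed [(2 y N)^(1/2)]; the
   exponent [2/3] is ample as [12 T <= L], and being below 1 it leaves a net saving in the
   degenerate case. *)
pose y := truncexp T; pose E := truncexp (L - J%:R * T); pose J0' := (truncexp (2 / 3 * L)).+1.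
pose Yn := Num.truncn (expR (J%:R * T)).
have flm (s t : R) : s <= t -> (truncexp s <= truncexp t)%N by move=> st; apply: le_truncn; rewrite ler_expR.
have yN : (y <= N)%N by rewrite NL; apply: flm.
have y0 : (0 < y)%N by apply: truncexp_ge; have := expR_ge1Dx T; move: T0; clear; lra.
have hy' : (0 < h <= y)%N by rewrite h1 /=; apply: truncexp_ge.
have EN' : (E <= N)%N by rewrite NL; apply: flm; rewrite gerBl ltW.
have N0 : (0 < N)%N := leq_trans y0 yN.
have EN : (E < 2 * N)%N by rewrite mul2n -addnn; apply: leq_ltn_trans EN' _; rewrite -addn1 leq_add2l.
have tN : (2 ^ (8 * J) < N)%N.
  rewrite NL; apply: truncexp_ge; apply: le_trans g7 _.
  apply: le_trans (_ : _ <= L) _.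
    by apply: le_trans cla; exact: ler_peMr (le_trans (ler0n _ 600) g5) la1.
  by have := expR_ge1Dx L; clear; lra.
have [NxL NxL'] := truncexp_bounds L; rewrite -NL in NxL NxL'.
have [yT yT'] := truncexp_bounds T; rewrite -/y in yT yT'.
have [EX EX'] := truncexp_bounds (L - J%:R * T); rewrite -/E in EX EX'.
have JJ : (2 * y * N <= J0' ^ 2)%N.
  rewrite -(ler_nat R) [leRHS]natrX !natrM.
  have [_ jq] := truncexp_bounds (2 / 3 * L); rewrite -/J0' in jq.
  apply: le_trans (_ : _ <= expR (2 / 3 * L) ^+ 2) _; last first.
    by rewrite lerXn2r ?nnegrE ?expR_ge0 // ltW.
  apply: le_trans (_ : _ <= expR 1 * expR T * expR L) _.
    apply: ler_pM; rewrite ?mulr_ge0 //; apply: ler_pM => //.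
    by have := expR_ge1Dx (1 : R); clear; lra.
  rewrite -!expRD -expRM_natl ler_expR; move: JT12 TJT L600; clear; lra.
have dd : 0 < (A - e) / T <= 1 / 4.
  by move: d01 => /andP[-> /=]; clear; lra.
have dd2 : 0 < 3 * J%:R * T / L <= 1 / 4.
  have -> : 3 * J%:R * T / L = 3 * (J%:R * T) / L by rewrite mulrA.
  rewrite ler_pdivrMr // divr_gt0 ?mulr_gt0 ?ltr0n //=.
  by move: JT12; clear; lra.
have Y0 : 0 <= expR (J%:R * T) := expR_ge0 _.
have := phi_diff_le J0 y0 hy' yN Y0 EN tN JJ dd dd2.
rewrite -/N -/Yn => H; apply: le_trans H _.
have lN2 : lnn (N + N) <= L + 1.
  rewrite addnn -muln2 mulnC lnnM //; have := ln_truncexp_le (ltW L0); rewrite -NL.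
  by have /andP[_] := @ln2_bounds R; rewrite /lnn; clear; lra.
have SPV := le_trans (spF (N + N)%N lN2) V1F.
have dd1 : 0 < (A - e) / T <= 1 by move: d01 => /andP[-> /=]; clear; lra.
have t1 := term_sparse T0 TE LT eC (ltW V0) (ltW eps0) dd1 lN2 SPV.
have yTQ : expR T <= y.+1%:R := ltW yT'.
have t2 := @term_square R L T y.+1 J N (ltW T0) NxL yTQ.
have l1 : 1 <= 1 + lnn (N + N) by rewrite lerDl lnn_ge0.
have l2 : 1 + lnn (N + N) <= expR (la + 1).
  rewrite expRD ela; have := ler_wpM2l (ltW L0) (expR_ge1Dx (1 : R)).
  by move: lN2 L600; clear; lra.
have eV0 : 1 <= expR (eps / 2 * V).
  by rewrite -[leLHS]expR0 ler_expR mulr_ge0 ?(ltW eps2) ?(ltW V0).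
have lm m : (m <= (4 * J).+1)%N -> expR (m%:R * (la + 1)) <= expR (eps / 2 * V).
  move=> mJ; rewrite ler_expR; apply: le_trans V3F; rewrite mul0r add0r.
  apply: le_trans (_ : _ <= expR (4 * J%:R + 1) * expR (mu + 1)) _; last first.
    rewrite -expRD ler_expR.
    have : 4 * J%:R * 1 <= 4 * J%:R * mu by rewrite ler_wpM2l ?mulr_ge0.
    by move: mu1 J0R; clear; lra.
  apply: ler_pM => //; first by rewrite addr_ge0 // (le_trans ler01).
    apply: le_trans (_ : _ <= 4 * J%:R + 1) _.
      by rewrite -natrM natr1 ler_nat.
    by have := expR_ge1Dx (4 * J%:R + 1 : R); clear; lra.
  rewrite expRD emu; have := ler_wpM2l (le_trans ler01 la1) (expR_ge1Dx (1 : R)).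
  by move: la1; clear; lra.
have lpow m : (m <= (4 * J).+1)%N -> (1 + lnn (N + N)) ^+ m <= expR (eps / 2 * V).
  move=> mJ; apply: le_trans (lm m mJ); rewrite expRM_natl.
  by rewrite lerXn2r ?nnegrE ?expR_ge0 // (le_trans ler01).
have L2 : 1 + L <= expR (eps / 2 * V).
  apply: le_trans (lm 1%N (ltn0Sn _)); rewrite mul1r expRD ela.
  have := ler_wpM2l (ltW L0) (expR_ge1Dx (1 : R)).
  by move: L600; clear; lra.
have X0 := expR_ge0 (L - J%:R * T).
have eVV : expR (eps / 2 * V) <= expR (eps * V).
  by rewrite ler_expR; have := mulr_ge0 (ltW eps0) (ltW V0); clear; lra.
have t3 : E%:R * (1 + lnn E) <= expR (L - J%:R * T) * expR (eps * V).
  apply: ler_pM => //; first by rewrite addr_ge0 // lnn_ge0.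
  apply: le_trans eVV; apply: le_trans L2; rewrite lerD2l.
  by apply: le_trans (ln_truncexp_le LJ0) _; rewrite gerBl ltW.
have lJ0 : lnn J0' <= 2 / 3 * L + 1.
  by apply: ln_truncexpS_le; rewrite mulr_ge0 ?(ltW L0) // divr_ge0.
have Yn0 : (0 < Yn)%N.
  by apply: truncexp_ge; have := expR_ge1Dx (J%:R * T); move: JT0; clear; lra.
have lYn : lnn Yn <= J%:R * T by apply: ln_truncexp_le; exact: ltW.
have lN : lnn N <= L by rewrite NL; apply: ln_truncexp_le; exact: ltW.
have JTL : J%:R * T <= L by move: LJ0; clear; lra.
have L12 : 12 <= L by move: L600; clear; lra.
have t4 := term_friable mert (ltW C0) mu1 la1 emu ela T0 TE Am JTL dd2 N0 lN lJ0 Yn0 lYn L12.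
have t4' : (1 + L) * expR (expR (0 * la + (6 * J%:R + 1 + C) * mu + (6 * J%:R + 1 + C))) <=
    expR (eps * V).
  apply: le_trans (_ : _ <= expR (eps / 2 * V) * expR (eps / 4 * V)) _.
    apply: ler_pM => //; last by rewrite ler_expR.
    by rewrite addr_ge0 // ltW.
  rewrite -expRD ler_expR; have := mulr_ge0 (ltW eps0) (ltW V0); clear; lra.
have l0 : 0 <= 1 + lnn (N + N) := le_trans ler01 l1.
have /andP[_ hy2] := hy'.
have t5 := @term_cases R L T (1 + lnn (N + N)) J N E h y.+1 J0 T0 LJ0 NxL (ltW EX') hy yTQ l0.
have t5' := lpow (4 * J).+1 (leqnn _).
have t2' : 6 * expR (L - J%:R * T) <= 6 * (expR (L - J%:R * T) * expR (eps * V)).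
  rewrite ler_pM2l // ler_peMr // (le_trans _ eVV) //.
have t4'' := le_trans t4 (ler_wpM2l (expR_ge0 6) (ler_wpM2l X0 t4')).
have m7 : 0 <= 7 * (2 * J).+1%:R :> R by rewrite mulr_ge0.
have t5'' := le_trans t5 (ler_wpM2l m7 (ler_wpM2l X0 (le_trans t5' eVV))).
have t2'' := le_trans t2 t2'.
clear -t1 t2'' t3 t4'' t5''.
move: t1 t2'' t3 t4'' t5''; rewrite /error_const.
set Z := expR (L - _) * expR _.
set s1 := 2 * (pw _ _ * _); set s2 := N%:R * (6 / _); set s3 := E%:R * _.
set s4 := pw _ N * _ * _; set s5 := _ * (_ / _) * _; set e6 := expR 6; set jj := (2 * J).+1%:R.
clearbody Z s1 s2 s3 s4 s5 e6 jj; clear=> *; lra.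
Qed.

Lemma iter_ln_ge (c x : R) : expR (expR (expR (expR c))) <= x -> c <= iter 4 (@ln R) x.
Proof.
have lnE (a b : R) : expR a <= b -> a <= ln b.
  move=> ab; have b0 : 0 < b by apply: lt_le_trans ab; exact: expR_gt0.
  by rewrite -[leLHS]expRK ler_ln ?posrE ?expR_gt0.
by move=> h; apply: (lnE); apply: (lnE); apply: (lnE); apply: (lnE).
Qed.

End Final.

Theorem theorem1p1 (R : realType) (J : nat) (hJ : (1 <= J)%N) :
  exists (x0 C : R) (eps : R -> R),
    (eps x @[x --> +oo] --> (0 : R)) /\
    forall x : R, x0 <= x ->
      (forall h : nat, (1 <= h)%N -> h%:R <= scaley J x ->
         `| (S_phi h x)%:R - (D_phi h (scaleY J x) x)%:R |
           <= C * (x * expR (- (Num.sqrt J%:R * scaleG x) + eps x * scaleV x)))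
      /\
      (forall h : nat, odd h -> D_phi h (scaleY J x) x = 0%N).
Proof.
(* The constant depends on [J] alone and is the same for every [eps]. *)
pose C : R := error_const J.
have C0 : 0 <= C by rewrite /C /error_const !addr_ge0 ?mulr_ge0 ?expR_ge0.
(* The condition [0 <= e] bounds the admissible set from below, so that its infimum is meaningful
   and nonnegative. *)
pose ok (x e : R) := 0 <= e /\ forall h : nat, (1 <= h)%N -> h%:R <= scaley J x ->
   `| (S_phi h x)%:R - (D_phi h (scaleY J x) x)%:R |
      <= C * (x * expR (- (Num.sqrt J%:R * scaleG x) + e * scaleV x)).
have thr (e : R) : 0 < e -> exists x0, 0 < x0 /\ forall x, x0 <= x -> ok x e.
  move=> e0; have [c0 H] := phi_asym hJ e0.
  exists (expR (expR (expR (expR c0)))); split=> [|x xx]; first exact: expR_gt0.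
  by split; [exact: ltW|apply: H; exact: iter_ln_ge].
have okS (x e e' : R) : 0 <= x -> 0 <= scaleV x -> e <= e' -> ok x e -> ok x e'.
  move=> x0 V0 ee [e0 H]; split=> [|h h1 hy]; first exact: le_trans ee.
  apply: le_trans (H h h1 hy) _; rewrite ler_wpM2l // ler_wpM2l // ler_expR lerD2l.
  by rewrite ler_wpM2r.
have [x1 [x10 ok1]] := thr 1 ltr01.
(* The infimum need not be admissible; adding [x^-1] makes it so. *)
pose eps x := inf [set e | ok x e] + x^-1.
have lb x : has_lbound [set e | ok x e] by exists 0 => e [].
have inf_le x e : ok x e -> inf [set e | ok x e] <= e.
  by move=> H; apply: ge_inf => //; exact: lb.
have inf_ge0 x e : ok x e -> 0 <= inf [set e | ok x e].
  by move=> H; apply: lb_le_inf; [exists e|move=> e' []].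
have [c0 Vc0] : exists c0 : R, forall x, c0 <= iter 4 (@ln R) x -> 0 <= scaleV x.
  exists 2 => x xc; have xc' : 2 * 1 <= iter 4 (@ln R) x by rewrite mulr1.
  have F := frame_exists hJ (lexx 1) xc'.
  by rewrite (fr_V F) expR_ge0.
pose x0 := Num.max x1 (expR (expR (expR (expR c0)))).
exists x0, C, eps; split; last first.
  move=> x; rewrite ge_max => /andP[xx1 xc]; split; last by move=> h oh; exact: odd_no_diag.
  have x_gt0 : 0 < x by apply: lt_le_trans xx1.
  have V0 : 0 <= scaleV x by apply: Vc0; exact: iter_ln_ge.
  have hi : has_inf [set e | ok x e] by split; [exists 1; exact: ok1|exact: lb].
  have ix : 0 < x^-1 by rewrite invr_gt0.
  have [e' oke' e'x] := inf_adherent ix hi.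
  by have [_ H] := okS _ _ (eps x) (ltW x_gt0) V0 (ltW e'x) oke'.
apply/cvgrPdist_le => e e0.
have e20 : 0 < e / 2 by apply: divr_gt0.
have [x2 [x20 ok2]] := thr _ e20.
exists (x2 + 2 / e); split; first exact: num_real.
move=> x xx; have ie : 0 < 2 / e by apply: divr_gt0.
have x2x : x2 <= x by apply: le_trans (ltW xx); rewrite lerDl ltW.
have ex : 2 / e <= x by apply: le_trans (ltW xx); rewrite lerDr ltW.
have x_gt0 : 0 < x by apply: lt_le_trans ex.
have okx := ok2 _ x2x.
have ix : x^-1 <= e / 2.
  by rewrite -[e / 2]invrK lef_pV2 ?posrE ?invr_gt0 // invf_div.
have i0 := inf_ge0 _ _ okx; have i1 := inf_le _ _ okx.
have ix0 : 0 < x^-1 by rewrite invr_gt0.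
rewrite sub0r normrN /eps ger0_norm; last by rewrite addr_ge0 // ltW.
by move: i1 ix; clear; lra.
Qed.
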